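(* A unitary $u\in\Pi_{k\to\omega}M_{n_k}$ is conjugated to an element of $\Pi_{k\to\omega}P_{n_k}$ if and only if its associated measure $\mu_u$ belongs to the closed convex hull of the set $\{\lambda_i: i\in\mathbb{N}^*\cup\{\infty\}\}$ of Borel measures on $S^1$, where the closure is taken in the topology of setwise convergence on Borel sets.
   Context: $M_n=M_n(\mathbb{C})$ and $P_n\subset M_n$ is the group of permutation matrices. On $M_n$ put $Tr(A)=\frac1n\sum_i a_{ii}$ and $\|A\|_2=\sqrt{Tr(A^*A)}$. Fix a free ultrafilter $\omega$ on $\mathbb{N}$ and a sequence $(n_k)_k$ of positive integers with $\lim_k n_k=\infty$. Define $\Pi_{k\to\omega}M_{n_k}=l^\infty(\mathbb{N},M_{n_k})/\mathcal{N}_\omega$, where $l^\infty(\mathbb{N},M_{n_k})$ is the algebra of sequences $(x_k)$, $x_k\in M_{n_k}$, bounded in operator norm, and $\mathcal{N}_\omega=\{(x_k):\lim_{k\to\omega}\|x_k\|_2=0\}$. The class of $(x_k)$ is denoted $\Pi_{k\to\omega}x_k$, and $Tr(\Pi_{k\to\omega}x_k)=\lim_{k\to\omega}Tr(x_k)$; with this trace $\Pi_{k\to\omega}M_{n_k}$ is a tracial von Neumann algebra. $\Pi_{k\to\omega}P_{n_k}$ is the subgroup of elements having a representative $(p_k)$ with $p_k\in P_{n_k}$ for all $k$. Two elements $x,y$ of $\Pi_{k\to\omega}M_{n_k}$ are conjugated if $y=wxw^*$ for some unitary $w\in\Pi_{k\to\omega}M_{n_k}$. Associated measure: let $S^1=\{z\in\mathbb{C}:|z|=1\}$.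 For a unitary $u$, let $A(u)$ be the (abelian) von Neumann subalgebra generated by $u$. Then $(A(u),Tr)\simeq L^\infty(\sigma(u),\mu_u)$ for a Borel probability measure $\mu_u$ on the spectrum $\sigma(u)\subset S^1$, with $u$ corresponding to the function $z\mapsto z$ and $Tr$ to integration against $\mu_u$. One views $\mu_u$ as a Borel measure on $S^1$; it satisfies $\int_{S^1}z^n\,d\mu_u=Tr(u^n)$ for all $n$. $\mathbb{N}^*$ is the set of positive integers. For $i\in\mathbb{N}^*$, $\lambda_i=\frac1i\sum_{z^i=1}\delta_z$, where $\delta_z$ is the Dirac measure at $z\in S^1$; $\lambda_\infty$ is the normalized (probability) Lebesgue measure on $S^1$. The topology used: $\mu_j\to\mu$ if $\mu_j(A)\to\mu(A)$ for every Borel set $A\subset S^1$ (called the strong topology). *)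

(* Defs.v *)
From HB Require Import structures.
From mathcomp Require Import all_boot all_order all_algebra.
From mathcomp Require Import ring complex.
From mathcomp Require Import all_classical all_reals all_analysis.

Set Implicit Arguments.
Unset Strict Implicit.
Unset Printing Implicit Defensive.

Import Order.TTheory GRing.Theory Num.Theory.
Import numFieldNormedType.Exports.

Local Open Scope classical_set_scope.
Local Open Scope ring_scope.
Local Open Scope complex_scope.
Local Open Scope sesquilinear_scope.

Section L2.
Variables (R : realType) (I : finType).
Local Notation C := R[i].
Implicit Types (z w : I -> C) (a b : I -> R).

Definition l2 z : R := Num.sqrt (\sum_i Normc.normc (z i) ^+ 2).

Lemma normc_ge0 (x : C) : 0 <= Normc.normc x.
Proof. by case: x => x y; rewrite sqrtr_ge0. Qed.

Lemma sum_sqr_ge0 a : 0 <= \sum_i a i ^+ 2.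
Proof. by apply: sumr_ge0 => i _; exact: sqr_ge0. Qed.

Lemma cauchy_schwarz_sqr a b :
  (\sum_i a i * b i) ^+ 2 <= (\sum_i a i ^+ 2) * (\sum_i b i ^+ 2).
Proof.
have E u v : \sum_i (u * a i - v * b i) ^+ 2 = u ^+ 2 * (\sum_i a i ^+ 2) -
    (u * v) *+ 2 * (\sum_i a i * b i) + v ^+ 2 * (\sum_i b i ^+ 2).
  by rewrite !mulr_sumr -sumrB -big_split /=; apply: eq_bigr => i _; ring.
set S := \sum_i _ * _; set A := \sum_i a i ^+ 2; set B := \sum_i b i ^+ 2.
have B0 : 0 <= B := sum_sqr_ge0 b.
have [B1|B1] := eqVneq B 0.
  have b0 i : b i = 0.
    move/eqP: B1; rewrite psumr_eq0; last by move=> j _; exact: sqr_ge0.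
    by move=> /allP /(_ i (mem_index_enum i)) /=; rewrite sqrf_eq0 => /eqP.
  have -> : S = 0 by apply: big1 => i _; rewrite b0 mulr0.
  by rewrite expr0n /= B1 mulr0.
have : 0 <= \sum_i (B * a i - S * b i) ^+ 2 by exact: sum_sqr_ge0.
rewrite E -/A -/B -/S.
have -> : B ^+ 2 * A - (B * S) *+ 2 * S + S ^+ 2 * B = B * (A * B - S ^+ 2).
  by ring.
by rewrite pmulr_rge0 ?lt_def ?B1 // subr_ge0.
Qed.

Lemma cauchy_schwarz a b :
  \sum_i a i * b i <= Num.sqrt (\sum_i a i ^+ 2) * Num.sqrt (\sum_i b i ^+ 2).
Proof.
rewrite -sqrtrM ?sum_sqr_ge0 //; apply: le_trans (ler_norm _) _.
by rewrite -sqrtr_sqr ler_wsqrtr // cauchy_schwarz_sqr.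
Qed.

Lemma l2_ge0 z : 0 <= l2 z. Proof. exact: sqrtr_ge0. Qed.

Lemma l2_sqr z : l2 z ^+ 2 = \sum_i Normc.normc (z i) ^+ 2.
Proof. by rewrite sqr_sqrtr // sum_sqr_ge0. Qed.

Lemma eq_l2 z w : z =1 w -> l2 z = l2 w.
Proof. by move=> zw; congr Num.sqrt; apply: eq_bigr => i _; rewrite zw. Qed.

Lemma l2D z w : l2 (fun i => z i + w i) <= l2 z + l2 w.
Proof.
rewrite -(ler_pXn2r (n := 2)) ?nnegrE ?addr_ge0 ?l2_ge0 // sqrrD !l2_sqr.
apply: (@le_trans _ _ (\sum_i (Normc.normc (z i) + Normc.normc (w i)) ^+ 2)).
  apply: ler_sum => i _; rewrite ler_pXn2r ?nnegrE ?addr_ge0 ?normc_ge0 //.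
  exact: le_normcD.
under eq_bigr do rewrite sqrrD.
rewrite 2!big_split /= lerD2r lerD2l sumrMnl ler_pMn2r //.
exact: cauchy_schwarz.
Qed.

Lemma l2Z (c : C) z : l2 (fun i => c * z i) = Normc.normc c * l2 z.
Proof.
rewrite -[Normc.normc c]ger0_norm ?normc_ge0 // -sqrtr_sqr -sqrtrM ?sqr_ge0 //.
rewrite mulr_sumr; congr Num.sqrt; apply: eq_bigr => i _.
by rewrite Normc.normcM exprMn.
Qed.

Lemma l20 : l2 (fun=> 0) = 0.
Proof. by rewrite /l2 big1 ?sqrtr0 // => i _; rewrite Normc.normc0 expr0n. Qed.

Lemma l2_dot z w :
  Normc.normc (\sum_i (z i)^* * w i) <= l2 z * l2 w.
Proof.
apply: le_trans (cauchy_schwarz (fun i => Normc.normc (z i)) _).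
elim/big_ind2: _ => [|x a y b xa yb|i _]; first by rewrite Normc.normc0.
  by apply: le_trans (le_normcD _ _) _; exact: lerD.
by rewrite Normc.normcM; case: (z i) => x y; rewrite /= sqrrN.
Qed.

End L2.

Section Matrices.
Variable R : realType.
Local Notation C := R[i].

Definition vnorm n (v : 'cV[C]_n) : R := l2 (fun i => v i 0).

Definition opnorm n (A : 'M[C]_n) : R :=
  sup [set vnorm (A *m v) | v in [set v | vnorm v <= 1]].

Definition ntr n (A : 'M[C]_n) : C := n%:R^-1 * \tr A.

Definition norm2 n (A : 'M[C]_n) : R :=
  Num.sqrt (complex.Re (ntr (A ^t* *m A))).

Lemma conjCE (x : C) : Num.conj x = conjc x.
Proof. by []. Qed.

Lemma vnormD n (v w : 'cV[C]_n) : vnorm (v + w) <= vnorm v + vnorm w.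
Proof. by apply: le_trans (l2D _ _); rewrite le_eqVlt; apply/orP; left;
  apply/eqP/eq_l2 => i; rewrite mxE. Qed.

Lemma vnormZ n c (v : 'cV[C]_n) : vnorm (c *: v) = Normc.normc c * vnorm v.
Proof. by rewrite -l2Z; apply: eq_l2 => i; rewrite mxE. Qed.

Lemma vnorm_mul n (A : 'M[C]_n) : exists2 c, 0 <= c &
  forall v, vnorm (A *m v) <= c * vnorm v.
Proof.
pose r i := l2 (fun j => A i j).
exists (Num.sqrt (\sum_i r i ^+ 2)) => [|v]; first exact: sqrtr_ge0.
rewrite -[vnorm v]ger0_norm ?l2_ge0 // -sqrtr_sqr -sqrtrM ?sum_sqr_ge0 //.
apply: ler_wsqrtr; rewrite mulr_suml; apply: ler_sum => i _.
rewrite -exprMn ler_pXn2r ?nnegrE ?mulr_ge0 ?normc_ge0 ?l2_ge0 // mxE.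
rewrite (_ : r i = l2 (fun j => (A i j)^*)); last first.
  by congr Num.sqrt; apply: eq_bigr => j _; case: (A i j) => x y /=; rewrite sqrrN.
apply: le_trans (l2_dot _ _); rewrite [in leRHS](eq_bigr (fun j => A i j * v j 0)) //.
by move=> j _; congr (_ * _); exact: conjcK.
Qed.

Lemma has_sup_opnorm n (A : 'M[C]_n) :
  has_sup [set vnorm (A *m v) | v in [set v | vnorm v <= 1]].
Proof.
split.
  exists (vnorm (A *m 0)), 0 => //=.
  by rewrite (_ : vnorm 0 = 0) // -[RHS](l20 R 'I_n); apply: eq_l2 => i; rewrite mxE.
have [c c0 cA] := vnorm_mul A; exists c => _ [v /= v1 <-].
by apply: le_trans (cA v) _; rewrite ler_piMr.
Qed.

Lemma opnorm_ge0 n (A : 'M[C]_n) : 0 <= opnorm A.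
Proof.
have [[_ [v v1 _]] ub] := has_sup_opnorm A.
by apply: le_trans (l2_ge0 _) (ub_le_sup ub _); exists v.
Qed.

Lemma opnormP n (A : 'M[C]_n) v : vnorm (A *m v) <= opnorm A * vnorm v.
Proof.
have [c c0 cA] := vnorm_mul A.
have [v0|v0] := eqVneq (vnorm v) 0.
  by rewrite v0 mulr0; apply: le_trans (cA v) _; rewrite v0 mulr0.
have vp : 0 < vnorm v by rewrite lt_def v0 l2_ge0.
rewrite -ler_pdivrMr //; have [_ ub] := has_sup_opnorm A.
apply: (ub_le_sup ub); exists ((vnorm v)^-1%:C *: v) => /=.
  by rewrite vnormZ /= expr0n addr0 sqrtr_sqr ger0_norm ?invr_ge0 ?l2_ge0 // mulVf.
rewrite -scalemxAr vnormZ /= expr0n addr0 sqrtr_sqr ger0_norm ?invr_ge0 ?l2_ge0 //.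
exact: mulrC.
Qed.

Lemma opnorm_le n (A : 'M[C]_n) c : 0 <= c ->
  (forall v, vnorm (A *m v) <= c * vnorm v) -> opnorm A <= c.
Proof.
move=> c0 cA; apply: ge_sup; first by have [] := has_sup_opnorm A.
by move=> _ [v /= v1 <-]; apply: le_trans (cA v) _; rewrite ler_piMr.
Qed.

Lemma opnormD n (A B : 'M[C]_n) : opnorm (A + B) <= opnorm A + opnorm B.
Proof.
apply: opnorm_le => [|v]; first by rewrite addr_ge0 ?opnorm_ge0.
by rewrite mulmxDl mulrDl; apply: le_trans (vnormD _ _) (lerD _ _); exact: opnormP.
Qed.

Lemma opnormZ n c (A : 'M[C]_n) : opnorm (c *: A) <= Normc.normc c * opnorm A.
Proof.
apply: opnorm_le => [|v]; first by rewrite mulr_ge0 ?opnorm_ge0 ?normc_ge0.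
by rewrite -scalemxAl vnormZ -mulrA ler_wpM2l ?normc_ge0 ?opnormP.
Qed.

Lemma opnormM n (A B : 'M[C]_n) : opnorm (A *m B) <= opnorm A * opnorm B.
Proof.
apply: opnorm_le => [|v]; first by rewrite mulr_ge0 ?opnorm_ge0.
rewrite -mulmxA -mulrA; apply: le_trans (opnormP _ _) _.
by rewrite ler_wpM2l ?opnorm_ge0 ?opnormP.
Qed.

Lemma opnorm1 n : opnorm (1%:M : 'M[C]_n) <= 1.
Proof. by apply: opnorm_le => // v; rewrite mul1mx mul1r. Qed.

Lemma vnorm_sqr n (v : 'cV[C]_n) : (v ^t* *m v) 0 0 = (vnorm v ^+ 2)%:C.
Proof.
rewrite mxE l2_sqr rmorph_sum; apply: eq_bigr => i _; rewrite !mxE.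
case: (v i 0) => x y; rewrite conjCE /= sqr_sqrtr ?addr_ge0 ?sqr_ge0 //.
by rewrite /GRing.mul /=; congr (_ +i* _); ring.
Qed.

Lemma opnorm_adj n (A : 'M[C]_n) : opnorm (A ^t*) <= opnorm A.
Proof.
apply: opnorm_le => [|v]; first exact: opnorm_ge0.
set w := A ^t* *m v; have w0 : 0 <= vnorm w by exact: l2_ge0.
have [->|wn0] := eqVneq (vnorm w) 0; first by rewrite mulr_ge0 ?opnorm_ge0 ?l2_ge0.
have wp : 0 < vnorm w by rewrite lt_def wn0.
rewrite -(ler_pM2l wp) -expr2.
have -> : vnorm w ^+ 2 = Normc.normc (\sum_i ((A *m w) i 0)^* * v i 0).
  have -> : \sum_i ((A *m w) i 0)^* * v i 0 = (vnorm w ^+ 2)%:C.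
    rewrite -vnorm_sqr.
    have -> : w ^t* *m w = (A *m w) ^t* *m v.
      by rewrite [in RHS]trmx_mul [in RHS]map_mxM -[RHS]mulmxA.
    rewrite mxE.
    by apply: eq_bigr => i _; rewrite [_ ^t* _ _]mxE [_^T _ _]mxE.
  by rewrite /= expr0n addr0 sqrtr_sqr ger0_norm ?sqr_ge0.
apply: le_trans (l2_dot _ _) _.
by rewrite mulrA ler_wpM2r ?l2_ge0 // mulrC; exact: opnormP.
Qed.

Lemma norm2E n (A : 'M[C]_n) :
  norm2 A = (Num.sqrt n%:R)^-1 * l2 (fun ij => A ij.1 ij.2).
Proof.
rewrite -sqrtrV -?sqrtrM ?invr_ge0 // /norm2 /ntr; congr Num.sqrt.
have -> : \tr (A ^t* *m A) = (\sum_ij Normc.normc (A ij.1 ij.2) ^+ 2)%:C.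
  rewrite -(pair_bigA _ (fun i j => Normc.normc (A i j) ^+ 2)) exchange_big /=.
  rewrite rmorph_sum; apply: eq_bigr => j _.
  rewrite mxE rmorph_sum; apply: eq_bigr => i _; rewrite !mxE.
  case: (A i j) => x y; rewrite conjCE /= sqr_sqrtr ?addr_ge0 ?sqr_ge0 //.
  by rewrite /GRing.mul /=; congr (_ +i* _); ring.
have -> : n%:R^-1 = (n%:R^-1)%:C :> C by rewrite fmorphV rmorph_nat.
by rewrite -rmorphM.
Qed.


Lemma norm2_ge0 n (A : 'M[C]_n) : 0 <= norm2 A.
Proof. exact: sqrtr_ge0. Qed.

Lemma norm20 n : norm2 (0 : 'M[C]_n) = 0.
Proof.
rewrite norm2E (eq_l2 (w := fun=> 0)) ?l20 ?mulr0 // => i; exact: mxE.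
Qed.

Lemma norm2D n (A B : 'M[C]_n) : norm2 (A + B) <= norm2 A + norm2 B.
Proof.
rewrite !norm2E -mulrDr ler_wpM2l ?invr_ge0 ?sqrtr_ge0 //.
apply: le_trans (l2D _ _); rewrite le_eqVlt; apply/orP; left.
by apply/eqP/eq_l2 => i; rewrite mxE.
Qed.

Lemma norm2Z n c (A : 'M[C]_n) : norm2 (c *: A) = Normc.normc c * norm2 A.
Proof. by rewrite !norm2E mulrCA -l2Z; congr (_ * _); apply: eq_l2 => i; rewrite mxE. Qed.

Lemma norm2N n (A : 'M[C]_n) : norm2 (- A) = norm2 A.
Proof. by rewrite -scaleN1r norm2Z normcN Normc.normc1 mul1r. Qed.

Lemma norm2_adj n (A : 'M[C]_n) : norm2 (A ^t*) = norm2 A.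
Proof.
rewrite !norm2E; congr (_ * Num.sqrt _).
rewrite -(pair_bigA _ (fun i j => Normc.normc ((A ^t*) i j) ^+ 2)) exchange_big.
rewrite pair_bigA; apply: eq_bigr => -[i j] _ /=; rewrite !mxE /=.
by case: (A i j) => x y; rewrite conjCE /= sqrrN.
Qed.

Lemma norm2_col n (A : 'M[C]_n) :
  norm2 A = (Num.sqrt n%:R)^-1 * Num.sqrt (\sum_j vnorm (col j A) ^+ 2).
Proof.
rewrite norm2E; congr (_ * Num.sqrt _).
rewrite -(pair_bigA _ (fun i j => Normc.normc (A i j) ^+ 2)) exchange_big.
by apply: eq_bigr => j _; rewrite l2_sqr; apply: eq_bigr => i _; rewrite mxE.
Qed.

Lemma norm2_mull n (A B : 'M[C]_n) : norm2 (A *m B) <= opnorm A * norm2 B.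
Proof.
rewrite !norm2_col mulrCA ler_wpM2l ?invr_ge0 ?sqrtr_ge0 //.
rewrite -[opnorm A]ger0_norm ?opnorm_ge0 // -sqrtr_sqr -sqrtrM ?sqr_ge0 //.
apply: ler_wsqrtr; rewrite mulr_sumr; apply: ler_sum => j _.
rewrite -exprMn ler_pXn2r ?nnegrE ?mulr_ge0 ?opnorm_ge0 ?l2_ge0 //.
by rewrite colE -mulmxA -colE; exact: opnormP.
Qed.

Lemma norm2_mulr n (A B : 'M[C]_n) : norm2 (A *m B) <= norm2 A * opnorm B.
Proof.
rewrite -norm2_adj trmx_mul map_mxM; apply: le_trans (norm2_mull _ _) _.
by rewrite norm2_adj mulrC ler_wpM2l ?norm2_ge0 // opnorm_adj.
Qed.

Lemma norm2_opnorm n (A : 'M[C]_n) : norm2 A <= opnorm A.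
Proof.
rewrite -[A in norm2 A]mulmx1; apply: le_trans (norm2_mull _ _) _.
rewrite ler_piMr ?opnorm_ge0 // norm2E.
case: n A => [|n] A; first by rewrite sqrtr0 invr0 mul0r.
rewrite mulrC ler_pdivrMr ?sqrtr_gt0 ?ltr0n // mul1r ler_wsqrtr //.
rewrite -(pair_bigA _ (fun i j => Normc.normc ((1%:M : 'M[C]_n.+1) i j) ^+ 2)) /=.
rewrite (eq_bigr (fun=> 1)) ?sumr_const ?card_ord // => i _.
rewrite (bigD1 i) //= big1 ?addr0 => [|j ji].
  by rewrite mxE eqxx Normc.normc1 expr1n.
by rewrite mxE eq_sym (negPf ji) Normc.normc0 expr0n.
Qed.

Lemma ntrD n (A B : 'M[C]_n) : ntr (A + B) = ntr A + ntr B.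
Proof. by rewrite /ntr mxtraceD mulrDr. Qed.

Lemma ntrN n (A : 'M[C]_n) : ntr (- A) = - ntr A.
Proof. by rewrite /ntr raddfN mulrN. Qed.

Lemma ntr_norm2 n (A : 'M[C]_n) : Normc.normc (ntr A) <= norm2 A.
Proof.
rewrite norm2E /ntr Normc.normcM.
have -> : Normc.normc n%:R^-1 = n%:R^-1 :> R.
  rewrite (_ : n%:R^-1 = (n%:R^-1)%:C :> C); last by rewrite fmorphV rmorph_nat.
  by rewrite /= expr0n addr0 sqrtr_sqr ger0_norm ?invr_ge0.
rewrite -[in leLHS](sqr_sqrtr (ler0n R n)) expr2 invfM -mulrA.
rewrite ler_wpM2l ?invr_ge0 ?sqrtr_ge0 //.
case: n A => [|n] A; first by rewrite sqrtr0 invr0 mul0r l2_ge0.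
rewrite mulrC ler_pdivrMr ?sqrtr_gt0 ?ltr0n //.
apply: (@le_trans _ _ (\sum_i Normc.normc (A i i) * 1)).
  rewrite /mxtrace; elim/big_ind2: _ => [|x a y b xa yb|i _].
  - by rewrite Normc.normc0.
  - by apply: le_trans (le_normcD _ _) _; exact: lerD.
  - by rewrite mulr1.
apply: le_trans (cauchy_schwarz _ _) _.
rewrite sumr_const card_ord expr1n ler_wpM2r ?sqrtr_ge0 // ler_wsqrtr //.
rewrite -(pair_bigA _ (fun i j => Normc.normc (A i j) ^+ 2)) /=.
apply: ler_sum => i _; rewrite (bigD1 i) //= lerDl.
by apply: sumr_ge0 => j _; exact: sqr_ge0.
Qed.

End Matrices.

Record free_ultrafilter := FreeUltrafilter {
  ultrafilter_sets :> set_system nat;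
  ultrafilterP : UltraFilter ultrafilter_sets;
  ultrafilter_free : \bigcap_(A in ultrafilter_sets) A = set0
}.
#[global] Existing Instance ultrafilterP.

Definition seqmx (R : realType) (n : nat -> nat) := forall k, 'M[R[i]]_(n k).
Identity Coercion fun_of_seqmx : seqmx >-> Funclass.

Section SequenceAlgebra.
Variables (R : realType) (n : nat -> nat).
Local Notation C := R[i].
Local Notation S := (seqmx R n).
Implicit Types x y z : S.

HB.instance Definition _ := Choice.on S.

Definition addx x y : S := fun k => x k + y k.
Definition oppx x : S := fun k => - x k.
Definition zerox : S := fun k => 0.
Definition mulx x y : S := fun k => x k *m y k.
Definition onex : S := fun k => 1%:M.
Definition scalex (c : C) x : S := fun k => c *: x k.
Definition starx x : S := fun k => (x k) ^t*.

Fact addxA : associative addx.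
Proof. by move=> x y z; apply/functional_extensionality_dep => k; exact: addrA. Qed.
Fact addxC : commutative addx.
Proof. by move=> x y; apply/functional_extensionality_dep => k; exact: addrC. Qed.
Fact add0x : left_id zerox addx.
Proof. by move=> x; apply/functional_extensionality_dep => k; exact: add0r. Qed.
Fact addNx : left_inverse zerox oppx addx.
Proof. by move=> x; apply/functional_extensionality_dep => k; exact: addNr. Qed.
HB.instance Definition _ := GRing.isZmodule.Build S addxA addxC add0x addNx.

Fact mulxA : associative mulx.
Proof. by move=> x y z; apply/functional_extensionality_dep => k; exact: mulmxA. Qed.
Fact mul1x : left_id onex mulx.
Proof. by move=> x; apply/functional_extensionality_dep => k; exact: mul1mx. Qed.
Fact mulx1 : right_id onex mulx.
Proof. by move=> x; apply/functional_extensionality_dep => k; exact: mulmx1. Qed.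
Fact mulxDl : left_distributive mulx +%R.
Proof. by move=> x y z; apply/functional_extensionality_dep => k; exact: mulmxDl. Qed.
Fact mulxDr : right_distributive mulx +%R.
Proof. by move=> x y z; apply/functional_extensionality_dep => k; exact: mulmxDr. Qed.
HB.instance Definition _ :=
  GRing.Zmodule_isPzRing.Build S mulxA mul1x mulx1 mulxDl mulxDr.

Fact scalexA (a b : C) x : scalex a (scalex b x) = scalex (a * b) x.
Proof. by apply/functional_extensionality_dep => k; exact: scalerA. Qed.
Fact scale1x : left_id 1 scalex.
Proof. by move=> x; apply/functional_extensionality_dep => k; exact: scale1r. Qed.
Fact scalexDr : right_distributive scalex +%R.
Proof. by move=> a x y; apply/functional_extensionality_dep => k; exact: scalerDr. Qed.
Fact scalexDl x : {morph scalex^~ x : a b / a + b}.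
Proof. by move=> a b; apply/functional_extensionality_dep => k; exact: scalerDl. Qed.
HB.instance Definition _ :=
  GRing.Zmodule_isLmodule.Build C S scalexA scale1x scalexDr scalexDl.

Definition bounded_seqmx : {pred S} :=
  fun x => `[< exists c : R, forall k, opnorm (x k) <= c >].

Fact bounded_seqmx_subring : subring_closed bounded_seqmx.
Proof.
split.
- by apply/asboolP; exists 1 => k; exact: opnorm1.
- move=> x y /asboolP[a xa] /asboolP[b yb]; apply/asboolP; exists (a + b) => k.
  apply: le_trans (opnormD _ _) (lerD (xa k) _); apply: le_trans (yb k).
  rewrite -scaleN1r; apply: le_trans (opnormZ _ _) _.
  by rewrite normcN Normc.normc1 mul1r.
- move=> x y /asboolP[a xa] /asboolP[b yb]; apply/asboolP; exists (a * b) => k.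
  by apply: le_trans (opnormM _ _) (ler_pM _ _ _ _); rewrite ?opnorm_ge0.
Qed.
Fact bounded_seqmx_scaler : scaler_closed bounded_seqmx.
Proof.
move=> c x /asboolP[a xa]; apply/asboolP; exists (Normc.normc c * a) => k.
by apply: le_trans (opnormZ _ _) _; rewrite ler_wpM2l ?normc_ge0.
Qed.
Lemma bounded_seqmx_star x : x \in bounded_seqmx -> starx x \in bounded_seqmx.
Proof.
move=> /asboolP[a xa]; apply/asboolP; exists a => k.
exact: le_trans (opnorm_adj _) (xa k).
Qed.

Record linf := Linf { linf_val :> S; linf_bounded : linf_val \in bounded_seqmx }.

HB.instance Definition _ := [isSub for linf_val].
HB.instance Definition _ := [Choice of linf by <:].
HB.instance Definition _ :=
  GRing.SubChoice_isSubPzRing.Build S bounded_seqmx linf bounded_seqmx_subring.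
HB.instance Definition _ :=
  GRing.SubZmodule_isSubLmodule.Build C S bounded_seqmx linf
    (conj (GRing.subring_closed_semi bounded_seqmx_subring).1 bounded_seqmx_scaler).

Definition star_linf (x : linf) : linf :=
  Linf (bounded_seqmx_star (linf_bounded x)).

End SequenceAlgebra.

Section Ultraproduct.
Variables (R : realType) (omega : free_ultrafilter) (n : nat -> nat).
Local Notation C := R[i].
Local Notation L := (linf R n).
Local Open Scope quotient_scope.

Definition null_seq (x : L) : Prop :=
  (fun k => norm2 (x k)) @ ultrafilter_sets omega --> (0 : R).

Lemma null_seqP x :
  null_seq x <-> forall e : R, 0 < e -> ultrafilter_sets omega [set k | norm2 (x k) < e].
Proof.
split => [x0 e e0|x0].
  have FF : Filter (ultrafilter_sets omega) by exact: _.
  have := @cvgr0_norm_lt _ _ _ _ FF (fun k => norm2 (x k)) x0 e e0.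
  by apply: filterS => k /=; rewrite ger0_norm ?norm2_ge0.
apply/cvgr0Pnorm_lt => e e0; apply: filterS (x0 e e0) => k /=.
by rewrite ger0_norm ?norm2_ge0.
Qed.

Lemma null_seq_le (a : R) (x y : L) : 0 <= a ->
  (forall k, norm2 (y k) <= a * norm2 (x k)) -> null_seq x -> null_seq y.
Proof.
move=> a0 yx /null_seqP x0; apply/null_seqP => e e0.
have a1 : 0 < a + 1 by rewrite ltr_wpDl.
apply: filterS (x0 (e / (a + 1)) (divr_gt0 e0 a1)) => k /=.
rewrite ltr_pdivlMr // mulrC; apply: le_lt_trans.
by apply: le_trans (yx k) _; rewrite ler_wpM2r ?norm2_ge0 // lerDl.
Qed.

Lemma null_seq0 : null_seq 0.
Proof. by apply/null_seqP => e e0; apply: filterE => k /=; rewrite norm20. Qed.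

Lemma null_seqD x y : null_seq x -> null_seq y -> null_seq (x + y).
Proof.
move=> /null_seqP x0 /null_seqP y0; apply/null_seqP => e e0.
have e2 : 0 < e / 2 by rewrite divr_gt0.
apply: filterS2 (x0 _ e2) (y0 _ e2) => k /= xk yk.
by apply: le_lt_trans (norm2D _ _) _; rewrite [ltRHS]splitr ltrD.
Qed.

Lemma null_seqZ c x : null_seq x -> null_seq (c *: x).
Proof.
apply: (@null_seq_le (Normc.normc c)); first exact: normc_ge0.
by move=> k; rewrite -norm2Z.
Qed.

Lemma null_seqN x : null_seq x -> null_seq (- x).
Proof. by rewrite -scaleN1r; exact: null_seqZ. Qed.

Lemma null_seqMl x y : null_seq y -> null_seq (x * y).
Proof.
have /asboolP[a xa] := linf_bounded x.
have a0 : 0 <= a := le_trans (opnorm_ge0 _) (xa 0%N).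
apply: null_seq_le a0 _ => k; apply: le_trans (norm2_mull _ _) _.
by rewrite ler_wpM2r ?norm2_ge0.
Qed.

Lemma null_seqMr x y : null_seq x -> null_seq (x * y).
Proof.
have /asboolP[a ya] := linf_bounded y.
have a0 : 0 <= a := le_trans (opnorm_ge0 _) (ya 0%N).
apply: null_seq_le a0 _ => k; apply: le_trans (norm2_mulr _ _) _.
by rewrite mulrC ler_wpM2r ?norm2_ge0.
Qed.

Lemma star_linfB (x y : L) : star_linf (x - y) = star_linf x - star_linf y.
Proof.
apply/val_inj/functional_extensionality_dep => k /=.
by apply/matrixP => i j; rewrite !mxE rmorphB.
Qed.

Lemma null_seq_star x : null_seq x -> null_seq (star_linf x).
Proof.
by apply: (@null_seq_le 1) => // k; rewrite mul1r norm2_adj.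
Qed.

Definition null_rel (x y : L) : bool := `[< null_seq (x - y) >].

Fact null_rel_refl : reflexive null_rel.
Proof. by move=> x; apply/asboolP; rewrite subrr; exact: null_seq0. Qed.

Fact null_rel_sym : symmetric null_rel.
Proof.
by move=> x y; apply/asboolP/asboolP => /null_seqN; rewrite opprB.
Qed.

Fact null_rel_trans : transitive null_rel.
Proof.
move=> y x z /asboolP xy /asboolP yz; apply/asboolP.
by rewrite -(subrK y x) -addrA; exact: null_seqD.
Qed.

Canonical null_equiv := EquivRel null_rel null_rel_refl null_rel_sym null_rel_trans.

(* The algebra of operator-norm bounded sequences modulo the ideal of sequences
   whose 2-norm tends to 0 along [omega]. *)
Definition uprod := {eq_quot null_equiv}.

HB.instance Definition _ := Choice.on uprod.
HB.instance Definition _ := EqQuotient.on uprod.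

Definition ucls (x : L) : uprod := \pi_uprod x.

Lemma uclsP (x y : L) : ucls x = ucls y <-> null_seq (x - y).
Proof.
split=> [/eqP|xy]; first by rewrite eqmodE => /asboolP.
by apply/eqP; rewrite eqmodE; apply/asboolP.
Qed.

Lemma uclsK (x : uprod) : ucls (repr x) = x.
Proof. exact: reprK. Qed.

Lemma repr_ucls x : null_seq (repr (ucls x) - x).
Proof. by apply/uclsP; rewrite uclsK. Qed.

Definition uadd (x y : uprod) : uprod := ucls (repr x + repr y).
Definition uopp (x : uprod) : uprod := ucls (- repr x).
Definition umul (x y : uprod) : uprod := ucls (repr x * repr y).
Definition uscale (c : C) (x : uprod) : uprod := ucls (c *: repr x).
Definition ustar (x : uprod) : uprod := ucls (star_linf (repr x)).

Lemma ucls_add x y : uadd (ucls x) (ucls y) = ucls (x + y).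
Proof.
apply/uclsP; rewrite opprD addrACA.
by apply: null_seqD; exact: repr_ucls.
Qed.

Lemma ucls_opp x : uopp (ucls x) = ucls (- x).
Proof. by apply/uclsP; rewrite -opprD; apply: null_seqN; exact: repr_ucls. Qed.

Lemma ucls_mul x y : umul (ucls x) (ucls y) = ucls (x * y).
Proof.
apply/uclsP; set x' := repr _; set y' := repr _.
have -> : x' * y' - x * y = x' * (y' - y) + (x' - x) * y.
  by rewrite mulrBr mulrBl addrA subrK.
by apply: null_seqD; [apply: null_seqMl|apply: null_seqMr]; exact: repr_ucls.
Qed.

Lemma ucls_scale c x : uscale c (ucls x) = ucls (c *: x).
Proof. by apply/uclsP; rewrite -scalerBr; apply: null_seqZ; exact: repr_ucls. Qed.

Lemma ucls_star x : ustar (ucls x) = ucls (star_linf x).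
Proof.
by apply/uclsP; rewrite -star_linfB; apply: null_seq_star; exact: repr_ucls.
Qed.

Lemma uprodW (P : uprod -> Prop) : (forall x, P (ucls x)) -> forall x, P x.
Proof. by move=> H x; rewrite -(uclsK x). Qed.

Fact uaddA : associative uadd.
Proof.
elim/uprodW => x; elim/uprodW => y; elim/uprodW => z.
by rewrite !ucls_add addrA.
Qed.
Fact uaddC : commutative uadd.
Proof. by elim/uprodW => x; elim/uprodW => y; rewrite !ucls_add addrC. Qed.
Fact uadd0 : left_id (ucls 0) uadd.
Proof. by elim/uprodW => x; rewrite ucls_add add0r. Qed.
Fact uaddN : left_inverse (ucls 0) uopp uadd.
Proof. by elim/uprodW => x; rewrite ucls_opp ucls_add addNr. Qed.
HB.instance Definition _ := GRing.isZmodule.Build uprod uaddA uaddC uadd0 uaddN.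

Lemma uclsD x y : ucls (x + y) = ucls x + ucls y.
Proof. by rewrite -ucls_add. Qed.

Fact umulA : associative umul.
Proof.
elim/uprodW => x; elim/uprodW => y; elim/uprodW => z.
by rewrite !ucls_mul mulrA.
Qed.
Fact umul1 : left_id (ucls 1) umul.
Proof. by elim/uprodW => x; rewrite ucls_mul mul1r. Qed.
Fact umulr1 : right_id (ucls 1) umul.
Proof. by elim/uprodW => x; rewrite ucls_mul mulr1. Qed.
Fact umulDl : left_distributive umul +%R.
Proof.
elim/uprodW => x; elim/uprodW => y; elim/uprodW => z.
by rewrite -uclsD !ucls_mul mulrDl uclsD.
Qed.
Fact umulDr : right_distributive umul +%R.
Proof.
elim/uprodW => x; elim/uprodW => y; elim/uprodW => z.
by rewrite -uclsD !ucls_mul mulrDr uclsD.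
Qed.
HB.instance Definition _ :=
  GRing.Zmodule_isPzRing.Build uprod umulA umul1 umulr1 umulDl umulDr.

Fact uscaleA (a b : C) x : uscale a (uscale b x) = uscale (a * b) x.
Proof. by elim/uprodW: x => x; rewrite !ucls_scale scalerA. Qed.
Fact uscale1 : left_id 1 uscale.
Proof. by elim/uprodW => x; rewrite ucls_scale scale1r. Qed.
Fact uscaleDr : right_distributive uscale +%R.
Proof.
move=> a; elim/uprodW => x; elim/uprodW => y.
by rewrite -uclsD !ucls_scale scalerDr uclsD.
Qed.
Fact uscaleDl x : {morph uscale^~ x : a b / a + b}.
Proof.
by move=> a b; elim/uprodW: x => x; rewrite !ucls_scale scalerDl uclsD.
Qed.
HB.instance Definition _ :=
  GRing.Zmodule_isLmodule.Build C uprod uscaleA uscale1 uscaleDr uscaleDl.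

Lemma uclsM x y : ucls (x * y) = ucls x * ucls y.
Proof. by rewrite -ucls_mul. Qed.
Lemma ucls1 : ucls 1 = 1. Proof. by []. Qed.
Lemma uclsZ c x : ucls (c *: x) = c *: ucls x.
Proof. by rewrite -ucls_scale. Qed.

End Ultraproduct.

Section Trace.
Variables (R : realType) (omega : free_ultrafilter) (n : nat -> nat).
Local Notation C := R[i].
Local Notation L := (linf R n).
Local Notation M := (uprod R omega n).
Local Notation W := (ultrafilter_sets omega).

Definition utr (x : M) : C :=
  lim ((fun k => complex.Re (ntr (repr x k)) : R) @ W) +i*
  lim ((fun k => complex.Im (ntr (repr x k)) : R) @ W).

Lemma ultra_bounded_cvg (f : nat -> R) a :
  (forall k, `|f k| <= a) -> cvg (f @ W).
Proof.
move=> fa; have [p [_ clp]] : `[- a, a]%classic `&` cluster (f @ W) !=set0.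
  apply: segment_compact; have : W [set k | f k \in `[- a, a]] by
    apply: filterE => k /=; rewrite in_itv /= -ler_norml; exact: fa.
  exact.
apply/cvg_ex; exists p; apply/cvgrPdist_lt => e e0.
have [//|WN] := in_ultra_setVsetC [set k | `|p - f k| < e] (ultrafilterP omega).
have [_ [[k kN <-] pk]] :
    (f @` (~` [set k | `|p - f k| < e])) `&` ball p e !=set0.
  by apply: clp; [apply: filterS WN => k kN; exists k|exact: nbhsx_ballx].
by case: kN.
Qed.

Lemma normc_Re (z : C) : `|complex.Re z| <= Normc.normc z.
Proof.
by case: z => x y; rewrite -sqrtr_sqr ler_wsqrtr // lerDl sqr_ge0.
Qed.

Lemma normc_Im (z : C) : `|complex.Im z| <= Normc.normc z.
Proof.
by case: z => x y; rewrite -sqrtr_sqr ler_wsqrtr // lerDr sqr_ge0.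
Qed.

Lemma utr_cvg (h : C -> R) (hB : forall z w, h (z - w) = h z - h w)
    (hn : forall z, `|h z| <= Normc.normc z) (x : L) :
  (fun k => h (ntr (x k))) @ W -->
  lim ((fun k => h (ntr (repr (ucls omega x) k))) @ W).
Proof.
set y := repr _.
have yc : cvg ((fun k => h (ntr (y k))) @ W).
  have /asboolP[a ya] := linf_bounded y.
  apply: (@ultra_bounded_cvg _ a) => k; apply: le_trans (hn _) _.
  apply: le_trans (ntr_norm2 _) _; exact: le_trans (norm2_opnorm _) (ya k).
have dc : (fun k => h (ntr (y k)) - h (ntr (x k))) @ W --> (0 : R).
  apply/cvgr0Pnorm_lt => e e0.
  have /null_seqP/(_ e e0) := repr_ucls omega x.
  apply: filterS => k /=; apply: le_lt_trans.
  by rewrite -hB -ntrN -ntrD; apply: le_trans (hn _) (ntr_norm2 _).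
have -> : (fun k => h (ntr (x k))) =
    (fun k => h (ntr (y k)) - (h (ntr (y k)) - h (ntr (x k)))).
  by apply/funext => k; rewrite opprB addrC subrK.
rewrite -[X in _ --> X]subr0; exact: (cvgB yc dc).
Qed.

(* The limits defining [utr] exist and do not depend on the representative. *)
Lemma utrE (x : L) :
  (fun k => complex.Re (ntr (x k)) : R) @ W --> complex.Re (utr (ucls omega x)) /\
  (fun k => complex.Im (ntr (x k)) : R) @ W --> complex.Im (utr (ucls omega x)).
Proof.
split; apply: utr_cvg => //; try exact: normc_Re; try exact: normc_Im.
- by case=> a b [c d].
- by case=> a b [c d].
Qed.

Definition unorm2 (x : M) : R := Num.sqrt (complex.Re (utr (ustar x * x))).

Definition unitary (u : M) : Prop := ustar u * u = 1 /\ u * ustar u = 1.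

Definition conjugated (x y : M) : Prop :=
  exists2 w, unitary w & y = w * x * ustar w.

Definition uperm : set M :=
  [set x | exists2 p : L, (forall k, is_perm_mx (p k)) & ucls omega p = x].

(* A sequence in [M] that is Cauchy for the 2-norm: these represent the
   vectors of the Hilbert space completion L^2(M, Tr), on which [M] acts by
   left multiplication. *)
Definition cauchy2 (xi : nat -> M) : Prop :=
  forall e : R, 0 < e ->
    exists N, forall i j, (N <= i)%N -> (N <= j)%N -> unorm2 (xi i - xi j) < e.

(* [A] is closed in [M] for the strong operator topology of L^2(M, Tr). *)
Definition strong_closed (A : set M) : Prop :=
  forall x : M,
    (forall (m : nat) (xi : 'I_m -> nat -> M) (e : R),
      (forall i, cauchy2 (xi i)) -> 0 < e ->
      exists2 a, A a &
        forall i, \forall j \near \oo, unorm2 ((x - a) * xi i j) < e) ->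
    A x.

Definition vN_subalgebra (A : set M) : Prop :=
  [/\ A 1,
      forall x y, A x -> A y -> A (x + y) /\ A (x * y),
      forall c x, A x -> A (c *: x),
      forall x, A x -> A (ustar x) &
      strong_closed A].

(* The smallest von Neumann subalgebra containing [u], written A(u). *)
Definition vN_generated (u : M) : set M :=
  \bigcap_(A in [set A | vN_subalgebra A /\ A u]) A.

Definition spectrum (u : M) : set C :=
  [set z | ~ exists v : M,
    v * (u - z *: (1 : M)) = 1 /\ (u - z *: (1 : M)) * v = 1].

End Trace.

Definition circle (R : realType) := set_type [set z : R[i]^o | `|z| = 1].

Section Circle.
Variable R : realType.
Local Notation C := R[i].
Local Notation T := (circle R).

HB.instance Definition _ := Topological.copy T (set_type [set z : R[i]^o | `|z| = 1]).

Definition circle_val (z : T) : C := set_val z.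

Fact cis_subproof (t : R) : `|(cos t +i* sin t : R[i]^o)| = 1.
Proof. by rewrite normc_def /= cos2Dsin2 sqrtr1. Qed.

Definition cis (t : R) : T := SigSub (mem_set (cis_subproof t)).

HB.instance Definition _ := isPointed.Build T (cis 0).

End Circle.

Notation borel_circle R := (g_sigma_algebraType (@open (circle R))).

Section AssociatedMeasure.
Variables (R : realType) (omega : free_ultrafilter) (n : nat -> nat).
Local Notation C := R[i].
Local Notation M := (uprod R omega n).
Local Notation T := (borel_circle R).
Variable mu : probability T R.

Definition Linfty : set (T -> C) :=
  [set f | [/\ measurable_fun [set: T] (fun z => complex.Re (f z) : R),
               measurable_fun [set: T] (fun z => complex.Im (f z) : R) &
               exists c : R, {ae mu, forall z, Normc.normc (f z) <= c}]].

Definition cintegral (f : T -> C) : C :=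
  Rintegral mu [set: T] (fun z => complex.Re (f z)) +i*
  Rintegral mu [set: T] (fun z => complex.Im (f z)).

(* L^oo(mu) is handled through representatives: [Phi], defined on essentially
   bounded functions, factors through almost everywhere equality as an
   isomorphism of *-algebras from L^oo(mu) onto A(u). *)
Record tracial_iso (u : M) (Phi : (T -> C) -> M) : Prop := TracialIso {
  iso_image : Phi @` Linfty = vN_generated u;
  iso_ae : forall f g, Linfty f -> Linfty g ->
    Phi f = Phi g <-> {ae mu, forall z, f z = g z};
  iso_add : forall f g, Linfty f -> Linfty g -> Phi (f \+ g) = Phi f + Phi g;
  iso_mul : forall f g, Linfty f -> Linfty g -> Phi (f \* g) = Phi f * Phi g;
  iso_scale : forall c f, Linfty f -> Phi (fun z => c * f z) = c *: Phi f;
  iso_star : forall f, Linfty f -> Phi (fun z => conjc (f z)) = ustar (Phi f);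
  iso_gen : Phi (@circle_val R) = u;
  iso_trace : forall f, Linfty f -> utr (Phi f) = cintegral f
}.

(* The first clause makes [mu] a measure on the spectrum of [u], viewed as a
   measure on the circle. *)
Definition associated_measure (u : M) : Prop :=
  mu [set z | ~ spectrum u (circle_val z)] = 0%E /\
  exists Phi, tracial_iso u Phi.

End AssociatedMeasure.

Section ClosedConvexHull.
Variable R : realType.
Local Notation T := (borel_circle R).

Definition unity_roots (i : nat) : set T := [set z | circle_val z ^+ i = 1].

Definition lambda_fin (i : nat) (A : set T) : \bar R :=
  ((i%:R^-1)%:E * \sum_(z \in unity_roots i) (\d_z A : \bar R))%E.

(* Image of the Lebesgue measure on [0, 1) under t |-> e^(2 pi i t). *)
Definition lambda_inf (A : set T) : \bar R :=
  lebesgue_measure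
    ([set t : R | 0 <= t < 1] `&` [set t : R | A (cis (2 * pi * t))]).

Definition lambdas : set (set T -> \bar R) :=
  [set lambda_fin i | i in [set i | (0 < i)%N]] `|` [set lambda_inf].

Definition borel_set := set_type [set A : set T | measurable A].

(* Finite Borel measures are represented by their values on Borel sets; the
   pointwise topology on these values is that of setwise convergence. *)
Definition borel_values (mu : set T -> \bar R) : borel_set -> R :=
  fun A => fine (mu (set_val A)).

Definition convex_hull (V : lmodType R) (S : set V) : set V :=
  \bigcap_(K in [set K : set V |
                  convex_set (K : set (convex_lmodType V)) /\ S `<=` K]) K.

Definition closed_convex_hull (S : set (set T -> \bar R)) :
    set (set T -> \bar R) :=
  [set mu | closure
     (@convex_hull (borel_set -> R^o) (borel_values @` S)
        : set {ptws borel_set -> R^o})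
     (borel_values mu)].

End ClosedConvexHull.

(* Main.v *)
Require Import Defs.
From mathcomp Require Import all_boot all_order all_algebra.
From mathcomp Require Import fingroup perm cyclic separable cyclotomic complex ring lra zify.
From mathcomp Require Import all_classical all_reals all_analysis.
From mathcomp Require Import measurable_realfun.

(** Everything is read off from moments. A unitary of the ultraproduct is the
    class of a sequence of unitary matrices ([unitary_lift]), and the trace of
    its m-th power is the m-th moment of its associated measure
    ([assoc_moment]). Moments decide both sides of the equivalence:

    - Two classes of unitary matrices with the same moments are conjugate
      ([conjugated_of_moments]). Indeed, when finitely many moments of two
      matrices are close, a permutation matches their eigenvalues up to a small
      error outside a small proportion of indices ([transport]). The Hall
      condition behind this matching is obtained by averaging Lipschitz bump
      functions over the eigenvalues, and these functions are uniformly close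
      to trigonometric polynomials ([trig_approx]).
    - A probability on the circle is determined by its moments, by the same
      approximation ([measure_eq_of_moments]).

    The m-th moment of a permutation matrix is the proportion of points fixed by
    the m-th power of the permutation, that is, the sum over the divisors i of m
    of the proportions of points lying on i-cycles. The m-th moment of lambda_i
    is 1 if i divides m and 0 otherwise; lambda_oo behaves as i = 0 would, since
    0 divides no positive m, and it is given the index 0.

    If u is conjugate to the class of a sequence of permutations, let A_i be the
    limit along the ultrafilter of the proportion of points on i-cycles. The sum
    of the A_i is at most 1, the missing mass being carried by longer and longer
    cycles. The mixture of the lambda_i with weights A_i, completed by lambda_oo
    with the missing mass, has the moments of u and is therefore its measure. Its
    partial sums, completed likewise, are convex combinations of the lambda_i
    that converge setwise ([measure_of_perm]).

    Conversely, up to 1/M, a moment is a linear combination of the values of the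
    measure on finitely many level sets ([qf_moment]), so a measure in the
    closed convex hull has nearly the moments of a convex combination of the
    lambda_i. On n points such a combination is imitated by a permutation with
    suitable cycle lengths, with an error of order 1/M for large n
    ([realizable_lambdas], [realizable_convex]). Taking better and better
    permutations along the sequence ([diagonal_choice]) gives a class with
    exactly the moments of u, hence conjugate to u ([perm_of_measure]). *)

Set Implicit Arguments.
Unset Strict Implicit.
Unset Printing Implicit Defensive.

Import Order.TTheory GRing.Theory Num.Theory.
Import numFieldNormedType.Exports.

Local Open Scope classical_set_scope.
Local Open Scope ring_scope.
Local Open Scope complex_scope.
Local Open Scope sesquilinear_scope.

Local Notation cj := (@Num.conj _).

(** * Trigonometric approximation of Lipschitz functions *)

Section TrigApprox.
Variable R : realType.
Local Notation C := R[i].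

Lemma normcE (z : C) : `|z| = (Normc.normc z)%:C.
Proof. by []. Qed.

Lemma complex_prim_root (M : nat) : (0 < M)%N ->
  exists z : C, M.-primitive_root z.
Proof.
pose p : {poly C} := 'X^M - 1; have [r Dp] := closed_field_poly_normal p.
move=> M_gt0; rewrite (monicP _) ?monicXnsubC // scale1r in Dp.
have rn1: all M.-unity_root r by apply/allP=> z; rewrite -root_prod_XsubC -Dp.
have sz_r: (M < (size r).+1)%N.
  by rewrite -(size_prod_XsubC r id) -Dp size_XnsubC.
have [|z] := hasP (has_prim_root M_gt0 rn1 _ sz_r); last by exists z.
by rewrite -separable_prod_XsubC -Dp separable_Xn_sub_1 // pnatr_eq0 -lt0n.
Qed.

Lemma sum_prim_root (M r : nat) (z : C) : M.-primitive_root z ->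
  \sum_(j < M) (z ^+ j) ^+ r = (if (M %| r)%N then M else 0)%:R.
Proof.
move=> Mz.
have E j : (z ^+ j) ^+ r = (z ^+ r) ^+ j by rewrite -!exprM mulnC.
under eq_bigr do rewrite E.
have [d|nd] := ifPn.
  have -> : z ^+ r = 1 by apply/eqP; rewrite -(prim_order_dvd Mz).
  by under eq_bigr do rewrite expr1n; rewrite sumr_const card_ord.
have zr : z ^+ r - 1 != 0 by rewrite subr_eq0 -(prim_order_dvd Mz).
apply: (mulfI zr); rewrite -subrX1 mulr0.
by rewrite -exprM mulnC exprM (prim_expr_order Mz) expr1n subrr.
Qed.

Lemma unit_conj (z : C) : Normc.normc z = 1 -> z * cj z = 1.
Proof. by move=> z1; rewrite -normCK normcE z1 expr1n. Qed.

Lemma normc_conj (z : C) : Normc.normc (cj z) = Normc.normc z.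
Proof. by case: z => x y /=; rewrite sqrrN. Qed.

Lemma normcX (z : C) k : Normc.normc (z ^+ k) = Normc.normc z ^+ k.
Proof.
elim: k => [|k IH]; first by rewrite !expr0 Normc.normc1.
by rewrite !exprS Normc.normcM IH.
Qed.

Lemma prim_root_normc M (z : C) : M.-primitive_root z -> Normc.normc z = 1.
Proof.
move=> Mz; have M0 := prim_order_gt0 Mz.
apply/eqP; rewrite -(@eqrXn2 _ M) ?normc_ge0 ?ler01 //.
by rewrite -normcX (prim_expr_order Mz) Normc.normc1 expr1n.
Qed.

(** On the unit circle the parallelogram law trades the distance to t for the
    kernel, which is how the mean square distance under the kernel is computed. *)
Lemma normcD2 (t : C) : Normc.normc t = 1 ->
  Normc.normc (1 - t) ^+ 2 = 4 - Normc.normc (1 + t) ^+ 2.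
Proof.
case: t => x y /= /eqP; rewrite -(@eqrXn2 _ 2) ?sqrtr_ge0 ?ler01 // expr1n.
rewrite !sqr_sqrtr ?addr_ge0 ?sqr_ge0 // => /eqP xy1; nra.
Qed.

(** For z and w on the circle, the conjugate of 1 + z w* is (1 + z w* ) w z*, so
    the kernel is (1 + z w* )^(2N) (w z* )^N and the binomial formula applies. *)
Lemma kernelE (z w : C) N : Normc.normc z = 1 -> Normc.normc w = 1 ->
  (Normc.normc (1 + z * cj w ) ^+ (2 * N))%:C =
  \sum_(k < (2 * N).+1) 'C(2 * N, k)%:R * (w ^+ N * (cj w ) ^+ k) * (z ^+ k * (cj z ) ^+ N).
Proof.
move=> z1 w1; have zz := unit_conj z1; have ww := unit_conj w1.
rewrite exprM rmorphXn rmorphXn /= -normcE normCK.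
have -> : cj (1 + z * cj w) = (1 + z * cj w ) * (w * cj z ).
  rewrite rmorphD rmorph1 rmorphM /= conjCK.
  have -> : (1 + z * cj w) * (w * cj z) = w * cj z + (z * cj z) * (w * cj w).
    by ring.
  by rewrite zz ww mulr1 addrC mulrC.
rewrite [X in X ^+ N]mulrA -expr2 exprMn -exprM exprDn mulr_suml; apply: eq_bigr => k _.
rewrite expr1n mul1r !exprMn -mulr_natl; ring.
Qed.

(** Frequencies in the kernel are at most N in absolute value, so averaging over
    more than N roots of unity keeps only the constant term. *)
Lemma kernel_sum (z zeta : C) M N : Normc.normc z = 1 -> M.-primitive_root zeta ->
  (N < M)%N ->
  \sum_(j < M) Normc.normc (1 + z * cj (zeta ^+ j) ) ^+ (2 * N) =
  (M * 'C(2 * N, N))%:R.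
Proof.
move=> z1 Mz NM; apply: (@complexI R); rewrite rmorph_sum /=.
have ze1 := prim_root_normc Mz.
have zj1 j : Normc.normc (zeta ^+ j) = 1 by rewrite normcX ze1 expr1n.
under eq_bigr => j _ do rewrite (kernelE N z1 (zj1 j)).
rewrite exchange_big /=.
have kN : (N < (2 * N).+1)%N by lia.
rewrite (bigD1 (Ordinal kN)) //= [X in _ + X]big1 ?addr0 => [|k kn].
  rewrite -exprMn unit_conj // expr1n.
  under eq_bigr do rewrite -exprMn unit_conj // expr1n mulr1.
  by rewrite sumr_const card_ord mulr1 -mulrnA rmorph_nat mulnC.
rewrite -mulr_suml -mulr_sumr.
suff -> : \sum_(j < M) (zeta ^+ j) ^+ N * (cj (zeta ^+ j) ) ^+ k = 0.
  by rewrite mulr0 mul0r.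
have kN' : (k < (2 * N).+1)%N := ltn_ord k.
have kn' : (k : nat) != N by apply: contra kn => /eqP e; apply/eqP/val_inj.
have [kl|kg] := ltnP k N.
  have E (j : 'I_M) : (zeta ^+ j) ^+ N * (cj (zeta ^+ j) ) ^+ k = (zeta ^+ j) ^+ (N - k).
    rewrite -[in X in X * _](subnK (ltnW kl)) exprD -mulrA -exprMn unit_conj //.
    by rewrite expr1n mulr1.
  under eq_bigr do rewrite E.
  by rewrite (sum_prim_root _ Mz) ifN // gtnNdvd //; lia.
have E (j : 'I_M) : (zeta ^+ j) ^+ N * (cj (zeta ^+ j) ) ^+ k = cj ((zeta ^+ j) ^+ (k - N)).
  rewrite -[in X in _ * X](subnKC kg) exprD mulrA -exprMn unit_conj //.
  by rewrite expr1n mul1r [RHS]rmorphXn.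
under eq_bigr do rewrite E.
rewrite -rmorph_sum (sum_prim_root _ Mz) ifN ?rmorph0 // gtnNdvd //; lia.
Qed.

Lemma central_binS N :
  ((N.+1 * 'C(2 * N.+1, N.+1)) = (2 * (2 * N).+1) * 'C(2 * N, N))%N.
Proof.
have h1 : (N.+1 * 'C(2 * N.+1, N.+1) = (2 * N.+1) * 'C((2 * N).+1, N))%N.
  by have := mul_bin_diag (2 * N.+1)%N N; rewrite (_ : (2 * N.+1).-1 = (2 * N).+1) //; lia.
have h2 : (((2 * N).+1 - N) * 'C((2 * N).+1, N) = (2 * N).+1 * 'C(2 * N, N))%N.
  by have := mul_bin_down (2 * N).+1 N.
rewrite h1 -[RHS]mulnA -h2 -[LHS]mulnA; congr (2 * (_ * _))%N; lia.
Qed.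

Lemma normc_real (x : R) : Normc.normc x%:C = `|x|.
Proof. by rewrite /= expr0n addr0 sqrtr_sqr. Qed.

Lemma normc_nat k : Normc.normc (k%:R : C) = k%:R.
Proof. by rewrite -(rmorph_nat (real_complex R)) normc_real normr_nat. Qed.

Lemma normc_sum (I : Type) (r : seq I) (P : pred I) (F : I -> C) :
  Normc.normc (\sum_(i <- r | P i) F i) <= \sum_(i <- r | P i) Normc.normc (F i).
Proof.
elim/big_ind2: _ => [|x a y b xa yb|//]; first by rewrite Normc.normc0.
by apply: le_trans (le_normcD _ _) (lerD xa yb).
Qed.

(** Averaging phi over the roots of unity w against the kernel |1 + z w*|^(2N),
    normalized to total mass 1, produces a trigonometric polynomial. The
    kernel concentrates near w = z: by [normcD2] and [central_binS] the mean
    square distance to z is exactly 2 / (N + 1). Neither N nor the bound B on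
    the coefficients depends on phi, which matters when phi is built from an
    arbitrary set of eigenvalues. *)
Lemma trig_approx (L e : R) : 0 <= L -> 0 < e -> exists N : nat, exists B : nat -> R,
  forall phi : C -> R,
    (forall z w, `|phi z - phi w| <= L * Normc.normc (z - w)) ->
    (forall z, 0 <= phi z <= 1) ->
  exists c : nat -> C, (forall k, Normc.normc (c k) <= B k) /\
    forall z, Normc.normc z = 1 ->
    Normc.normc ((phi z)%:C - \sum_(k < (2 * N).+1) c k * (z ^+ k * cj z ^+ N)) <= e.
Proof.
move=> L0 e0; set D := L ^+ 2 / e ^+ 2.
have D0 : 0 <= D by rewrite divr_ge0 ?sqr_ge0.
pose N := Num.truncn (2 * D).
have ND : 2 * D <= N.+1%:R by rewrite ltW // truncnS_gt.
exists N, (fun k => (N.+2 * 'C(2 * N, k))%:R) => phi phiL phi01.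
pose M := N.+2; have [ze Mz] := @complex_prim_root M isT.
have ze1 := prim_root_normc Mz.
have zj1 j : Normc.normc (ze ^+ j) = 1 by rewrite normcX ze1 expr1n.
pose W : R := (M * 'C(2 * N, N))%:R.
have bin0 : (0 < 'C(2 * N, N))%N by rewrite bin_gt0; lia.
have W0 : 0 < W by rewrite ltr0n muln_gt0.
pose c k : C := \sum_(j < M) (phi (ze ^+ j) / W)%:C *
  ('C(2 * N, k)%:R * ((ze ^+ j) ^+ N * (cj (ze ^+ j)) ^+ k)).
exists c; split=> [k|z z1].
  apply: le_trans (normc_sum _ _ _) _.
  have -> : (M * 'C(2 * N, k))%:R = \sum_(j < M) 'C(2 * N, k)%:R :> R.
    by rewrite sumr_const card_ord -mulrnA mulnC.
  apply: ler_sum => j _; rewrite !Normc.normcM !normcX normc_conj normc_nat !normcX ze1.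
  have /andP[p0 p1] := phi01 (ze ^+ j).
  rewrite !expr1n !mulr1 normc_real ger0_norm ?divr_ge0 ?(ltW W0) //.
  by rewrite ler_piMl // ler_pdivrMr // mul1r (le_trans p1) // ler1n muln_gt0.
have -> : \sum_(k < (2 * N).+1) c k * (z ^+ k * cj z ^+ N) =
  (\sum_(j < M) phi (ze ^+ j) / W * Normc.normc (1 + z * cj (ze ^+ j)) ^+ (2 * N))%:C.
  rewrite rmorph_sum /=; under eq_bigr do rewrite mulr_suml.
  rewrite exchange_big /=; apply: eq_bigr => j _.
  rewrite [RHS]rmorphM /= (kernelE N z1 (zj1 j)) mulr_sumr; apply: eq_bigr => k _.
  by rewrite !mulrA.
pose K (j : 'I_M) := Normc.normc (1 + z * cj (ze ^+ j)) ^+ (2 * N) / W.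
have K0 j : 0 <= K j by rewrite divr_ge0 ?exprn_ge0 ?normc_ge0 // ltW.
have K1 : \sum_j K j = 1.
  by rewrite -mulr_suml (kernel_sum z1 Mz) // divff ?gt_eqF.
(* N + 2 roots of unity are enough for the kernels of order N and N + 1. *)
have K2 : \sum_j K j * Normc.normc (z - ze ^+ j) ^+ 2 = 2 / N.+1%:R.
  have E j : K j * Normc.normc (z - ze ^+ j) ^+ 2 =
    4 * K j - Normc.normc (1 + z * cj (ze ^+ j)) ^+ (2 * N.+1) / W.
    have -> : Normc.normc (z - ze ^+ j) = Normc.normc (1 - z * cj (ze ^+ j)).
      have -> : z - ze ^+ j = - ze ^+ j * (1 - z * cj (ze ^+ j)).
        by rewrite mulrBr mulr1 mulNr opprK mulrCA unit_conj // mulr1 addrC.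
      by rewrite Normc.normcM normcN zj1 mul1r.
    rewrite normcD2; last by rewrite Normc.normcM z1 normc_conj zj1 mulr1.
    rewrite mulnS exprD /K; ring.
  under eq_bigr do rewrite E.
  rewrite sumrB -mulr_sumr K1 -mulr_suml (kernel_sum z1 Mz) //.
  have := central_binS N; rewrite /W => h.
  have b0 : 'C(2 * N, N)%:R != 0 :> R by rewrite pnatr_eq0 -lt0n.
  have n0 : N.+1%:R != 0 :> R by rewrite pnatr_eq0.
  have m0 : M%:R != 0 :> R by rewrite pnatr_eq0.
  rewrite !(natrM _ M).
  have -> : 'C(2 * N.+1, N.+1)%:R = (2 * (2 * N).+1%:R) * 'C(2 * N, N)%:R / N.+1%:R :> R.
    by apply: (mulfI n0); rewrite -[LHS]natrM h !natrM; field.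
  by field; rewrite b0 m0 nat1r n0.
rewrite (eq_bigr (fun j => K j * phi (ze ^+ j))); last by move=> j _; rewrite /K; ring.
rewrite -rmorphB normc_real.
have -> : phi z = \sum_j K j * phi z by rewrite -mulr_suml K1 mul1r.
rewrite -sumrB; apply: le_trans (ler_norm_sum _ _ _) _.
(* For t the distance, L t <= e / 2 + (L t)^2 / (2 e): only the mean square
   distance is needed. *)
apply: (@le_trans _ _ (\sum_j K j * (e / 2 + L ^+ 2 / (2 * e) * Normc.normc (z - ze ^+ j) ^+ 2))).
  apply: ler_sum => j _; rewrite -mulrBr normrM ger0_norm // ler_wpM2l //.
  apply: le_trans (phiL _ _) _; set t := Normc.normc _.
  have -> : e / 2 + L ^+ 2 / (2 * e) * t ^+ 2 = L * t + (e - L * t) ^+ 2 / (2 * e).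
    by field; rewrite gt_eqF.
  by rewrite lerDl divr_ge0 ?sqr_ge0 // mulr_ge0 // ltW.
under eq_bigr do rewrite mulrDr [X in _ + X]mulrCA.
rewrite big_split /= -mulr_suml K1 mul1r -mulr_sumr K2.
have -> : L ^+ 2 / (2 * e) * (2 / N.+1%:R) = D / N.+1%:R * e.
  by rewrite /D; field; rewrite ?nat1r ?pnatr_eq0 (gt_eqF e0).
have : D / N.+1%:R <= 1 / 2 by rewrite ler_pdivrMr ?ltr0n //; lra.
by move=> h; rewrite -lerBrDl (le_trans (ler_wpM2r (ltW e0) h)) //; lra.
Qed.

End TrigApprox.
(** * Matchings: a defect form of the marriage theorem *)

Section DefectHall.
Variables (T : finType) (r : rel T).
Implicit Types s : {perm T}.

Definition matched s : {set T} := [set i | r i (s i)]%SET.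

(* An edge from i to j allows i to take over the partner of j. *)
Let edge s : rel T := fun i j => r i (s j).

(** After the exchange b gains a partner; the hypothesis on i says that i has
    nothing to lose, or is matched again by the former partner of b. *)
Lemma matched_swap s b i : ~~ r b (s b) -> r b (s i) ->
  ~~ r i (s i) || r i (s b) ->
  (#|matched s| < #|matched (tperm b i * s)%g|)%N.
Proof.
move=> bad rbi hi; have bi : i != b by apply: contraNneq bad => e; rewrite -{2}e.
apply: proper_card; apply/properP; split.
  apply/fintype.subsetP => x; rewrite !inE permM; case: tpermP => [->|->|] //.
  by move=> ri; move: hi; rewrite ri.
by exists b; rewrite !inE ?permM ?tpermL.
Qed.

Lemma path_edge_in s s' x p : {in p, s =1 s'} ->
  path (edge s) x p -> path (edge s') x p.
Proof.
elim: p x => //= y p IH x ss /andP[xy yp].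
rewrite [edge s' x y]/edge -ss ?mem_head // [r _ _]xy IH // => z zp.
by rewrite ss // inE zp orbT.
Qed.

(** Exchanging the partners of b0 and of the next vertex moves the defect one step
    along the alternating path; the number of matched elements grows at the
    latest when the unmatched end b is reached. *)
Lemma augment p s b0 b : ~~ r b0 (s b0) -> ~~ r b (s b) ->
  path (edge s) b0 p -> uniq (b0 :: p) -> r (last b0 p) (s b) ->
  exists s', (#|matched s| < #|matched s'|)%N.
Proof.
elim: p s b0 b => [|i1 p IH] s b0 b bad0 bad /=.
  move=> _ _ rb; exists (tperm b0 b * s)%g; apply: matched_swap => //.
  by rewrite bad.
move=> /andP[e01 pth] /andP[b0N /andP[i1N up]] rb.
move: b0N; rewrite inE negb_or => /andP[b01 b0p].
set s' := (tperm b0 i1 * s)%g.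
have [h|] := boolP (~~ r i1 (s i1) || r i1 (s b0)).
  by exists s'; apply: matched_swap.
rewrite negb_or negbK => /andP[g1 bad1].
have s'E x : x != b0 -> x != i1 -> s' x = s x.
  by move=> xb xi; rewrite permM tpermD // eq_sym.
have s'1 : s' i1 = s b0 by rewrite permM tpermR.
have s'0 : s' b0 = s i1 by rewrite permM tpermL.
have card_s' : #|matched s'| = #|matched s|.
  have -> : matched s' = (b0 |: (matched s :\ i1))%SET.
    apply/setP => x; rewrite !inE.
    have [->|xb] := eqVneq x b0; first by rewrite s'0.
    by have [->|xi] := eqVneq x i1; rewrite ?s'1 ?(negPf bad1) // s'E.
  rewrite cardsU1 !inE (negPf bad0) andbF /= [RHS](cardsD1 i1) inE g1.
  by [].
rewrite -card_s'.
(* The exchange gave the partner of b0 to i1, so i1 takes the role of b when the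
   path comes back to b0. *)
apply: (IH s' i1 (if b == b0 then i1 else b)).
- by rewrite s'1.
- have [_|bb] := eqVneq b b0; first by rewrite s'1.
  by rewrite s'E //; apply: contraNneq bad => ->.
- have : {in p, s =1 s'}.
    by move=> x xp; rewrite s'E //; [apply: contraNneq b0p => <-|apply: contraNneq i1N => <-].
  by move=> ss; apply: path_edge_in ss pth.
- by rewrite /= i1N.
- have [bb|bb] := eqVneq b b0; first by rewrite s'1 -bb.
  by rewrite s'E //; apply: contraNneq bad => ->.
Qed.

(** Take s with as many matched elements as possible, and let S be the set of
    elements reached by alternating paths from unmatched ones. The elements
    that s sends to neighbours of S lie in S, and all but k elements of S are of
    this kind. If more than k elements were unmatched, one of them would be sent
    to a neighbour of S, and [augment] would contradict maximality. *)
Lemma defect_hall k :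
  (forall S : {set T}, (#|S| <= #|[set j | [exists i in S, r i j]]%SET| + k)%N) ->
  exists s : {perm T}, (#|[set i | ~~ r i (s i)]%SET| <= k)%N.
Proof.
move=> hall.
have [s _ smax] := @arg_maxnP _ (1%g : {perm T}) xpredT (fun s => #|matched s|) isT.
exists s; rewrite leqNgt; apply/negP => kB.
set B := [set i | _]%SET in kB.
pose S := [set i | [exists b in B, connect (edge s) b i]]%SET.
pose N := [set j | [exists i in S, r i j]]%SET.
pose T0 := (s @^-1: N)%SET.
have T0N : #|T0| = #|N|.
  by rewrite /T0 card_preimset //; exact: perm_inj.
have T0S : T0 \subset S.
  apply/fintype.subsetP => i; rewrite !inE => /existsP[j]; rewrite inE.
  move=> /andP[/existsP[b /andP[bB bj]] ji]; apply/existsP; exists b.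
  by rewrite bB (connect_trans bj) // connect1.
have BS : B \subset S.
  by apply/fintype.subsetP => b bB; rewrite inE; apply/existsP; exists b; rewrite bB connect0.
have : ~~ [disjoint B & T0].
  apply: contraTN kB => dis; rewrite -leqNgt.
  have : (#|B| + #|T0| <= #|S|)%N.
    have /eqP <- : (#|(B :|: T0)%SET| == #|B| + #|T0|)%N by rewrite (leq_card_setU B T0).2.
    by rewrite subset_leq_card // finset.subUset BS.
  by move=> h; have := hall S; rewrite -/N -T0N => h'; lia.
case/pred0Pn => b /andP[/= bB]; rewrite !inE => /existsP[j].
rewrite inE => /andP[/existsP[b0 /andP[b0B /connectP[p pth jl]]] rj].
move: jl; case/shortenP: pth => p' pth up _ jl.
have [|||s' lt] := @augment p' s b0 b _ _ pth up; rewrite -?jl //.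
- by move: b0B; rewrite inE.
- by move: bB; rewrite inE.
by have /= := smax s' isT; rewrite leqNgt lt.
Qed.

End DefectHall.

(** * Eigenvalue lists with close moments can be matched *)

Section Transport.
Variable R : realType.
Local Notation C := R[i].

Lemma monomial_unit (z : C) k N : Normc.normc z = 1 ->
  z ^+ k * cj z ^+ N = if (N <= k)%N then z ^+ (k - N) else cj (z ^+ (N - k)).
Proof.
move=> z1; have [h|/ltnW h] := leqP N k.
  by rewrite -[in LHS](subnK h) exprD -mulrA -exprMn unit_conj // expr1n mulr1.
rewrite -[in LHS](subnKC h) exprD mulrA -exprMn unit_conj // expr1n mul1r.
by rewrite [RHS]rmorphXn.
Qed.

Definition tent (e : R) (a z : C) : R := Num.max 0 (1 - Normc.normc (z - a) / e).

Lemma tent01 e a z : 0 < e -> 0 <= tent e a z <= 1.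
Proof.
move=> e0; rewrite /tent le_max lexx /= ge_max ler01 /= lerBlDr lerDl.
by rewrite divr_ge0 ?normc_ge0 // ltW.
Qed.

Lemma normc_sub (z w a : C) :
  Normc.normc (z - a) <= Normc.normc (z - w) + Normc.normc (w - a).
Proof.
have -> : z - a = (z - w) + (w - a) by rewrite addrA subrK.
exact: le_normcD.
Qed.

Lemma tent_lip e a z w : 0 < e ->
  `|tent e a z - tent e a w| <= e^-1 * Normc.normc (z - w).
Proof.
move=> e0; have h x y : tent e a x - tent e a y <= e^-1 * Normc.normc (x - y).
  have p : 0 <= e^-1 * Normc.normc (x - y).
    by rewrite mulr_ge0 ?normc_ge0 // invr_ge0 ltW.
  rewrite lerBlDr /tent ge_max; apply/andP; split.
    by rewrite addr_ge0 // le_max lexx.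
  have : Normc.normc (y - a) / e <= e^-1 * Normc.normc (x - y) + Normc.normc (x - a) / e.
    rewrite [e^-1 * _]mulrC -mulrDl ler_pM2r ?invr_gt0 //.
    by rewrite -(normcN (x - y)) opprB normc_sub.
  move=> h; rewrite -lerBlDl le_max; apply/orP; right; lra.
rewrite ler_norml h andbT lerNl opprB.
by rewrite -(normcN (z - w)) opprB h.
Qed.

Lemma maxr_lip (a b a' b' L : R) : `|a - a'| <= L -> `|b - b'| <= L ->
  `|Num.max a b - Num.max a' b'| <= L.
Proof.
rewrite !ler_norml => /andP[? ?] /andP[? ?].
by case: (leP a b) => ?; case: (leP a' b') => ?; apply/andP; split; lra.
Qed.

Lemma max_lip (I : Type) (r : seq I) (P : pred I) (F : I -> C -> R) L z w :
  0 <= L ->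
  (forall i, `|F i z - F i w| <= L) ->
  `|\big[Num.max/0]_(i <- r | P i) F i z - \big[Num.max/0]_(i <- r | P i) F i w| <= L.
Proof.
move=> L0 FL; elim/big_ind2: _ => [|a a' b b' ha hb|i _ //]; first by rewrite subrr normr0.
exact: maxr_lip.
Qed.

(** For a set S of indices, let phi be the maximum of the tents of radius e around
    the points d i, i in S. It is 1 at these points and vanishes at distance e
    from all of them, so the mean of phi over d is at least the proportion of S,
    and over f at most the proportion of the neighbours of S. By [trig_approx]
    both means nearly agree: this is the hypothesis of [defect_hall], with
    defect e n. *)
Lemma transport (e : R) : 0 < e -> exists N : nat, exists2 delta : R, 0 < delta &
  forall (n : nat) (d f : 'I_n -> C),
    (forall i, Normc.normc (d i) = 1) -> (forall i, Normc.normc (f i) = 1) ->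
    (forall m, (0 < m <= N)%N ->
       Normc.normc (\sum_i d i ^+ m - \sum_i f i ^+ m) <= delta * n%:R) ->
    exists s : {perm 'I_n},
      #|[set i | ~~ (Normc.normc (d i - f (s i)) <= e)]%SET|%:R <= e * n%:R.
Proof.
move=> e0; have e4 : 0 < e / 4 by rewrite divr_gt0.
have L0 : 0 <= e^-1 by rewrite invr_ge0 ltW.
have [N [B approx]] := trig_approx L0 e4.
pose SB := \sum_(k < (2 * N).+1) `|B k|.
have SB0 : 0 <= SB by apply: sumr_ge0.
have SB1 : 0 < 2 * (SB + 1) by rewrite mulr_gt0 // ltr_wpDl.
exists N, (e / (2 * (SB + 1))); first by rewrite divr_gt0.
set delta := e / _ => n d f d1 f1 mom.
have delta0 : 0 < delta by rewrite divr_gt0.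
have mono k : (k < (2 * N).+1)%N ->
    Normc.normc (\sum_i d i ^+ k * cj (d i) ^+ N - \sum_i f i ^+ k * cj (f i) ^+ N) <=
    delta * n%:R.
  move=> kN.
  rewrite (eq_bigr _ (fun i _ => monomial_unit k N (d1 i))).
  rewrite (eq_bigr _ (fun i _ => monomial_unit k N (f1 i))).
  have [->|kn] := eqVneq k N.
    rewrite leqnn subnn; under eq_bigr do rewrite expr0.
    rewrite [X in _ - X](eq_bigr (fun=> 1)) ?subrr ?Normc.normc0 //.
    by rewrite mulr_ge0 // ltW.
  have [h|h] := leqP N k; first by apply: mom; lia.
  rewrite -!rmorph_sum -rmorphB normc_conj; apply: mom; lia.
pose T (c : nat -> C) (g : 'I_n -> C) : C :=
  \sum_i \sum_(k < (2 * N).+1) c k * (g i ^+ k * cj (g i) ^+ N).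
have TE c : (forall k, Normc.normc (c k) <= B k) ->
    Normc.normc (T c d - T c f) <= SB * (delta * n%:R).
  move=> cB; rewrite /T exchange_big [X in _ - X]exchange_big -sumrB /=.
  apply: le_trans (normc_sum _ _ _) _; rewrite mulr_suml; apply: ler_sum => k _.
  rewrite -!mulr_sumr -mulrBr Normc.normcM; apply: ler_pM; rewrite ?normc_ge0 //.
    exact: le_trans (cB k) (ler_norm _).
  exact: mono.
pose r : rel 'I_n := fun i j => Normc.normc (d i - f j) <= e.
have en0 : 0 <= e * n%:R by rewrite mulr_ge0 // ltW.
have [S|s sk] := @defect_hall _ r (Num.truncn (e * n%:R)); last first.
  exists s; apply: (@le_trans _ _ (Num.truncn (e * n%:R))%:R); first by rewrite ler_nat.
  by rewrite truncn_le.
pose phi z : R := \big[Num.max/0]_(i in S) tent e (d i) z.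
have phi01 z : 0 <= phi z <= 1.
  rewrite /phi; elim/big_ind: _ => [|x y /andP[x0 x1] /andP[y0 y1]|i _].
  - by rewrite lexx ler01.
  - by rewrite le_max x0 ge_max x1.
  - exact: tent01.
have phiL z w : `|phi z - phi w| <= e^-1 * Normc.normc (z - w).
  apply: (@max_lip _ _ _ (fun i => tent e (d i))) => [|i]; last exact: tent_lip.
  by rewrite mulr_ge0 // normc_ge0.
have [c [cB cphi]] := approx phi phiL phi01.
set NS := [set j | _]%SET.
have cardS : #|S|%:R <= \sum_i phi (d i).
  rewrite -sum1_card natr_sum big_mkcond; apply: ler_sum => i _.
  case: ifP => [iS|_]; last by case/andP: (phi01 (d i)).
  have -> : 1%:R = tent e (d i) (d i) :> R.
    by rewrite /tent subrr Normc.normc0 mul0r subr0 max_r.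
  exact: (le_bigmax_cond 0 (fun i0 => tent e (d i0) (d i)) iS).
have cardN : \sum_i phi (f i) <= #|NS|%:R.
  rewrite -sum1_card natr_sum [leRHS]big_mkcond; apply: ler_sum => j _.
  case: ifP => [_|jN]; first by case/andP: (phi01 (f j)).
  rewrite /phi; elim/big_ind: _ => // [x y x0 y0|i iS]; first by rewrite ge_max x0.
  rewrite /tent ge_max lexx /= subr_le0 ler_pdivlMr // mul1r.
  have : ~~ r i j.
    apply/negP => rij; move/negP: jN; apply; rewrite inE.
    by apply/existsP; exists i; rewrite iS.
  by rewrite /r -ltNge -normcN opprB => /ltW.
have close g : (forall i, Normc.normc (g i) = 1) ->
    Normc.normc ((\sum_i phi (g i))%:C - T c g) <= e / 4 * n%:R.
  move=> g1; rewrite rmorph_sum /T -sumrB; apply: le_trans (normc_sum _ _ _) _.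
  rewrite mulr_natr -[X in _ *+ X]card_ord -sumr_const.
  by apply: ler_sum => i _; exact: cphi.
have diff : \sum_i phi (d i) - \sum_i phi (f i) <= e * n%:R.
  apply: le_trans (ler_norm _) _; rewrite -normc_real rmorphB.
  have -> : (\sum_i phi (d i))%:C - (\sum_i phi (f i))%:C =
    ((\sum_i phi (d i))%:C - T c d) - ((\sum_i phi (f i))%:C - T c f) + (T c d - T c f).
    by ring.
  apply: le_trans (le_normcD _ _) _.
  apply: le_trans (lerD (le_normcD _ _) (TE c cB)) _; rewrite normcN.
  have := close d d1; have := close f f1 => h1 h2.
  have : SB * (delta * n%:R) <= e / 2 * n%:R.
    rewrite mulrA ler_wpM2r // /delta mulrA ler_pdivrMr //.
    have -> : e / 2 * (2 * (SB + 1)) = SB * e + e by field.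
    by rewrite lerDl ltW.
  move=> h3; have -> : e * n%:R = e / 4 * n%:R + e / 4 * n%:R + e / 2 * n%:R by field.
  exact: lerD (lerD h2 h1) h3.
have : #|S|%:R <= #|NS|%:R + e * n%:R :> R by lra.
rewrite -lerBlDl => h.
rewrite -leq_subLR truncn_ge_nat //.
have [le|lt] := leqP #|S| #|NS|; first by rewrite (eqP (le : #|S| - #|NS| == 0)%N).
by rewrite natrB // ltnW.
Qed.

End Transport.
(** * Unitary matrices in the normalized Hilbert-Schmidt norm *)

Section MatrixLemmas.
Variable R : realType.
Local Notation C := R[i].

Lemma adjM n (A B : 'M[C]_n) : (A *m B) ^t* = B ^t* *m A ^t*.
Proof. by rewrite trmx_mul map_mxM. Qed.

Lemma adjK n (A : 'M[C]_n) : A ^t* ^t* = A.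
Proof. exact: trmxCK. Qed.

Lemma adj_diag n (d : 'rV[C]_n) : (diag_mx d) ^t* = diag_mx (map_mx cj d).
Proof. by rewrite tr_diag_mx map_diag_mx. Qed.

Lemma unitarymxE n (U : 'M[C]_n) : U \is unitarymx ->
  U *m U ^t* = 1%:M /\ U ^t* *m U = 1%:M.
Proof. by move=> /unitarymxP UU; split=> //; exact: mulmx1C. Qed.

Lemma normal_spectral n (A : 'M[C]_n) : A *m A ^t* = A ^t* *m A ->
  exists2 P, P \is unitarymx & exists d : 'rV[C]_n, A = P ^t* *m diag_mx d *m P.
Proof.
move=> /normalmxP/orthomx_spectral_subproof[[P d] /= PU ->].
by exists P => //; exists d; rewrite invmx_unitary.
Qed.

Lemma norm2_mulUl n (U A : 'M[C]_n) : U \is unitarymx -> norm2 (U *m A) = norm2 A.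
Proof.
move=> /unitarymxE[_ UU]; rewrite /norm2 adjM.
by rewrite -mulmxA (mulmxA _ U) UU mul1mx.
Qed.

Lemma norm2_mulUr n (U A : 'M[C]_n) : U \is unitarymx -> norm2 (A *m U) = norm2 A.
Proof.
by move=> UU; rewrite -norm2_adj adjM norm2_mulUl ?norm2_adj ?trmxC_unitary.
Qed.

Lemma le_norm2 n (A B : 'M[C]_n) :
  (forall i j, Normc.normc (A i j) <= Normc.normc (B i j)) -> norm2 A <= norm2 B.
Proof.
move=> AB; rewrite !norm2E ler_wpM2l ?invr_ge0 ?sqrtr_ge0 // ler_wsqrtr //.
by apply: ler_sum => i _; rewrite ler_pXn2r ?nnegrE ?normc_ge0.
Qed.

Lemma dist1_sqr (s : R) : 0 <= s -> `|s - 1| <= `|s ^+ 2 - 1|.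
Proof.
move=> s0; have -> : s ^+ 2 - 1 = (s - 1) * (s + 1) by ring.
by rewrite normrM ler_peMr // ger0_norm ?addr_ge0 // lerDr.
Qed.

Lemma normc_realB1 (x : R) : Normc.normc (x%:C - 1) = `|x - 1|.
Proof. by rewrite -normc_real rmorphB. Qed.

(** The unitary part of the polar decomposition. Diagonalize A* A as P* s^2 P with
    s > 0; then U = A P* s^-1 P is unitary, and A - U and A* A - 1 have the same
    norms as s - 1 and s^2 - 1, where |s - 1| <= |s^2 - 1|. *)
Lemma polar_invertible n (A : 'M[C]_n) : A \in unitmx ->
  exists2 U, U \is unitarymx & norm2 (A - U) <= norm2 (A ^t* *m A - 1%:M).
Proof.
move=> Au; have [|P PU [d AE]] := @normal_spectral _ (A ^t* *m A).
  by rewrite adjM adjK.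
have [PP PP'] := unitarymxE PU.
have PU' : P ^t* \is unitarymx by rewrite trmxC_unitary.
pose B := A *m P ^t*.
have BB : B ^t* *m B = diag_mx d.
  rewrite /B adjM adjK -!mulmxA (mulmxA _ A) AE -!mulmxA PP mulmx1.
  by rewrite mulmxA PP mul1mx.
pose s i := vnorm (col i B).
have ds i : d 0 i = (s i ^+ 2)%:C.
  rewrite -vnorm_sqr; transitivity ((B ^t* *m B) i i).
    by rewrite BB !mxE eqxx mulr1n.
  by rewrite !mxE; apply: eq_bigr => j _; rewrite !mxE.
have s0 i : s i != 0.
  apply/negP => /eqP s0; have : diag_mx d \in unitmx.
    rewrite -BB unitmx_mul map_unitmx unitmx_tr andbb.
    by rewrite unitmx_mul Au (unitarymx_unit PU').
  by rewrite unitmxE det_diag (bigD1 i) //= ds s0 expr0n mul0r unitr0.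
pose t : 'rV[C]_n := \row_j ((s j)^-1)%:C; pose sd : 'rV[C]_n := \row_j (s j)%:C.
have tsd : diag_mx t *m diag_mx sd = 1%:M.
  rewrite mulmx_diag -diag_const_mx; congr diag_mx; apply/rowP => j.
  by rewrite !mxE -rmorphM mulVf ?rmorph1.
have tdt : diag_mx t *m diag_mx d *m diag_mx t = 1%:M.
  rewrite !mulmx_diag -diag_const_mx; congr diag_mx; apply/rowP => j.
  by rewrite !mxE ds -!rmorphM expr2 mulrA mulVf // mul1r divff ?rmorph1.
have treal : (diag_mx t) ^t* = diag_mx t.
  rewrite adj_diag; congr diag_mx; apply/rowP => i.
  by rewrite !mxE conjCE /= oppr0.
have VU : B *m diag_mx t \is unitarymx.
  apply/unitarymxP/mulmx1C.
  by rewrite adjM treal mulmxA -(mulmxA (diag_mx t)) BB.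
exists (B *m diag_mx t *m P); first exact: mul_unitarymx.
have -> : A - B *m diag_mx t *m P = B *m diag_mx t *m (diag_mx sd - 1%:M) *m P.
  rewrite mulmxBr -[B *m _ *m diag_mx sd]mulmxA tsd !mulmx1 mulmxBl; congr (_ - _).
  by rewrite /B -mulmxA PP' mulmx1.
have E : norm2 (A ^t* *m A - 1%:M) = norm2 (diag_mx d - 1%:M).
  have -> : A ^t* *m A - 1%:M = P ^t* *m (diag_mx d - 1%:M) *m P.
    by rewrite AE mulmxBr mulmx1 mulmxBl PP'.
  by rewrite (norm2_mulUr _ PU) norm2_mulUl ?trmxC_unitary.
rewrite E (norm2_mulUr _ PU) (norm2_mulUl _ VU).
apply: le_norm2 => i j; rewrite !mxE.
have [_|_] := eqVneq i j; last by rewrite !mulr0n subrr.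
rewrite !mulr1n ds !normc_realB1.
have si : 0 <= s i by exact: l2_ge0.
exact: dist1_sqr.
Qed.

(** Otherwise the numbers e / (k + 1) would be infinitely many roots. *)
Lemma real_not_root (p : {poly C}) (e : R) : p != 0 -> 0 < e ->
  exists2 t : R, 0 < t <= e & ~~ root p t%:C.
Proof.
move=> p0 e0; apply: contrapT => h.
pose x k : C := (e / k.+1%:R)%:C.
have : (size [seq x k | k <- iota 0 (size p)] < size p)%N.
  apply: max_poly_roots => //.
    apply/allP => _ /mapP[k _ ->]; apply: contrapT => /negP nr; apply: h.
    exists (e / k.+1%:R) => //; rewrite divr_gt0 //= ler_pdivrMr //.
    by rewrite ler_peMr ?ler1n // ltW.
  rewrite map_inj_uniq ?iota_uniq // => i j /complexI.
  move/(mulfI (lt0r_neq0 e0))/invr_inj/eqP.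
  by rewrite eqr_nat => /eqP[].
by rewrite size_map size_iota ltnn.
Qed.

Lemma unitmx_shift n (A : 'M[C]_n) (e : R) : 0 < e ->
  exists2 t : R, 0 < t <= e & A + (t%:C)%:M \in unitmx.
Proof.
move=> e0; have [|t te] := @real_not_root (char_poly (- A)) _ _ e0.
  by rewrite monic_neq0 ?char_poly_monic.
rewrite -eigenvalue_root_char /eigenvalue negbK kermx_eq0 => tu.
exists t => //; move: tu.
by rewrite row_free_unit -opprD -scaleN1r unitmxZ // unitrN1.
Qed.

Lemma norm2_scalar n (t : R) : norm2 ((t%:C)%:M : 'M[C]_n) <= `|t|.
Proof.
rewrite -scalemx1 norm2Z normc_real ler_piMr //.
exact: le_trans (norm2_opnorm _) (opnorm1 _ _).
Qed.

Lemma addr_regroup (V : zmodType) (x b a c e : V) :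
  x + b + (a + c) - e = x - e + (a + b) + c.
Proof. by rewrite addrAC (addrAC x) (addrC a b) !addrA. Qed.

(** Adding a small multiple of the identity makes A invertible, so that the polar
    decomposition applies; the cost is absorbed by e. *)
Lemma near_unitary n (A : 'M[C]_n) (e : R) : 0 < e ->
  exists2 U, U \is unitarymx & norm2 (A - U) <= norm2 (A ^t* *m A - 1%:M) + e.
Proof.
move=> e0; set a := norm2 A; have a0 : 0 <= a by exact: norm2_ge0.
have k0 : 0 < 2 * a + 2 by rewrite ltr_wpDl // mulr_ge0.
have [|t /andP[t0 te] tu] := @unitmx_shift n A (Num.min 1 (e / (2 * a + 2))).
  by rewrite lt_min ltr01 divr_gt0.
move: te; rewrite le_min => /andP[t1 te].
have {te} te : t * (2 * a + 2) <= e by rewrite -ler_pdivlMr.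
have [U UU UA] := polar_invertible tu; exists U; first exact: UU.
set T : 'M[C]_n := (t%:C)%:M; rewrite -/T in UA.
have nT : norm2 T <= t by rewrite (le_trans (norm2_scalar _ _)) // gtr0_norm.
have adjT : T ^t* = T.
  by rewrite /T tr_scalar_mx map_scalar_mx /= conjCE /= oppr0.
have step1 : norm2 (A - U) <= norm2 (A + T - U) + t.
  have -> : A - U = (A + T - U) - T by rewrite addrAC addrK.
  by apply: le_trans (norm2D _ _) _; rewrite norm2N lerD2l.
have step2 : norm2 ((A + T) ^t* *m (A + T) - 1%:M) <=
    norm2 (A ^t* *m A - 1%:M) + 2 * (t * a) + t ^+ 2.
  have -> : (A + T) ^t* *m (A + T) - 1%:M =
      (A ^t* *m A - 1%:M) + (t%:C *: A + t%:C *: A ^t* ) + t%:C *: T.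
    have -> : (A + T) ^t* = A ^t* + T by rewrite linearD map_mxD [X in _ + X]adjT.
    rewrite mulmxDl !mulmxDr /T mul_mx_scalar !mul_scalar_mx.
    exact: addr_regroup.
  apply: le_trans (norm2D _ _) _; apply: lerD; last first.
    by rewrite norm2Z normc_real gtr0_norm // expr2 ler_wpM2l // ltW.
  apply: le_trans (norm2D _ _) _; rewrite lerD2l.
  apply: le_trans (norm2D _ _) _.
  by rewrite !norm2Z norm2_adj normc_real gtr0_norm // -/a mulr_natl.
have tt : t ^+ 2 <= t by rewrite expr2 ler_piMl // ltW.
have {}UA := le_trans UA step2; apply: le_trans step1 _.
apply: le_trans (lerD UA (lexx t)) _; rewrite -!addrA lerD2l.
apply: le_trans te.
have -> : t * (2 * a + 2) = 2 * (t * a) + (t + t) by ring.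
by rewrite lerD2l lerD2r.
Qed.

Lemma unitary_spectral n (U : 'M[C]_n) : U \is unitarymx ->
  exists2 P, P \is unitarymx & exists2 d : 'rV[C]_n,
    U = P ^t* *m diag_mx d *m P & forall i, Normc.normc (d 0 i) = 1.
Proof.
move=> UU; have [U1 U2] := unitarymxE UU.
have [|P PU [d UE]] := @normal_spectral _ U; first by rewrite U1.
have [PP PP'] := unitarymxE PU.
exists P => //; exists d => // i.
have : diag_mx d *m (diag_mx d) ^t* = 1%:M.
  have -> : diag_mx d = P *m U *m P ^t*.
    by rewrite UE -!mulmxA PP mulmx1 mulmxA PP mul1mx.
  rewrite !adjM adjK -!mulmxA (mulmxA _ P) PP' mul1mx (mulmxA U) U1 mul1mx.
  by rewrite PP.
rewrite adj_diag mulmx_diag => /matrixP/(_ i i).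
rewrite !mxE eqxx !mulr1n => /(congr1 (@Normc.normc R)).
rewrite Normc.normcM normc_conj Normc.normc1 -expr2 => /eqP.
by rewrite sqrp_eq1 ?normc_ge0 // => /eqP.
Qed.

Lemma conj_expr n (P A : 'M[C]_n) m : P \is unitarymx ->
  (P ^t* *m A *m P) ^+ m = P ^t* *m A ^+ m *m P.
Proof.
move=> /unitarymxE[PP PP']; elim: m => [|m IH].
  by rewrite !expr0 mulmx1 PP'.
rewrite !exprS IH -[LHS]/(_ *m _) -[X in _ = _ *m X *m _]/(_ *m _).
by rewrite -!mulmxA (mulmxA P (P ^t* )) PP mul1mx.
Qed.

Lemma diag_expr n (d : 'rV[C]_n) m :
  (diag_mx d) ^+ m = diag_mx (\row_i (d 0 i ^+ m)).
Proof.
elim: m => [|m IH].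
  rewrite expr0 -[LHS]diag_const_mx; congr diag_mx; apply/rowP => i.
  by rewrite !mxE expr0.
rewrite exprS IH -[LHS]/(_ *m _) mulmx_diag; congr diag_mx; apply/rowP => i.
by rewrite !mxE exprS.
Qed.

Lemma trace_spectral n (P : 'M[C]_n) d m : P \is unitarymx ->
  \tr ((P ^t* *m diag_mx d *m P) ^+ m) = \sum_i (d 0 i) ^+ m.
Proof.
move=> PU; have [PP _] := unitarymxE PU.
rewrite conj_expr // mxtrace_mulC mulmxA PP mul1mx diag_expr mxtrace_diag.
by apply: eq_bigr => i _; rewrite mxE.
Qed.

Lemma perm_unitary n (s : {perm 'I_n}) : (perm_mx s : 'M[C]_n) \is unitarymx.
Proof.
apply/unitarymxP; rewrite tr_perm_mx map_perm_mx -perm_mxM.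
by rewrite mulgV perm_mx1.
Qed.

Lemma perm_conj_diag n (s : {perm 'I_n}) (d : 'rV[C]_n) :
  perm_mx s *m diag_mx d *m (perm_mx s) ^t* = diag_mx (\row_i d 0 (s i)).
Proof.
rewrite tr_perm_mx map_perm_mx -col_permE -row_permE.
by apply/matrixP => i j; rewrite !mxE (inj_eq perm_inj).
Qed.

Lemma norm2_diag_sqr n (d : 'rV[C]_n) :
  norm2 (diag_mx d) ^+ 2 = n%:R^-1 * \sum_i Normc.normc (d 0 i) ^+ 2.
Proof.
rewrite norm2E exprMn exprVn sqr_sqrtr // l2_sqr.
rewrite -(pair_bigA _ (fun i j => Normc.normc (diag_mx d i j) ^+ 2)) /=.
congr (_ * _); apply: eq_bigr => i _; rewrite (bigD1 i) //= big1 ?addr0.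
  by rewrite mxE eqxx mulr1n.
by move=> j ji; rewrite mxE eq_sym (negPf ji) mulr0n Normc.normc0 expr0n.
Qed.

(** Diagonalize both matrices and match the eigenvalues with [transport]. Matched
    eigenvalues contribute at most e'^2 to the square of the norm, and the
    unmatched ones, in proportion at most e', at most 4 each: with e' <= 1 and
    e' <= e^2 / 5 the total is at most e^2. *)
Lemma near_conjugate (e : R) : 0 < e -> exists N : nat, exists2 delta : R, 0 < delta &
  forall n (U W : 'M[C]_n), U \is unitarymx -> W \is unitarymx ->
    (forall m, (0 < m <= N)%N ->
       Normc.normc (\tr (W ^+ m) - \tr (U ^+ m)) <= delta * n%:R) ->
    exists2 V, V \is unitarymx & norm2 (W - V *m U *m V ^t* ) <= e.
Proof.
move=> e0; pose e' := Num.min 1 (e ^+ 2 / 5).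
have e'0 : 0 < e' by rewrite lt_min ltr01 divr_gt0 ?exprn_gt0.
have [N [delta delta0 tr]] := transport e'0.
exists N, delta => // n U W UU WU mom.
have [P PU [d UE d1]] := unitary_spectral UU.
have [Q QU [f WE f1]] := unitary_spectral WU.
have [m m0|s hs] := tr n (fun i => f 0 i) (fun i => d 0 i) f1 d1.
  by rewrite -(trace_spectral f m QU) -(trace_spectral d m PU) -UE -WE mom.
have SU := perm_unitary s; have [SS SS'] := unitarymxE SU.
have [PP PP'] := unitarymxE PU.
exists (Q ^t* *m perm_mx s *m P).
  by rewrite !mul_unitarymx ?trmxC_unitary.
have -> : W - (Q ^t* *m perm_mx s *m P) *m U *m (Q ^t* *m perm_mx s *m P) ^t* =
    Q ^t* *m diag_mx (f - \row_i d 0 (s i)) *m Q.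
  have -> : diag_mx (f - \row_i d 0 (s i)) =
      diag_mx f - perm_mx s *m diag_mx d *m (perm_mx s) ^t*.
    by rewrite perm_conj_diag [LHS]linearB.
  rewrite mulmxBr mulmxBl -WE; congr (_ - _).
  rewrite !adjM adjK UE -!mulmxA; congr (_ *m (_ *m _)).
  by rewrite !mulmxA PP mul1mx -(mulmxA (diag_mx d)) PP mulmx1.
have QU' : Q ^t* \is unitarymx by rewrite trmxC_unitary.
rewrite (norm2_mulUr _ QU) (norm2_mulUl _ QU').
rewrite -(ler_pXn2r (n := 2)) ?nnegrE ?norm2_ge0 ?(ltW e0) // norm2_diag_sqr.
have [n0|n0] := posnP n.
  have -> : n%:R = 0 :> R by rewrite n0.
  by rewrite invr0 mul0r sqr_ge0.
rewrite mulrC ler_pdivrMr ?ltr0n //.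
pose bad := [set i | ~~ (Normc.normc (f 0 i - d 0 (s i)) <= e')]%SET.
apply: (@le_trans _ _ (\sum_(i < n) (e' + 4 * (i \in bad)%:R))).
  apply: ler_sum => i _; rewrite !mxE; set x := Normc.normc _.
  have x0 : 0 <= x by exact: normc_ge0.
  have e'1 : e' <= 1 by rewrite /e' ge_min lexx.
  rewrite inE -/x; have [xe|xe] := boolP (x <= e').
    by rewrite mulr0 addr0; nra.
  have : x <= 2.
    by apply: le_trans (le_normcD _ _) _; rewrite normcN f1 d1.
  by rewrite mulr1; nra.
rewrite big_split /= sumr_const card_ord -mulr_sumr -natr_sum -big_mkcond sum1_card.
rewrite -mulr_natr; have : e' <= e ^+ 2 / 5 by rewrite /e' ge_min lexx orbT.
rewrite ler_pdivlMr // => h5.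
apply: (@le_trans _ _ (e' * 5 * n%:R)); first by move: hs; rewrite -/bad; lra.
by rewrite ler_wpM2r.
Qed.

End MatrixLemmas.
(** * Unitaries of the ultraproduct and their moments *)

Section UltraproductLemmas.
Variables (R : realType) (omega : free_ultrafilter).
Local Notation C := R[i].
Local Notation W := (ultrafilter_sets omega).

Lemma ultra_tail j : W [set k | (j <= k)%N].
Proof.
elim: j => [|j IH]; first exact: filterE.
have Wj : W [set k | k != j].
  have [//|Wj] := in_ultra_setVsetC [set k | k != j] (ultrafilterP omega).
  suff : (set0 : set nat) j by [].
  rewrite -(ultrafilter_free omega) => A WA.
  have [k [Ak /= /negP]] := filter_ex (filterI WA Wj).
  by rewrite negbK => /eqP <-.
by apply: filterS2 IH Wj => k /= jk kj; rewrite ltn_neqAle eq_sym kj.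
Qed.

(** For each k take x achieving the largest possible j <= k. Since the ultrafilter
    is free, the restriction j <= k is harmless. *)
Lemma diagonal_choice (X : nat -> Type) (x0 : forall k, X k)
    (P : forall k, X k -> nat -> Prop) :
  (forall k x i j, (i <= j)%N -> P k x j -> P k x i) ->
  (forall j, W [set k | exists x, P k x j]) ->
  exists x : forall k, X k, forall j, W [set k | P k (x k) j].
Proof.
move=> mono ex.
have ch k : exists x : X k, forall j, (j <= k)%N -> (exists y, P k y j) -> P k x j.
  suff h m : (m <= k.+1)%N ->
      exists x : X k, forall j, (j < m)%N -> (exists y, P k y j) -> P k x j.
    by have [x hx] := h k.+1 (leqnn _); exists x => j jk; apply: hx.
  elim: m => [_|m IH mk]; first by exists (x0 k).
  have [[y ym]|no] := pselect (exists y, P k y m).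
    by exists y => j jm _; apply: mono ym.
  have [x hx] := IH (ltnW mk); exists x => j.
  rewrite ltnS leq_eqVlt => /orP[/eqP ->|jm] ; last exact: hx.
  by move=> e; case: (no e).
exists (fun k => projT1 (cid (ch k))) => j.
apply: filterS2 (ex j) (ultra_tail j) => k /= ek jk.
by case: cid => x /= hx; exact: hx.
Qed.

Variable n : nat -> nat.
Local Notation L := (linf R n).
Local Notation M := (uprod R omega n).
Local Notation cl := (@ucls R omega n).

Lemma unitary_bounded (U : seqmx R n) : (forall k, U k \is unitarymx) ->
  U \in @bounded_seqmx R n.
Proof.
move=> UU; apply/asboolP; exists 1 => k; apply: opnorm_le => // v.
rewrite mul1r -(ler_pXn2r (n := 2)) ?nnegrE ?l2_ge0 //.
rewrite -lecR -!vnorm_sqr; have [_ U2] := unitarymxE (UU k).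
have -> : (U k *m v) ^t* = v ^t* *m (U k) ^t* by rewrite trmx_mul map_mxM.
by rewrite -mulmxA (mulmxA _ (U k)) U2 mul1mx.
Qed.

Definition unitary_seq (U : seqmx R n) (UU : forall k, U k \is unitarymx) : L :=
  Linf (unitary_bounded UU).

Lemma linf_mulE (x y : L) k : (x * y) k = x k *m y k. Proof. by []. Qed.

Lemma linf_exprE (x : L) m k : (x ^+ m) k = (x k) ^+ m.
Proof.
elim: m => [|m IH]; first by rewrite !expr0.
by rewrite !exprS linf_mulE IH.
Qed.

Lemma uclsX (x : L) m : cl (x ^+ m) = cl x ^+ m.
Proof.
elim: m => [|m IH]; first by rewrite !expr0.
by rewrite !exprS uclsM IH.
Qed.

Lemma null_seq_eventually (x : L) :
  (forall e : R, 0 < e -> W [set k | norm2 (x k) <= e]) -> null_seq omega x.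
Proof.
move=> h; apply/null_seqP => e e0.
have e2 : 0 < e / 2 by rewrite divr_gt0.
apply: filterS (h _ e2) => k /= /le_lt_trans; apply.
by rewrite ltr_pdivrMr // ltr_pMr // ltr1n.
Qed.

Lemma unitary_seq_unitary (U : L) : (forall k, U k \is unitarymx) -> unitary (cl U).
Proof.
move=> UU; split; rewrite -[ustar _]/(ustar _) ucls_star -uclsM -ucls1;
  congr cl; apply/val_inj/functional_extensionality_dep => k;
  have [U1 U2] := unitarymxE (UU k); [exact: U2|exact: U1].
Qed.

(** The 2-norm of x_k* x_k - 1 tends to 0 for any representative, so
    [near_unitary] provides unitaries U_k whose distance to x_k tends to 0. *)
Lemma unitary_lift (u : M) : unitary u ->
  exists2 U : L, (forall k, U k \is unitarymx) & cl U = u.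
Proof.
elim/uprodW: u => x [uu _].
have null1 : null_seq omega (star_linf x * x - 1).
  by apply/uclsP; rewrite uclsM -ucls_star ucls1.
have ek k : 0 < (k.+1%:R^-1 : R) by rewrite invr_gt0.
have ch k := near_unitary (x k) (ek k).
pose U0 : seqmx R n := fun k => projT1 (cid2 (ch k)).
have U0U k : U0 k \is unitarymx by rewrite /U0; case: cid2.
have U0x k : norm2 (x k - U0 k) <= norm2 ((x k) ^t* *m x k - 1%:M) + k.+1%:R^-1.
  by rewrite /U0; case: cid2.
exists (unitary_seq U0U) => //.
apply/esym/uclsP; apply: null_seq_eventually => e e0.
have e2 : 0 < e / 2 by rewrite divr_gt0.
move/null_seqP: null1 => /(_ _ e2) h1.
apply: filterS2 h1 (ultra_tail (Num.truncn (e / 2)^-1)) => k /= h1 kj.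
apply: le_trans (U0x k) _.
rewrite [leRHS]splitr; apply: lerD; first exact: ltW.
rewrite -[leRHS]invrK lef_pV2 ?posrE ?invr_gt0 //.
by apply: le_trans (ltW (truncnS_gt _)) _; rewrite ler_nat ltnS.
Qed.

Lemma normc_le_ReIm (z : C) :
  Normc.normc z <= `|complex.Re z| + `|complex.Im z|.
Proof.
case: z => a b /=; rewrite -(ler_pXn2r (n := 2)) ?nnegrE ?sqrtr_ge0 ?addr_ge0 //.
rewrite sqr_sqrtr ?addr_ge0 ?sqr_ge0 // sqrrD !real_normK ?num_real //.
by rewrite -addrA lerD2l lerDr mulrn_wge0 // mulr_ge0.
Qed.

Lemma ReB (z w : C) : complex.Re (z - w) = complex.Re z - complex.Re w.
Proof. by case: z w => a b []. Qed.

Lemma ImB (z w : C) : complex.Im (z - w) = complex.Im z - complex.Im w.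
Proof. by case: z w => a b []. Qed.

Lemma utr_near (x : L) (e : R) : 0 < e ->
  W [set k | Normc.normc (ntr (x k) - utr (cl x)) < e].
Proof.
move=> e0; have e2 : 0 < e / 2 by rewrite divr_gt0.
have [/cvgrPdist_lt/(_ _ e2) hr /cvgrPdist_lt/(_ _ e2) hi] := utrE omega x.
apply: filterS2 hr hi => k /= hr hi.
apply: le_lt_trans (normc_le_ReIm _) _; rewrite [ltRHS]splitr.
by rewrite ReB ImB -normrN -[in X in _ + X]normrN !opprB ltrD.
Qed.

Lemma utr_unique (x : L) (c : C) :
  (forall e : R, 0 < e -> W [set k | Normc.normc (ntr (x k) - c) <= e]) ->
  utr (cl x) = c.
Proof.
move=> h; apply/eqP; rewrite -subr_eq0; apply/eqP/Normc.eq0_normc/eqP.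
rewrite eq_le normc_ge0 andbT; apply/ler_addgt0Pl => e e0; rewrite addr0.
have e2 : 0 < e / 2 by rewrite divr_gt0.
have [k [/= h1 h2]] := filter_ex (filterI (utr_near x e2) (h _ e2)).
apply: le_trans (normc_sub _ (ntr (x k)) _) _.
rewrite [leRHS]splitr lerD // -normcN opprB; exact: ltW.
Qed.

Lemma utr_conj (w x : M) m : unitary w -> utr ((w * x * ustar w) ^+ m) = utr (x ^+ m).
Proof.
move=> [w1 w2].
have -> : (w * x * ustar w) ^+ m = w * x ^+ m * ustar w.
  elim: m => [|m IH]; first by rewrite !expr0 mulr1.
  by rewrite !exprS IH -!mulrA (mulrA (ustar w)) w1 mul1r.
set y := x ^+ m.
have -> : utr (w * y * ustar w) = utr (ustar w * (w * y)); last first.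
  by rewrite mulrA w1 mul1r.
move: {w1 w2} (ustar w) (w * y); elim/uprodW => a; elim/uprodW => b.
rewrite -!uclsM; apply: utr_unique => e e0.
apply: filterS (utr_near (a * b) e0) => k /= /ltW.
suff -> : ntr ((b * a : L) k) = ntr ((a * b : L) k) by [].
by rewrite /ntr; congr (_ * _); exact: mxtrace_mulC.
Qed.

Lemma normc_ntr k (B : 'M[C]_k) : (0 < k)%N ->
  Normc.normc (\tr B) = Normc.normc (ntr B) * k%:R.
Proof.
move=> k0; rewrite /ntr Normc.normcM.
have k0' : (k%:R : C) != 0 by rewrite pnatr_eq0 -lt0n.
rewrite -[in RHS](normc_nat R k) mulrAC -Normc.normcM mulVf //.
by rewrite Normc.normc1 mul1r.
Qed.

(** For every j and almost all k, enough moments of U_k and V_k are close for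
    [near_conjugate] to conjugate U_k to V_k up to 1 / (j + 1); the diagonal
    choice of the conjugating unitaries makes the error tend to 0. *)
Lemma conjugated_of_moments (U V : L) : (forall k, (0 < n k)%N) ->
  (forall k, U k \is unitarymx) -> (forall k, V k \is unitarymx) ->
  (forall m, (0 < m)%N -> utr (cl U ^+ m) = utr (cl V ^+ m)) ->
  conjugated (cl U) (cl V).
Proof.
move=> n0 UU VU mom.
pose X k := {Q : 'M[C]_(n k) | Q \is unitarymx}.
have one_unitary k : (1%:M : 'M[C]_(n k)) \is unitarymx.
  by rewrite -(perm_mx1 C (n k)); exact: perm_unitary.
pose P k (Q : X k) j :=
  norm2 (V k - sval Q *m U k *m (sval Q) ^t* ) <= (j.+1%:R^-1 : R).
have [k Q i j ij|j|Q hQ] := @diagonal_choice X (fun k => exist (fun Q : 'M[C]_(n k) => is_true (Q \is unitarymx)) 1%:M (one_unitary k)) P.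
- move=> /le_trans; apply.
  by rewrite lef_pV2 ?posrE ?ltr0n // ler_nat ltnS.
- have j0 : 0 < (j.+1%:R^-1 : R) by rewrite invr_gt0.
  have [N [d d0 near]] := near_conjugate j0.
  have close m : (0 < m)%N -> W [set k |
      Normc.normc (\tr (V k ^+ m) - \tr (U k ^+ m)) <= d * (n k)%:R].
    move=> m0; have d2 : 0 < d / 2 by rewrite divr_gt0.
    apply: filterS2 (utr_near (V ^+ m) d2) (utr_near (U ^+ m) d2) => k /= h1 h2; rewrite -raddfB normc_ntr //.
    rewrite ler_wpM2r // ntrD ntrN.
    have E : utr (cl (V ^+ m)) = utr (cl (U ^+ m)) by rewrite !uclsX mom.
    apply: le_trans (normc_sub _ (utr (cl (U ^+ m))) _) _.
    rewrite [leRHS]splitr; apply: lerD.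
      by rewrite -E -linf_exprE; exact: ltW.
    by rewrite -normcN opprB -linf_exprE; exact: ltW.
  have allc : W [set k | forall m, (0 < m <= N)%N ->
      Normc.normc (\tr (V k ^+ m) - \tr (U k ^+ m)) <= d * (n k)%:R].
    elim: N {near} => [|N IH]; first by apply: filterE => k m; lia.
    apply: filterS2 IH (close N.+1 isT) => k /= h1 h2 m /andP[m0].
    rewrite leq_eqVlt => /orP[/eqP -> //|mN].
    by apply: h1; rewrite m0.
  apply: filterS allc => k /= h.
  have [Z ZU ZN] := near _ _ _ (UU k) (VU k) h.
  by exists (exist (fun Q : 'M[C]_(n k) => is_true (Q \is unitarymx)) Z ZU).
pose w := unitary_seq (fun k => svalP (Q k)).
exists (cl w); first by apply: unitary_seq_unitary => k; exact: (svalP (Q k)).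
rewrite ucls_star -!uclsM; apply/uclsP; apply: null_seq_eventually => e e0.
apply: filterS (hQ (Num.truncn e^-1)) => k; rewrite /P /= => /le_trans; apply.
by rewrite -[leRHS]invrK lef_pV2 ?posrE ?invr_gt0 // ltW // truncnS_gt.
Qed.

End UltraproductLemmas.
(** * Measurable functions on the circle and their integrals *)

Section CircleMeasurability.
Variable R : realType.
Local Notation C := R[i].
Local Notation T := (borel_circle R).
Local Notation val := (@circle_val R).

Definition lip (L : R) (phi : C -> R) :=
  forall z w, `|phi z - phi w| <= L * Normc.normc (z - w).

Lemma circle_valP (z : circle R) : Normc.normc (val z) = 1.
Proof.
case: z => x xP; have h : `|(x : C^o)| = 1 by exact: (set_mem xP).
exact: (congr1 (@complex.Re R) h).
Qed.

Lemma lip_continuous L phi : lip L phi -> continuous (phi : C^o -> R).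
Proof.
move=> phiL z; have FF : Filter (nbhs (z : C^o)) by exact: nbhs_filter.
apply/(@cvgrPdist_lt _ _ _ _ FF) => e e0.
have L1 : 0 < `|L| + 1 by rewrite ltr_wpDl.
have d0 : 0 < ((e / (`|L| + 1))%:C : C) by rewrite ltcR divr_gt0.
apply: filterS (nbhsx_ballx (z : C^o) _ d0) => w.
rewrite -ball_normE => h.
have {}h : Normc.normc (z - w) < e / (`|L| + 1) by rewrite -ltcR; exact: h.
move: h; rewrite ltr_pdivlMr // => h.
apply: le_lt_trans (phiL _ _) _; apply: le_lt_trans h.
by rewrite mulrC ler_wpM2l ?normc_ge0 // (le_trans (ler_norm _)) // lerDl.
Qed.

Lemma open_complex_ball (U : set C^o) (z : C) : open U -> U z ->
  exists2 r : R, 0 < r & forall w, Normc.normc (z - w) < r -> U w.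
Proof.
move=> oU Uz; have /nbhs_ballP[d /= d0 dU] := open_nbhs_nbhs (conj oU Uz).
have d0' : 0 < complex.Re d by move: d0; case: (d) => x y /andP[].
have dE : d = (complex.Re d)%:C by move: d0; case: (d) => x y /andP[/= /eqP->].
exists (complex.Re d) => // w zw; apply: dU; rewrite -ball_normE /=.
by move: zw; rewrite -ltcR -dE => h; exact: h.
Qed.

Lemma open_circle_measurable (A : set (circle R)) : open A -> measurable (A : set T).
Proof. by move=> oA; exact: sub_sigma_algebra. Qed.

Lemma lip_measurable L phi : lip L phi ->
  measurable_fun [set: T] (fun z : T => phi (val z)).
Proof.
move=> /lip_continuous /continuousP cphi.
apply: (measurability _ (RGenOpens.measurableE R)).
move=> _ [_ [a [b ->] <-]]; rewrite setTI.
apply: open_circle_measurable; exists (phi @^-1` `]a, b[%classic) => //.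
exact/cphi/interval_open.
Qed.

Lemma lip_Re : lip 1 (@complex.Re R).
Proof. by move=> z w; rewrite mul1r -ReB; exact: normc_Re. Qed.

Lemma lip_Im : lip 1 (@complex.Im R).
Proof. by move=> z w; rewrite mul1r -ImB; exact: normc_Im. Qed.

Lemma ReM (z w : C) :
  complex.Re (z * w) = complex.Re z * complex.Re w - complex.Im z * complex.Im w.
Proof. by case: z w => a b []. Qed.

Lemma ImM (z w : C) :
  complex.Im (z * w) = complex.Re z * complex.Im w + complex.Im z * complex.Re w.
Proof. by case: z w => a b []. Qed.

Lemma power_measurable m :
  measurable_fun [set: T] (fun z : T => complex.Re (val z ^+ m)) /\
  measurable_fun [set: T] (fun z : T => complex.Im (val z ^+ m)).
Proof.
elim: m => [|m [IHr IHi]].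
  by split; under eq_fun do rewrite expr0; exact: measurable_cst.
have mr := lip_measurable lip_Re; have mi := lip_measurable lip_Im.
split.
  under eq_fun do rewrite exprS ReM.
  by apply: measurable_funB; exact: measurable_funM.
under eq_fun do rewrite exprS ImM.
by apply: measurable_funD; exact: measurable_funM.
Qed.

(** Moments are complex; indexing their two parts by a boolean allows statements
    about real-valued integrals that cover both. *)
Definition part (h : bool) (z : C) : R := if h then complex.Re z else complex.Im z.

Lemma part_le h z : `|part h z| <= Normc.normc z.
Proof. by case: h; [exact: normc_Re|exact: normc_Im]. Qed.

Lemma part_measurable h m : measurable_fun [set: T] (fun z : T => part h (val z ^+ m)).
Proof. by case: h; have [] := power_measurable m. Qed.

Lemma part_power_le h m (z : T) : `|part h (val z ^+ m)| <= 1.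
Proof. by rewrite (le_trans (part_le _ _)) // normcX circle_valP expr1n. Qed.

End CircleMeasurability.

Section BoundedIntegrals.
Variables (d : measure_display) (R : realType) (T : measurableType d).
Variable mu : {measure set T -> \bar R}.
Hypothesis mu1 : mu setT = 1%E.

Lemma bounded_integrable (f : T -> R) (a : R) : measurable_fun setT f ->
  (forall z, `|f z| <= a) -> mu.-integrable setT (EFin \o f).
Proof.
move=> mf fa; apply: measurable_bounded_integrable => //.
  by rewrite [mu _]mu1 ltry.
exists a; split; first exact: num_real.
by move=> x ax z _; exact: le_trans (fa z) (ltW ax).
Qed.

Lemma Rintegral_const (a : R) : Rintegral mu setT (fun=> a) = a.
Proof. by rewrite Rintegral_cst // [mu _]mu1 /= mulr1. Qed.

Lemma Rintegral_near (f g : T -> R) (a e : R) :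
  measurable_fun setT f -> measurable_fun setT g ->
  (forall z, `|f z| <= a) -> (forall z, `|g z| <= a) ->
  (forall z, `|f z - g z| <= e) ->
  `|Rintegral mu setT f - Rintegral mu setT g| <= e.
Proof.
move=> mf mg fa ga fg; rewrite -RintegralB //; try exact: (@bounded_integrable _ a).
have mfg : measurable_fun setT (fun z => f z - g z) by exact: measurable_funB.
have ifg : mu.-integrable setT (EFin \o (fun z => f z - g z)).
  exact: (@bounded_integrable _ e).
apply: le_trans (le_normr_Rintegral _ ifg) _ => //.
rewrite -[leRHS](Rintegral_const e); apply: le_Rintegral => //.
- by apply: (@bounded_integrable _ e) => [|z]; [exact: measurableT_comp|rewrite normr_id].
- by apply: (@bounded_integrable _ `|e|) => // z.
Qed.

Section LinearCombination.
Variables (I : Type) (r : seq I) (a : I -> R) (f : I -> T -> R).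
Hypothesis mf : forall i, measurable_fun setT (f i).
Hypothesis f1 : forall i z, `|f i z| <= 1.

Lemma lincomb_measurable : measurable_fun setT (fun z => \sum_(i <- r) a i * f i z).
Proof.
elim: r => [|i s IH]; first by under eq_fun do rewrite big_nil; exact: measurable_cst.
under eq_fun do rewrite big_cons.
by apply: measurable_funD => //; apply: measurable_funM.
Qed.

Lemma lincomb_bounded z : `|\sum_(i <- r) a i * f i z| <= \sum_(i <- r) `|a i|.
Proof.
apply: le_trans (ler_norm_sum _ _ _) _; apply: ler_sum => i _.
by rewrite normrM ler_piMr.
Qed.

End LinearCombination.

Lemma Rintegral_lincomb (I : Type) (r : seq I) (a : I -> R) (f : I -> T -> R) :
  (forall i, measurable_fun setT (f i)) -> (forall i z, `|f i z| <= 1) ->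
  Rintegral mu setT (fun z => \sum_(i <- r) a i * f i z) =
  \sum_(i <- r) a i * Rintegral mu setT (f i).
Proof.
move=> mf f1; elim: r => [|i s IH].
  rewrite big_nil -[RHS](Rintegral_const 0).
  by apply: eq_Rintegral => z _; rewrite big_nil.
rewrite big_cons -IH -RintegralZl //; last exact: (@bounded_integrable _ 1).
rewrite -RintegralD //; first by apply: eq_Rintegral => z _; rewrite big_cons.
  apply: (@bounded_integrable _ (`|a i|)); first exact: measurable_funM.
  by move=> z; rewrite normrM ler_piMr.
apply: (@bounded_integrable _ (\sum_(i <- s) `|a i|)).
  exact: lincomb_measurable.
by move=> z; exact: lincomb_bounded.
Qed.

Lemma Rintegral_indic (A : set T) : measurable A ->
  Rintegral mu setT (\1_A : T -> R) = fine (mu A).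
Proof. by move=> mA; rewrite /Rintegral integral_indic // setIT. Qed.

End BoundedIntegrals.

(** * Moments determine probabilities on the circle *)

Section Moments.
Variable R : realType.
Local Notation C := R[i].
Local Notation T := (borel_circle R).
Local Notation val := (@circle_val R).
Local Notation pw h m := (fun z : T => part h (val z ^+ m)).

Definition moment (mu : {measure set T -> \bar R}) h m : R :=
  Rintegral mu setT (pw h m).

Lemma moment0 (mu : {measure set T -> \bar R}) h : mu setT = 1%E ->
  moment mu h 0 = h%:R.
Proof.
move=> mu1; rewrite -(Rintegral_const mu1 h%:R).
by apply: eq_Rintegral => z _; rewrite expr0; case: h.
Qed.

(** By [trig_approx] the integral of phi is within e / 2 of the integral of a
    trigonometric polynomial, which is a linear combination of moments. *)
Lemma lip_integral_eq (mu nu : {measure set T -> \bar R}) L phi :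
  mu setT = 1%E -> nu setT = 1%E ->
  (forall h m, moment mu h m = moment nu h m) ->
  0 <= L -> lip L phi -> (forall z, 0 <= phi z <= 1) ->
  Rintegral mu setT (fun z : T => phi (val z)) =
  Rintegral nu setT (fun z : T => phi (val z)).
Proof.
move=> mu1 nu1 mom L0 phiL phi01; apply/eqP; rewrite -subr_eq0 -normr_le0.
apply/ler_addgt0Pl => e e0; rewrite addr0.
have e2 : 0 < e / 2 by rewrite divr_gt0.
have [N [B]] := trig_approx L0 e2; move=> /(_ phi phiL phi01)[c [_ capp]].
(* The k-th monomial of the approximation has frequency k - N. *)
pose dist (k : 'I_(2 * N).+1) := if (N <= k)%N then (k - N)%N else (N - k)%N.
pose b (k : 'I_(2 * N).+1) : R :=
  if (N <= k)%N then - complex.Im (c k) else complex.Im (c k).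
pose r := [seq (k, h) | k <- index_enum 'I_(2 * N).+1, h <- [:: true; false]].
pose co (kh : 'I_(2 * N).+1 * bool) := if kh.2 then complex.Re (c kh.1) else b kh.1.
pose f (kh : 'I_(2 * N).+1 * bool) (z : T) := part kh.2 (val z ^+ dist kh.1).
pose p (z : T) := \sum_(i <- r) co i * f i z.
have pE z : p z = complex.Re (\sum_(k < (2 * N).+1) c k * (val z ^+ k * cj (val z) ^+ N)).
  rewrite /p /r big_allpairs_dep raddf_sum; apply: eq_bigr => k _.
  rewrite !big_cons big_nil /= addr0 /co /f /b /dist /=.
  rewrite (monomial_unit k N (circle_valP z)).
  case: ifP => _; rewrite ReM /=; first by rewrite mulNr.
  by case: (_ ^+ _) => x y; rewrite /= mulrN opprK.
have fm i : measurable_fun setT (f i) by exact: part_measurable.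
have f1 i z : `|f i z| <= 1 by exact: part_power_le.
have near z : `|phi (val z) - p z| <= e / 2.
  apply: le_trans (capp (val z) (circle_valP z)).
  by rewrite pE -[phi _]/(complex.Re (phi (val z))%:C) -ReB; exact: normc_Re.
pose a := 1 + \sum_(i <- r) `|co i|.
have s0 : 0 <= \sum_(i <- r) `|co i| by exact: sumr_ge0.
have pa z : `|p z| <= a by rewrite (le_trans (lincomb_bounded _ _ f1 _)) // lerDr.
have phia z : `|phi (val z)| <= a.
  by have /andP[h0 h1] := phi01 (val z); rewrite ger0_norm // (le_trans h1) // lerDl.
have close (m : {measure set T -> \bar R}) : m setT = 1%E ->
  `|Rintegral m setT (fun z : T => phi (val z)) - Rintegral m setT p| <= e / 2.
  move=> m1; apply: (Rintegral_near m1 _ _ phia pa near).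
    exact: lip_measurable phiL.
  exact: lincomb_measurable.
have Ep : Rintegral mu setT p = Rintegral nu setT p.
  rewrite !Rintegral_lincomb //; apply: eq_bigr => i _; congr (_ * _).
  exact: mom.
have h1 := close mu mu1; have := close nu nu1; rewrite -Ep => h2.
have -> : Rintegral mu setT (fun z : T => phi (val z)) -
    Rintegral nu setT (fun z : T => phi (val z)) =
    (Rintegral mu setT (fun z : T => phi (val z)) - Rintegral mu setT p) -
    (Rintegral nu setT (fun z : T => phi (val z)) - Rintegral mu setT p) by ring.
by apply: le_trans (ler_normB _ _) _; rewrite [leRHS]splitr lerD.
Qed.

Lemma measure_fin (mu : {measure set T -> \bar R}) (A : set T) :
  mu setT = 1%E -> measurable A -> mu A \is a fin_num.
Proof.
move=> mu1 mA; rewrite ge0_fin_numE //.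
by apply: le_lt_trans (ltry 1); rewrite -mu1 le_measure ?inE.
Qed.

Section Thickening.
Variable F : set T.
Hypothesis F0 : F !=set0.

(* A Lipschitz function that is 1 on F and vanishes at distance e from F. *)
Let psi (e : R) (z : C) : R := sup [set tent e (val w) z | w in F].

Let thick (e : R) : set T := [set z | exists2 w, F w & Normc.normc (val z - val w) < e].

Let psi_sup e z : 0 < e -> has_sup [set tent e (val w) z | w in F].
Proof.
move=> e0; split; first by have [w Fw] := F0; exists (tent e (val w) z), w.
by exists 1 => _ [w _ <-]; case/andP: (tent01 (val w) z e0).
Qed.

Let psi_ge e z w : 0 < e -> F w -> tent e (val w) z <= psi e z.
Proof.
by move=> e0 Fw; apply: ub_le_sup; [case: (psi_sup z e0)|exists w].
Qed.

Let psi01 e z : 0 < e -> 0 <= psi e z <= 1.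
Proof.
move=> e0; apply/andP; split.
  have [w Fw] := F0; apply: le_trans (psi_ge z e0 Fw).
  by case/andP: (tent01 (val w) z e0).
apply: ge_sup; first by case: (psi_sup z e0).
by move=> _ [w _ <-]; case/andP: (tent01 (val w) z e0).
Qed.

Let psi_lip e : 0 < e -> lip e^-1 (psi e).
Proof.
move=> e0.
have h x y : psi e x - psi e y <= e^-1 * Normc.normc (x - y).
  rewrite lerBlDr; apply: ge_sup; first by case: (psi_sup x e0).
  move=> _ [w Fw <-]; rewrite -lerBlDr; have := psi_ge y e0 Fw.
  have := tent_lip (val w) x y e0; rewrite ler_norml => /andP[_ h1 h2].
  by apply: le_trans h1; rewrite lerD2l lerN2.
move=> x y; rewrite ler_norml h andbT lerNl opprB.
by rewrite -(normcN (x - y)) opprB h.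
Qed.

Let thickE e : 0 < e -> thick e = [set z | 0 < psi e (val z)].
Proof.
move=> e0; apply/seteqP; split=> z /=.
  move=> [w Fw zw]; apply: lt_le_trans (psi_ge _ e0 Fw).
  by rewrite /tent lt_max; apply/orP; right; rewrite subr_gt0 ltr_pdivrMr ?mul1r.
move=> p0; apply: contrapT => no; move: p0; apply/negP; rewrite -leNgt.
apply: ge_sup; first by case: (psi_sup (val z) e0).
move=> _ [w Fw <-]; rewrite /tent ge_max lexx /= subr_le0 ler_pdivlMr // mul1r.
by rewrite leNgt; apply/negP => zw; apply: no; exists w.
Qed.

Let psi_measurable e : 0 < e -> measurable_fun [set: T] (fun z : T => psi e (val z)).
Proof. by move=> /psi_lip; exact: lip_measurable. Qed.

Let thick_measurable e : 0 < e -> measurable (thick e).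
Proof.
move=> e0; rewrite thickE //.
have := psi_measurable e0 measurableT (measurable_itv `]0, +oo[).
by rewrite setTI; congr measurable; apply/seteqP; split=> z /=;
  rewrite in_itv /= andbT.
Qed.

(** The function psi e lies between the indicators of F and of its
    e-neighbourhood, and has the same integral for both measures, whence
    mu F <= nu (thick e); now let e tend to 0. *)
Lemma closed_measure_le (mu nu : {measure set T -> \bar R}) :
  closed (F : set (circle R)) ->
  mu setT = 1%E -> nu setT = 1%E -> (forall h m, moment mu h m = moment nu h m) ->
  (mu F <= nu F)%E.
Proof.
move=> cF mu1 nu1 mom.
have mF : measurable F.
  by rewrite -[F]setCK; apply: measurableC; apply: open_circle_measurable; exact: closed_openC.
pose Fk (k : nat) := thick k.+1%:R^-1.
have k0 k : 0 < (k.+1%:R^-1 : R) by rewrite invr_gt0.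
have capF : \bigcap_k Fk k = F.
  apply/seteqP; split=> z.
    move=> h; apply: contrapT => nFz.
    have : open (~` F : set (circle R)) by exact: closed_openC.
    case=> U oU UF; have Uz : U (val z) by rewrite -[U _]/((_ @^-1` U) z) UF.
    have [r r0 rU] := open_complex_ball oU Uz.
    have [w Fw zw] := h (Num.truncn r^-1) I.
    have : U (val w).
      apply: rU; apply: lt_le_trans zw _.
      rewrite -[leRHS]invrK lef_pV2 ?posrE ?invr_gt0 //.
      exact: ltW (truncnS_gt _).
    by rewrite -[U _]/((_ @^-1` U) w) UF; apply.
  move=> Fz k _; exists z => //.
  by rewrite subrr Normc.normc0.
have step k : (mu F <= nu (Fk k))%E.
  have e0 := k0 k; set e := k.+1%:R^-1 in e0.
  have mT := thick_measurable e0; have mp := psi_measurable e0.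
  rewrite -(fineK (measure_fin mu1 mF)) -(fineK (measure_fin nu1 mT)) lee_fin.
  rewrite -(Rintegral_indic mu mF) -(Rintegral_indic nu mT).
  have ind1 (A : set T) z : `|\1_A z : R| <= 1.
    by rewrite indicE; case: (z \in A); rewrite ?normr1 ?normr0.
  have indI (m : {measure set T -> \bar R}) A : m setT = 1%E -> measurable A ->
      m.-integrable setT (EFin \o (\1_A : T -> R)).
    by move=> m1 mA; apply: (@bounded_integrable _ _ _ _ m1 _ 1); [exact: measurable_indic|exact: ind1].
  have psi1 z : `|psi e (val z)| <= 1.
    by have /andP[? ?] := psi01 (val z) e0; rewrite ger0_norm.
  have psiI (m : {measure set T -> \bar R}) : m setT = 1%E ->
      m.-integrable setT (EFin \o (fun z : T => psi e (val z))).
    by move=> m1; apply: (@bounded_integrable _ _ _ _ m1 _ 1).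
  apply: (@le_trans _ _ (Rintegral mu setT (fun z : T => psi e (val z)))).
    apply: le_Rintegral; [by []|exact: indI|exact: psiI|].
    move=> z _; rewrite ?indicE; have [zF|_] := boolP (z \in F).
      apply: le_trans (psi_ge _ e0 (set_mem zF)).
      by rewrite /tent subrr Normc.normc0 mul0r subr0 le_max lexx orbT.
    by case/andP: (psi01 (val z) e0).
  rewrite (lip_integral_eq mu1 nu1 mom _ (psi_lip e0)) ?invr_ge0 ?(ltW e0) //; last first.
    by move=> z; exact: psi01.
  apply: le_Rintegral; [by []|exact: psiI|exact: indI|].
  move=> z _; rewrite ?indicE; have [_|zF] := boolP (z \in _).
    by case/andP: (psi01 (val z) e0).
  rewrite leNgt; apply/negP => p0; move/negP: zF; apply; apply/mem_set.
  by rewrite thickE.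
have cv : nu \o Fk @ \oo --> nu (\bigcap_k Fk k).
  apply: nonincreasing_cvg_mu.
  - by rewrite -ge0_fin_numE //; apply: measure_fin => //; exact: thick_measurable.
  - by move=> i; exact: thick_measurable.
  - by rewrite capF.
  - move=> i j ij; apply/subsetPset => z [w Fw zw]; exists w => //.
    by apply: lt_le_trans zw _; rewrite lef_pV2 ?posrE ?ltr0n // ler_nat ltnS.
rewrite capF in cv; rewrite -(cvg_lim _ cv) //.
apply: lime_ge; first by apply/cvg_ex; eexists; exact: cv.
by apply: nearW => k; exact: step.
Qed.

End Thickening.

(** Closed sets have equal measure by [closed_measure_le], hence so do open sets,
    which are stable under intersection and generate the Borel sets. *)
Lemma measure_eq_of_moments (mu nu : {measure set T -> \bar R}) (A : set T) :
  mu setT = 1%E -> nu setT = 1%E -> (forall h m, moment mu h m = moment nu h m) ->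
  measurable A -> mu A = nu A.
Proof.
move=> mu1 nu1 mom; apply: (@measure_unique _ R T (@open (circle R)) (fun=> setT)).
- by [].
- by move=> X Y; exact: openI.
- by move=> _; exact: openT.
- by apply/seteqP; split=> // z _; exists 0%N.
- move=> O oO; have mO : measurable (O : set T) by exact: open_circle_measurable.
  have cO : closed (~` O : set (circle R)) by exact: open_closedC.
  suff : mu (~` O) = nu (~` O).
    have E (m : {measure set T -> \bar R}) : m setT = 1%E ->
        m O = (1 - fine (m (~` O)))%:E.
      move=> m1; have U : m setT = (m O + m (~` O))%E.
        rewrite -(setUv (O : set T)).
        exact: (measureU m mO (measurableC mO) (setICr _)).
      have [fO fC] := (measure_fin m1 mO, measure_fin m1 (measurableC mO)).
      move: U; rewrite m1 -[in RHS](fineK fO) -[in RHS](fineK fC) -EFinD.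
      by move=> [->]; rewrite addrK fineK.
    by move=> eqC; rewrite !E // eqC.
  have [co0|/set0P co0] := eqVneq (~` O) set0; first by rewrite co0 !measure0.
  by apply/eqP; rewrite eq_le !closed_measure_le.
- by move=> _; rewrite mu1 ltry.
Qed.

End Moments.

(** * The measures lambda_i, their moments and their mixtures *)

Section ExtremePoints.
Variable R : realType.
Local Notation C := R[i].
Local Notation T := (borel_circle R).
Local Notation val := (@circle_val R).
Local Notation pw h m := (fun z : T => part h (val z ^+ m)).

(** Adding 1 makes the integrand nonnegative, which is what the formulas for
    integrals against sums, multiples and images of measures require. *)
Lemma moment_shift (mu : {measure set T -> \bar R}) h m (c : R) : mu setT = 1%E ->
  (\int[mu]_z (1 + part h (val z ^+ m))%:E = (1 + c)%:E)%E -> moment mu h m = c.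
Proof.
move=> mu1 E; have : Rintegral mu setT (fun z : T => 1 + part h (val z ^+ m)) = 1 + c.
  by rewrite /Rintegral E.
have mp := part_measurable (R := R) h m.
rewrite RintegralD //; last 2 first.
- by apply: (@bounded_integrable _ _ _ _ mu1 _ 1) => // z; rewrite normr1.
- by apply: (@bounded_integrable _ _ _ _ mu1 _ 1) => // z; exact: part_power_le.
by rewrite (Rintegral_const mu1) => /addrI.
Qed.

Lemma integral_shift (mu : {measure set T -> \bar R}) h m : mu setT = 1%E ->
  (\int[mu]_z (1 + part h (val z ^+ m))%:E = (1 + moment mu h m)%:E)%E.
Proof.
move=> mu1; have mp := part_measurable (R := R) h m.
have m1p : measurable_fun [set: T] (fun z => 1 + part h (val z ^+ m)).
  by apply: measurable_funD => //; exact: measurable_cst.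
rewrite -[LHS]fineK; last first.
  apply: integrable_fin_num => //.
  apply: (@bounded_integrable _ _ _ _ mu1 (fun z => 1 + part h (val z ^+ m)) 2) => // z.
  apply: le_trans (ler_normD _ _) _; rewrite normr1.
  by rewrite -lerBrDl (le_trans (part_power_le h m z)) // lerBrDl.
congr EFin; rewrite -[LHS]/(Rintegral mu setT _) RintegralD //.
- by rewrite (Rintegral_const mu1).
- by apply: (@bounded_integrable _ _ _ _ mu1 _ 1) => // z; rewrite normr1.
- by apply: (@bounded_integrable _ _ _ _ mu1 _ 1) => // z; exact: part_power_le.
Qed.

Lemma shift_ge0 h m (z : T) : 0 <= 1 + part h (val z ^+ m).
Proof.
have := part_power_le h m z; rewrite ler_norml => /andP[h1 _].
by rewrite addrC -lerBlDr sub0r.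
Qed.

Lemma shift_measurable h m :
  measurable_fun [set: T] (fun z => (1 + part h (val z ^+ m))%:E).
Proof.
apply/measurable_EFinP; apply: measurable_funD; first exact: measurable_cst.
exact: part_measurable.
Qed.

Lemma circle_norm (z : C) : Normc.normc z = 1 -> `|(z : C^o)| = 1.
Proof. by move=> z1; rewrite [LHS](_ : _ = (Normc.normc z)%:C) // z1. Qed.

Definition circle_point (z : C) (z1 : Normc.normc z = 1) : T :=
  SigSub (mem_set (circle_norm z1)).

Lemma circle_pointK z z1 : val (@circle_point z z1) = z.
Proof. by []. Qed.

Lemma val_circle_inj : injective val.
Proof.
move=> [x xP] [y yP] E; have {E} xy : x = y := E.
by case: y / xy in yP *; rewrite (Prop_irrelevance xP yP).
Qed.

Lemma lambda_fin_measure i : (0 < i)%N ->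
  exists m : {measure set T -> \bar R}, [/\ forall A, m A = lambda_fin i A,
    m setT = 1%E & forall h k, moment m h k = (h && (i %| k)%N)%:R].
Proof.
move=> i0; have [ze zei] := complex_prim_root R i0.
have ze1 j : Normc.normc (ze ^+ j) = 1 by rewrite normcX (prim_root_normc zei) expr1n.
pose rt j : T := circle_point (ze1 j).
have nn : 0 <= (i%:R^-1 : R) by rewrite invr_ge0.
pose m : {measure set T -> \bar R} :=
  mscale (NngNum nn) (msum (fun j => \d_(rt j)) i).
have i0' : (i%:R : R) != 0 by rewrite pnatr_eq0 -lt0n.
have mT : m setT = 1%E.
  rewrite /m /= /mscale /= /msum.
  transitivity ((i%:R^-1)%:E * \sum_(j < i) (1%:E : \bar R))%E.
    by congr (_ * _)%E; apply: eq_bigr => j _; exact: diracT.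
  by rewrite sumEFin -EFinM sumr_const card_ord mulVf.
exists m; split => // [A|h k].
  rewrite /m /= /mscale /= /msum /lambda_fin; congr (_ * _)%E.
  have -> : @unity_roots R i = [set` [seq rt j | j <- index_iota 0 i]].
    apply/seteqP; split=> z /=; rewrite /unity_roots /=.
      move=> /(prim_rootP zei)[j zj]; apply/mapP; exists (j : nat).
        by rewrite mem_index_iota /=.
      by apply: val_circle_inj; rewrite zj.
    move=> /mapP[j _ ->]; rewrite circle_pointK -exprM mulnC exprM.
    by rewrite (prim_expr_order zei) expr1n.
  rewrite -fsbig_seq; last first.
    rewrite map_inj_in_uniq ?iota_uniq // => j l.
    rewrite !mem_index_iota /= => ji li /(congr1 val); rewrite !circle_pointK => /eqP.
    by rewrite (eq_prim_root_expr zei) !modn_small // => /eqP.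
  by rewrite big_map big_mkord.
apply: moment_shift => //.
have g0 (z : T) : setT z -> (0 <= (1 + part h (val z ^+ k))%:E)%E.
  by move=> _; rewrite lee_fin shift_ge0.
have mg := shift_measurable h k.
rewrite ge0_integral_mscale // ge0_integral_measure_sum //.
under eq_bigr do rewrite integral_dirac // diracT mul1e.
rewrite sumEFin -EFinM; congr EFin => /=.
rewrite big_split /= sumr_const card_ord mulrDr mulVf //; congr (_ + _).
transitivity (i%:R^-1 * part h (\sum_(j < i) (ze ^+ j) ^+ k)).
  by congr (_ * _); case: h {g0 mg}; rewrite /= raddf_sum.
rewrite (sum_prim_root _ zei) -(rmorph_nat (real_complex R)).
case: h {g0 mg} => /=; last by rewrite mulr0.
by case: (i %| k)%N; rewrite ?mulr0 // mulVf.
Qed.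

Definition ucirc (t : R) : C := cos t +i* sin t.

Lemma ucircX t k : ucirc t ^+ k = ucirc (k%:R * t).
Proof.
elim: k => [|k IH]; first by rewrite expr0 mul0r /ucirc cos0 sin0.
rewrite exprS IH -[k.+1%:R]natr1 mulrDl mul1r [k%:R * t + t]addrC /ucirc cosD sinD.
by rewrite /GRing.mul /=; congr (_ +i* _); rewrite [RHS]addrC.
Qed.

Lemma ucirc2pi k : ucirc (k%:R * (2 * pi)) = 1.
Proof.
rewrite -ucircX (_ : ucirc (2 * pi) = 1) ?expr1n //.
have -> : 2 * pi = pi + pi :> R by rewrite mulr_natl.
by rewrite /ucirc cosD sinD cospi sinpi !mulr0 !mul0r subr0 addr0 mulrNN mulr1.
Qed.

Lemma FTC_everywhere (F f : R -> R) : continuous f ->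
  (forall x : R, is_derive x (1 : R) F (f x)) ->
  (\int[lebesgue_measure]_(x in `[0%R, 1%R]) (f x)%:E = (F 1 - F 0)%:E)%E.
Proof.
move=> cf dF; have cF : continuous F.
  move=> x; apply/differentiable_continuous/derivable1_diffP.
  by have [] := dF x.
rewrite (@continuous_FTC2 _ f F) ?EFinB ?ltr01 //.
- exact: continuous_subspaceT.
- split; first by move=> x _; have [] := dF x.
  + by apply: cvg_at_right_filter; exact: cF.
  + by apply: cvg_at_left_filter; exact: cF.
- by move=> x _; rewrite derive1E; exact: derive_val.
Qed.

Lemma integral_circle h k :
  (\int[lebesgue_measure]_(t in `[0%R, 1%R])
     (1 + part h (ucirc (2 * pi * t) ^+ k))%:E = (1 + (h && (k == 0%N))%:R)%:E :> \bar R)%E.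
Proof.
have [->|k0] := eqVneq k 0%N.
  under eq_integral do rewrite expr0.
  rewrite integral_cst //= lebesgue_measure_itv /= lte_fin ltr01 oppr0 adde0 mule1.
  by case: h.
rewrite andbF addr0.
pose a : R := k%:R * (2 * pi).
have a0 : a != 0 by rewrite mulf_neq0 ?mulf_neq0 ?pnatr_eq0 // gt_eqF ?pi_gt0.
under eq_integral => t _ do rewrite ucircX mulrA -/a.
have [ca sa] : cos a = 1 /\ sin a = 0 by have [-> ->] := ucirc2pi k.
have da x : is_derive x (1 : R) ( *%R a) a.
  have -> : *%R a = a \*: (id : R -> R) by [].
  by apply: is_derive_eq; rewrite -[LHS]/(a * 1) mulr1.
have ca' : continuous ( *%R a : R -> R).
  by move=> x; apply: cvgM; [exact: cvg_cst|exact: cvg_id].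
have cC : continuous (fun t : R => 1 + cos (a * t)).
  move=> x; apply: cvgD; first exact: cvg_cst.
  by apply: (continuous_comp (ca' x)); exact: continuous_cos.
have cS : continuous (fun t : R => 1 + sin (a * t)).
  move=> x; apply: cvgD; first exact: cvg_cst.
  by apply: (continuous_comp (ca' x)); exact: continuous_sin.
have dC (x : R) : is_derive x (1 : R) (fun t => t + a^-1 * sin (a * t)) (1 + cos (a * x)).
  have ds := is_derive1_comp (is_derive_sin (a * x)) (da x).
  have H := is_deriveD (is_derive_id x 1) (is_deriveZ a^-1 ds).
  apply: (is_derive_eq H).
  by rewrite -[_ *: _]/(_ * _) mulrC mulfK.
have dS (x : R) : is_derive x (1 : R) (fun t => t - a^-1 * cos (a * t)) (1 + sin (a * x)).
  have ds := is_derive1_comp (is_derive_cos (a * x)) (da x).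
  have H := is_deriveB (is_derive_id x 1) (is_deriveZ a^-1 ds).
  apply: (is_derive_eq H).
  by rewrite -[_ *: _]/(_ * _) mulrC mulfK // opprK.
case: h => /=.
  rewrite (FTC_everywhere cC dC).
  by rewrite mulr1 mulr0 sa sin0 !mulr0 !addr0 subr0.
rewrite (FTC_everywhere cS dS).
by rewrite mulr1 mulr0 ca cos0; congr EFin; ring.
Qed.

Lemma cis_measurable : measurable_fun [set: R] (fun t : R => cis (2 * pi * t) : T).
Proof.
have c2 : continuous (fun t : R => 2 * pi * t).
  by move=> x; apply: cvgM; [exact: cvg_cst|exact: cvg_id].
apply: (@measurability _ _ _ T _ _ (@open (circle R))) => //.
move=> _ [V oV <-]; rewrite setTI; apply: open_measurable.
case: oV => U oU <-; rewrite openE => t /= Ut.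
have [r r0 rU] := open_complex_ball oU Ut.
have e2 : 0 < r / 2 by rewrite divr_gt0.
have cc : continuous (fun t : R => cos (2 * pi * t)).
  by move=> x; apply: (continuous_comp (c2 x)); exact: continuous_cos.
have cs : continuous (fun t : R => sin (2 * pi * t)).
  by move=> x; apply: (continuous_comp (c2 x)); exact: continuous_sin.
have /cvgrPdist_lt/(_ _ e2) h1 := cc t; have /cvgrPdist_lt/(_ _ e2) h2 := cs t.
apply: filterS2 h1 h2 => s h1 h2; apply: rU.
apply: le_lt_trans (normc_le_ReIm _) _; rewrite ReB ImB [ltRHS]splitr.
exact: ltrD.
Qed.

Lemma lambda_inf_measure : exists m : {measure set T -> \bar R},
  [/\ forall A, m A = lambda_inf A, m setT = 1%E &
      forall h k, moment m h k = (h && (k == 0%N))%:R].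
Proof.
have mD : measurable (`[0, 1[ : set R) by exact: measurable_itv.
pose lm : {measure set (measurableTypeR R) -> \bar R} := measure_function_mrestr__canonical__measure_function_Measure
  (@lebesgue_measure R) mD.
have cm : measurable_fun [set: measurableTypeR R]
    (fun t : measurableTypeR R => cis (2 * pi * t) : T) := cis_measurable.
pose m : {measure set T -> \bar R} :=
  measure_function_pushforward__canonical__measure_function_Measure lm cm.
have mE A : m A = lambda_inf A.
  rewrite /m /= /pushforward /= /mrestr /lambda_inf setIC; congr (lebesgue_measure (_ `&` _)).
have mT : m setT = 1%E.
  rewrite /m /= /pushforward /= /mrestr preimage_setT setTI.
  by rewrite lebesgue_measure_itv /= lte_fin ltr01 oppr0 adde0.
exists m; split => // h k; apply: moment_shift => //.
have g0 (z : T) : (0 <= (1 + part h (val z ^+ k))%:E)%E by rewrite lee_fin shift_ge0.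
have mg := shift_measurable h k.
have mgc : measurable_fun [set: measurableTypeR R]
    (fun t : R => (1 + part h (ucirc (2 * pi * t) ^+ k))%:E).
  exact: (measurableT_comp mg cis_measurable).
rewrite -integral_circle -integral_itv_bndo_bndc; last exact: measurable_funTS mgc.
rewrite (ge0_integral_pushforward cm lm) //.
rewrite preimage_setT.
rewrite (@ge0_negligible_integral _ _ _ lm _ (~` `[0, 1[)) //.
- rewrite setDE setTI setCK.
  apply: eq_measure_integral => A mA AD.
  by rewrite /lm /= /mrestr setIidl.
- exact: measurableC.
- by move=> x _; exact: (g0 (cis (2 * pi * x))).
- transitivity ((@lebesgue_measure R) set0); last exact: measure0.
  by congr (lebesgue_measure _); exact: setICl.
Qed.

(** The index 0 stands for infinity: no positive number is divisible by 0, in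
    accordance with the vanishing of the moments of lambda_oo of positive order. *)
Definition lambda_ (i : nat) : set T -> \bar R :=
  if i is 0 then @lambda_inf R else @lambda_fin R i.

Lemma lambda_measures : exists lam : nat -> {measure set T -> \bar R},
  forall i, [/\ forall A, lam i A = lambda_ i A, lam i setT = 1%E &
    forall h k, moment (lam i) h k = (h && (i %| k)%N)%:R].
Proof.
have ex i : exists m : {measure set T -> \bar R}, [/\ forall A, m A = lambda_ i A,
    m setT = 1%E & forall h k, moment m h k = (h && (i %| k)%N)%:R].
  case: i => [|i]; last exact: lambda_fin_measure.
  exact: lambda_inf_measure.
by exists (fun i => projT1 (cid (ex i))) => i; case: cid.
Qed.

(** The k-th moment of the mixture only involves the divisors of k, hence
    finitely many weights. *)
Lemma mixture (lam : nat -> {measure set T -> \bar R}) (a : nat -> R) :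
  (forall i, lam i setT = 1%E) ->
  (forall i h k, moment (lam i) h k = (h && (i %| k)%N)%:R) ->
  (forall i, 0 <= a i) -> series a @ \oo --> (1 : R) ->
  exists nu : {measure set T -> \bar R}, [/\ nu setT = 1%E,
    forall h k, (0 < k)%N ->
      moment nu h k = h%:R * \sum_(0 <= i < k.+1 | (i %| k)%N) a i &
    forall A, measurable A ->
      series (fun i => a i * fine (lam i A)) @ \oo --> fine (nu A)].
Proof.
move=> lam1 lamM a0 a1.
pose m i : {measure set T -> \bar R} := mscale (NngNum (a0 i)) (lam i).
pose nu : {measure set T -> \bar R} := mseries m 0.
have limE (f : nat -> R) (l : R) : (forall i, 0 <= f i) -> series f @ \oo --> l ->
    (\sum_(0 <= i <oo) (f i)%:E = l%:E)%E.
  move=> f0 fl; apply: cvg_lim => //.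
  under eq_fun do rewrite sumEFin.
  by apply: cvg_EFin; [exact: nearW|exact: fl].
have nuE A : nu A = (\sum_(0 <= i <oo) (a i)%:E * lam i A)%E by [].
have nu1 : nu setT = 1%E.
  rewrite nuE; under eq_eseriesr do rewrite lam1 mule1.
  exact: (limE a 1 a0 a1).
exists nu; split => // [h k k0|A mA].
  apply: moment_shift => //.
  rewrite ge0_integral_measure_series //; last 2 first.
  - by move=> z _; rewrite lee_fin shift_ge0.
  - exact: shift_measurable.
  have E i : (\int[m i]_z (1 + part h (val z ^+ k))%:E =
      (a i * (1 + (h && (i %| k)%N)%:R))%:E)%E.
    rewrite ge0_integral_mscale //.
    - by rewrite integral_shift // lamM -EFinM.
    - exact: shift_measurable.
    - by move=> z _; rewrite lee_fin shift_ge0.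
  under eq_eseriesr do rewrite E.
  apply: limE => [i|]; first by rewrite mulr_ge0 // addr_ge0.
  set f := fun i : nat => _.
  apply/cvgrPdist_lt => e e0; move/cvgrPdist_lt/(_ _ e0): a1.
  move=> h1; apply: filterS2 h1 (nbhs_infty_ge k.+1) => N h1 /= kN.
  have -> : series f N = series a N + h%:R * \sum_(0 <= i < k.+1 | (i %| k)%N) a i.
    rewrite /series /= /f.
    rewrite (eq_bigr (fun i => a i + h%:R * (a i * (i %| k)%N%:R))); last first.
      by move=> i _; case: h {f E}; rewrite mulrDr mulr1 ?mul1r ?mul0r ?mulr0.
    rewrite big_split /= -mulr_sumr; congr (_ + _ * _).
    rewrite (big_cat_nat _ (n := k.+1)) //= [X in _ + X]big_nat_cond.
    rewrite [X in _ + X]big1 ?addr0; last first.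
      move=> i /andP[/andP[ki _] _]; rewrite gtnNdvd ?mulr0 //.
    rewrite [RHS]big_mkcond /=; apply: eq_bigr => i _.
    by case: ifP; rewrite ?mulr1 ?mulr0.
  by rewrite opprD addrACA subrr addr0.
have fin := measure_fin nu1 mA.
have lamE i : ((a i)%:E * lam i A = (a i * fine (lam i A))%:E)%E.
  by rewrite EFinM fineK // measure_fin.
have ge0 i : (0 <= (a i)%:E * lam i A)%E by rewrite mule_ge0 // lee_fin.
have cv : (fun N => \sum_(0 <= i < N) (a i)%:E * lam i A)%E @ \oo --> (fine (nu A))%:E.
  rewrite fineK // nuE; exact: (@is_cvg_nneseries R (fun i => (a i)%:E * lam i A)%E xpredT 0 (fun i _ _ => ge0 i)).
rewrite (_ : series _ =
  (fun N => fine (\sum_(0 <= i < N) (a i)%:E * lam i A)%E)).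
  exact: fine_cvg cv.
apply/funext => N; rewrite /series /=.
by under [in RHS]eq_bigr do rewrite lamE; rewrite sumEFin.
Qed.

End ExtremePoints.
(** * Moments of the associated measure *)

Section AssociatedMoments.
Variables (R : realType) (omega : free_ultrafilter) (n : nat -> nat).
Local Notation T := (borel_circle R).
Local Notation val := (@circle_val R).

Lemma Linfty_power (mu : probability T R) m : Linfty mu (fun z : T => val z ^+ m).
Proof.
have [mr mi] := power_measurable R m; split => //.
by exists 1; apply: aeW => z; rewrite normcX circle_valP expr1n.
Qed.

(** The isomorphism sends the function z to u, hence z^m to u^m, and carries the
    integral to the trace. *)
Lemma assoc_moment (mu : probability T R) (u : uprod R omega n) h m :
  associated_measure mu u -> (0 < m)%N -> moment mu h m = part h (utr (u ^+ m)).
Proof.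
move=> [_ [Phi iso]] m0.
have power1 : (fun z : T => val z ^+ 1) = @circle_val R.
  by apply: functional_extensionality_dep => z; rewrite expr1.
have PhiX : Phi (fun z : T => val z ^+ m) = u ^+ m.
  case: m m0 => // m _; elim: m => [|m IH].
    by rewrite expr1 power1; exact: iso_gen iso.
  rewrite exprS -IH -{1}(iso_gen iso) -(iso_mul iso).
  - by congr Phi; apply/funext => z; rewrite /= exprS.
  - by rewrite -power1; exact: Linfty_power.
  - exact: Linfty_power.
rewrite -PhiX (iso_trace iso); last exact: Linfty_power.
by case: h.
Qed.

End AssociatedMoments.

(** * Moments as limits of values on Borel sets *)

Section LevelSets.
Variable R : realType.
Local Notation T := (borel_circle R).
Local Notation val := (@circle_val R).

Definition level h m (M j : nat) : set T :=
  [set z | j%:R <= M%:R * (1 + part h (val z ^+ m))].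

Lemma level_measurable h m M j : measurable (level h m M j).
Proof.
have mf : measurable_fun [set: T] (fun z => M%:R * (1 + part h (val z ^+ m))).
  apply: measurable_funM; first exact: measurable_cst.
  apply: measurable_funD; first exact: measurable_cst.
  exact: part_measurable.
have := mf measurableT _ (measurable_itv `[j%:R, +oo[).
by rewrite setTI; congr measurable; apply/seteqP; split=> z /=; rewrite in_itv /= andbT.
Qed.

Definition blevel h m M j : borel_set R := SigSub (mem_set (level_measurable h m M j)).

(** A layer-cake sum: where M (1 + p) = x, with p the part of the power, the number
    of positive j <= 2M with j <= x is the integer part of x, so that summing the
    indicators of the level sets and dividing by M recovers 1 + p up to 1 / M. *)
Definition qf h m M (f : borel_set R -> R) : R :=
  M%:R^-1 * \sum_(j < 2 * M) f (blevel h m M j.+1) - 1.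

Lemma sum_ltn (t N : nat) : (t <= N)%N -> (\sum_(j < N) (j < t))%N = t.
Proof.
move=> tN; rewrite -(big_mkord xpredT (fun j => nat_of_bool (j < t)%N)).
rewrite (big_cat_nat _ (n := t)) //= [X in (X + _)%N]big_nat [X in (_ + X)%N]big_nat.
rewrite (eq_bigr (fun=> 1%N)); last by move=> j /andP[_ ->].
rewrite [X in (_ + X)%N]big1 ?addn0; last first.
  by move=> j /andP[tj _]; rewrite ltnNge tj.
by rewrite -big_nat sum_nat_const_nat subn0 muln1.
Qed.

Lemma qf_moment (mu : {measure set T -> \bar R}) h m M : mu setT = 1%E -> (0 < M)%N ->
  `|qf h m M (borel_values mu) - moment mu h m| <= M%:R^-1.
Proof.
move=> mu1 M0; have M0' : 0 < M%:R :> R by rewrite ltr0n.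
have mI j : measurable_fun [set: T] (\1_(level h m M j.+1) : T -> R).
  by apply: measurable_indic; exact: level_measurable.
have bI j (z : T) : `|\1_(level h m M j.+1) z : R| <= 1.
  by rewrite indicE; case: (z \in _); rewrite ?normr1 ?normr0.
pose F (z : T) : R := \sum_(j < 2 * M) M%:R^-1 * \1_(level h m M j.+1) z.
have mF : measurable_fun setT F by exact: (lincomb_measurable _ _ (fun i : 'I__ => mI i)).
pose b : R := \sum_(j < 2 * M) `|M%:R^-1|.
have FB z : `|F z| <= b by exact: (lincomb_bounded _ _ (fun i : 'I__ => bI i)).
have b0 : 0 <= b by exact: sumr_ge0.
have mp := part_measurable (R := R) h m.
have -> : qf h m M (borel_values mu) = Rintegral mu setT (fun z : T => F z - 1).
  rewrite RintegralB //; last 2 first.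
  - exact: (@bounded_integrable _ _ _ _ mu1 _ b).
  - by apply: (@bounded_integrable _ _ _ _ mu1 _ 1) => // z; rewrite normr1.
  rewrite (Rintegral_const mu1) /qf; congr (_ - _).
  rewrite (Rintegral_lincomb mu1) //.
  rewrite mulr_sumr; apply: eq_bigr => j _; congr (_ * _).
  by rewrite Rintegral_indic //; exact: level_measurable.
apply: (@Rintegral_near _ _ _ _ mu1 _ _ (b + 1)) => //.
- by apply: measurable_funB => //; exact: measurable_cst.
- by move=> z; rewrite (le_trans (ler_normB _ _)) // normr1 lerD.
- by move=> z; rewrite (le_trans (part_power_le h m z)) // lerDr.
move=> z; set p := part h _; set t := Num.truncn (M%:R * (1 + p)).
have p0 : 0 <= 1 + p by exact: shift_ge0.
have p2 : 1 + p <= 2.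
  have := part_power_le h m z; rewrite -/p ler_norml => /andP[_ h2].
  by rewrite -lerBrDl (le_trans h2) // lerBrDl.
have tM : (t <= 2 * M)%N.
  rewrite truncn_le_nat; apply: le_lt_trans (_ : (2 * M)%:R < _); last by rewrite ltr_nat.
  by rewrite natrM mulrC ler_wpM2r // ltW.
have -> : F z = M%:R^-1 * t%:R.
  rewrite /F -mulr_sumr; congr (_ * _); rewrite -[in RHS](sum_ltn tM) natr_sum.
  apply: eq_bigr => j _; rewrite indicE /t truncn_gt_nat; congr (_%:R).
  by congr nat_of_bool; apply/idP/idP => [/set_mem //|hz]; exact/mem_set.
have /andP[t1 t2] : t%:R <= M%:R * (1 + p) < t.+1%:R.
  by apply: truncn_itv; rewrite mulr_ge0 // ltW.
have -> : M%:R^-1 * t%:R - 1 - p = - (M%:R^-1 * (M%:R * (1 + p) - t%:R)).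
  by field; rewrite gt_eqF.
rewrite normrN ger0_norm; last by rewrite mulr_ge0 ?invr_ge0 ?subr_ge0 // ltW.
rewrite -[leRHS]mulr1 ler_wpM2l ?invr_ge0 ?(ltW M0') // lerBlDl.
by move: t2; rewrite -natr1 => /ltW.
Qed.

End LevelSets.
(** * Convex hulls and setwise convergence *)

Section ConvexHull.
Variable R : realType.
Local Notation T := (borel_circle R).
Local Notation B := (borel_set R).

Lemma convex_comb (V : lmodType R) (K : set V) (f g : V) (t : R) :
  convex_set (K : set (convex_lmodType V)) -> K f -> K g -> 0 <= t <= 1 ->
  K (t *: f + (1 - t) *: g).
Proof.
move=> cK Kf Kg /andP[t0 t1].
have := cK f g (Itv01 t0 t1) (mem_set Kf) (mem_set Kg).
by move=> /set_mem.
Qed.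

(** By induction on N: the last term is first merged with g, which is then taken
    with the weight that the other terms leave. *)
Lemma convex_sum (V : lmodType R) (K : set V) (f : nat -> V) (w : nat -> R) N g :
  convex_set (K : set (convex_lmodType V)) -> (forall i, K (f i)) -> K g ->
  (forall i, 0 <= w i) -> \sum_(0 <= i < N) w i <= 1 ->
  K (\sum_(0 <= i < N) w i *: f i + (1 - \sum_(0 <= i < N) w i) *: g).
Proof.
move=> cK Kf + w0; elim: N g => [|N IH] g Kg.
  by rewrite !big_geq // add0r subr0 scale1r.
rewrite !big_nat_recr //=; set S := \sum_(0 <= i < N) w i => S1.
have S1' : S <= 1 by rewrite (le_trans _ S1) // lerDl.
have [SE|SN] := eqVneq S 1.
  have wN : w N = 0.
    by apply/eqP; rewrite eq_le w0 andbT; move: S1; rewrite SE gerDl.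
  by have := IH g Kg S1'; rewrite -/S SE wN addr0 scale0r addr0.
have S0 : 0 < 1 - S by rewrite subr_gt0 lt_neqAle SN.
pose t := w N / (1 - S).
have t01 : 0 <= t <= 1.
  rewrite divr_ge0 ?(ltW S0) //= ler_pdivrMr // mul1r lerBrDl.
  exact: S1.
have := IH _ (convex_comb cK (Kf N) Kg t01) S1'; rewrite -/S.
rewrite scalerDr !scalerA addrA.
have -> : (1 - S) * t = w N by rewrite /t mulrC divfK // gt_eqF.
have -> : (1 - S) * (1 - t) = 1 - (S + w N).
  by rewrite /t; field; rewrite gt_eqF.
by [].
Qed.

Lemma convex_hull_convex (V : lmodType R) (S : set V) :
  convex_set (convex_hull S : set (convex_lmodType V)).
Proof.
move=> x y t /set_mem hx /set_mem hy; apply/mem_set => K [cK SK].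
by apply/set_mem/cK; apply/mem_set; [apply: hx|apply: hy].
Qed.

Lemma convex_hull_sub (V : lmodType R) (S : set V) : S `<=` convex_hull S.
Proof. by move=> x Sx K [_ SK]; exact: SK. Qed.

Lemma closed_hull_seq (S : set (set T -> \bar R)) (mu : set T -> \bar R)
    (f : nat -> (B -> R^o)) :
  (forall N, convex_hull (@borel_values R @` S : set (B -> R^o)) (f N)) ->
  (forall A : B, (fun N => f N A : R) @ \oo --> (borel_values mu A : R)) ->
  closed_convex_hull S mu.
Proof.
move=> hf cf.
have cv : (f : nat -> {ptws B -> R^o}) @ \oo --> (borel_values mu : {ptws B -> R^o}).
  apply/cvg_sup => A U; rewrite nbhsE => -[W [[V oV <-] /= VA] WU].
  have nV : nbhs (borel_values mu A : R^o) V by exact: open_nbhs_nbhs.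
  have [M _ hM] := cf A V nV.
  by exists M => // N /hM hN; exact: WU.
move=> U /cv [N _ NU]; exists (f N); split; first exact: hf.
exact: (NU N (leqnn N)).
Qed.

Lemma closed_hull_approx (S : set (set T -> \bar R)) (mu : set T -> \bar R)
    (I : finType) (A : I -> B) (e : R) : 0 < e -> closed_convex_hull S mu ->
  exists2 f : B -> R^o, convex_hull (@borel_values R @` S : set (B -> R^o)) f &
    forall i, `|f (A i) - borel_values mu (A i)| < e.
Proof.
move=> e0 hmu.
pose P i (f : {ptws B -> R^o}) := `|f (A i) - borel_values mu (A i)| < e.
have h i : \forall f \near (borel_values mu : {ptws B -> R^o}), P i f.
  have h := @proj_continuous B (fun=> R^o) (A i) (borel_values mu)
    (ball (borel_values mu (A i) : R^o) e) (nbhsx_ballx _ _ e0).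
  apply: (@filterS _ (nbhs (borel_values mu : {ptws B -> R^o})) _ _ _ _ h) => f.
  by rewrite /= -ball_normE /P /= distrC.
have nb := @filter_forall _ I P (nbhs (borel_values mu : {ptws B -> R^o}))
  (nbhs_filter _) h.
by have [f [hf fU]] := hmu _ nb; exists f.
Qed.

End ConvexHull.
(** * Fixed points of powers of permutations *)

Section CycleTypes.

(** For l the list of the cycle lengths of a permutation, [ncyc l m] is the number
    of fixed points of its m-th power ([perm_of_cycles]). *)
Definition ncyc (l : seq nat) (m : nat) : nat := (\sum_(c <- l | c %| m) c)%N.

Definition nfix n (s : {perm 'I_n}) (m : nat) : nat := (\sum_(x < n) (iter m s x == x))%N.

Lemma iter_ordS c m (i : 'I_c) : iter m (@ordS c) i = ((i + m) %% c)%N :> nat.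
Proof.
elim: m => [|m IH] /=; first by rewrite addn0 modn_small.
by rewrite IH -addn1 modnDml addn1 addnS.
Qed.

Lemma iter_ordS_fix c m (i : 'I_c) : (iter m (@ordS c) i == i) = (c %| m)%N.
Proof.
rewrite -val_eqE /= iter_ordS -[X in _ == X](modn_small (ltn_ord i)).
by rewrite -[X in (_ == X %% _)%N]addn0 eqn_modDl mod0n.
Qed.

Definition block_fun c n (f : 'I_c -> 'I_c) (g : 'I_n -> 'I_n) (x : 'I_(c + n)) : 'I_(c + n) :=
  match fintype.split x with inl i => lshift n (f i) | inr j => rshift c (g j) end.

Lemma block_lshift c n f g i : @block_fun c n f g (lshift n i) = lshift n (f i).
Proof. by rewrite /block_fun -/(unsplit (inl i)) unsplitK. Qed.

Lemma block_rshift c n f g j : @block_fun c n f g (rshift c j) = rshift c (g j).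
Proof. by rewrite /block_fun -/(unsplit (inr j)) unsplitK. Qed.

Lemma block_inj c n f g : injective f -> injective g -> injective (@block_fun c n f g).
Proof.
move=> fi gi x y; rewrite -(splitK x) -(splitK y).
case: (fintype.split x) => i; case: (fintype.split y) => j /=; rewrite ?block_lshift ?block_rshift.
- by move/lshift_inj/fi => ->.
- by move/eqP; rewrite eq_lrshift.
- by move/eqP; rewrite eq_rlshift.
- by move/rshift_inj/gi => ->.
Qed.

Lemma iter_block c n f g m x : iter m (@block_fun c n f g) x =
  @block_fun c n (iter m f) (iter m g) x.
Proof.
elim: m => [|m IH] /=; first by rewrite -(splitK x); case: (fintype.split x) => i /=;
  rewrite ?block_lshift ?block_rshift.
rewrite IH -(splitK x); case: (fintype.split x) => i /=.
  by rewrite !block_lshift.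
by rewrite !block_rshift.
Qed.

Lemma perm_of_cycles (l : seq nat) n : all (fun c => 0 < c)%N l -> sumn l = n ->
  exists s : {perm 'I_n}, forall m, nfix s m = ncyc l m.
Proof.
elim: l n => [|c l IH] n /=.
  by move=> _ <-; exists 1%g => m; rewrite /nfix /ncyc big_ord0 big_nil.
move=> /andP[c0 l0] <-; have [s hs] := IH _ l0 erefl.
exists (perm (block_inj (@ordS_inj c) (@perm_inj _ s))) => m.
rewrite /nfix /ncyc big_cons big_split_ord /= -/(ncyc l m) -hs.
under eq_bigr => i _ do rewrite (eq_iter (permE _)) iter_block block_lshift
  (inj_eq (@lshift_inj _ _)) iter_ordS_fix.
under [X in (_ + X)%N]eq_bigr => i _ do rewrite (eq_iter (permE _)) iter_block block_rshift
  (inj_eq (@rshift_inj _ _)).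
rewrite sum_nat_const card_ord -/(nfix s m).
by case: ifP; rewrite ?muln1 ?muln0.
Qed.

Section Period.
Variables (n : nat) (s : {perm 'I_n}).

Lemma ex_period x : exists i, (0 < i)%N && (iter i s x == x).
Proof. by exists #[s]%g; rewrite order_gt0 -permX expg_order perm1 eqxx. Qed.

Definition period x := ex_minn (ex_period x).

Lemma period_dvd m x : (iter m s x == x) = (period x %| m)%N.
Proof.
rewrite /period; case: ex_minnP => p /andP[p0 /eqP px] pmin.
have iterp q : iter (q * p) s x = x.
  by elim: q => [//|q IH]; rewrite mulSn iterD IH px.
rewrite {1}(divn_eq m p) addnC iterD iterp.
apply/eqP/idP => [h|/eqP ->//].
have [r0|r0] := posnP (m %% p); first by rewrite /dvdn r0.
have := pmin (m %% p)%N; rewrite r0 h eqxx => /(_ isT).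
by rewrite leqNgt ltn_pmod.
Qed.

Lemma period_gt0 x : (0 < period x)%N.
Proof. by rewrite /period; case: ex_minnP => p /andP[]. Qed.

(** The points on i-cycles are those of least positive period i. *)
Definition oncyc (i : nat) : nat := (\sum_(x < n) (period x == i))%N.

Lemma oncyc0 : oncyc 0 = 0%N.
Proof. by apply: big1 => x _; rewrite eqn0Ngt period_gt0. Qed.

Lemma nfix_oncyc m : (0 < m)%N ->
  nfix s m = (\sum_(0 <= i < m.+1 | i %| m) oncyc i)%N.
Proof.
move=> m0; rewrite exchange_big /=; apply: eq_bigr => x _.
rewrite period_dvd; have [d|nd] := boolP (period x %| m)%N.
  rewrite (big_rem (period x)); last first.
    by rewrite mem_index_iota leq0n ltnS; exact: dvdn_leq.
  rewrite d eqxx big1_seq // => i /andP[_].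
  by rewrite mem_rem_uniq ?iota_uniq // inE eq_sym => /andP[/negPf ->].
rewrite big1 // => i id; case: eqP => // e; move: nd; by rewrite e id.
Qed.

Lemma sum_oncyc_le N : (\sum_(0 <= i < N) oncyc i <= n)%N.
Proof.
rewrite exchange_big /= -[leqRHS]card_ord -sum1_card; apply: leq_sum => x _.
have [xN|Nx] := ltnP (period x) N.
  rewrite (big_rem (period x)); last by rewrite mem_index_iota.
  rewrite eqxx big1_seq // => i /andP[_].
  by rewrite mem_rem_uniq ?iota_uniq // inE eq_sym => /andP[/negPf ->].
rewrite big_nat big1 // => i /andP[_ iN]; case: eqP => // e.
by move: iN; rewrite -e ltnNge Nx.
Qed.

End Period.

Lemma trace_perm (R : realType) n (s : {perm 'I_n}) m :
  \tr ((perm_mx s : 'M[R[i]]_n) ^+ m) = (nfix s m)%:R.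
Proof.
have -> : (perm_mx s : 'M[R[i]]_n) ^+ m = perm_mx (s ^+ m)%g.
  elim: m => [|m IH]; first by rewrite expr0 expg0 perm_mx1.
  by rewrite exprS IH expgS perm_mxM.
rewrite /nfix natr_sum; apply: eq_bigr => x _; rewrite !mxE permX.
by rewrite eq_sym; case: eqP.
Qed.

End CycleTypes.
(** * Permutations that imitate convex combinations of the lambda_i *)

Section Realization.
Variable R : realType.
Local Notation T := (borel_circle R).
Local Notation B := (borel_set R).

(** Up to an error, n points carry a permutation, described by its cycle lengths,
    with the approximate moments of f. The form of the error makes this class
    convex: the additive constant absorbs the rounding of block sizes, and the
    part proportional to n adds up over blocks. *)
Definition realizable (N M : nat) : set (B -> R^o) :=
  [set f | exists K : R, forall n, exists l : seq nat,
    [/\ all (fun c => 0 < c)%N l, sumn l = n &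
        forall m, (0 < m <= N)%N ->
          `|(ncyc l m)%:R - n%:R * qf true m M f| <= K + n%:R / M%:R /\
          `|n%:R * qf false m M f| <= K + n%:R / M%:R]].

Lemma qf_comb h m M (f g : B -> R^o) (t : R) :
  qf h m M (t *: f + (1 - t) *: g) = t * qf h m M f + (1 - t) * qf h m M g.
Proof.
rewrite /qf -[X in M%:R^-1 * X](_ : t * (\sum_(j < 2 * M) f (blevel R h m M j.+1)) +
  (1 - t) * (\sum_(j < 2 * M) g (blevel R h m M j.+1)) = _); first by ring.
by rewrite !mulr_sumr -big_split.
Qed.

Lemma realizable_measure N M (mu : {measure set T -> \bar R}) (K : nat) : (0 < M)%N ->
  mu setT = 1%E -> (forall m, moment mu false m = 0) ->
  (forall n, exists l : seq nat, [/\ all (fun c => 0 < c)%N l, sumn l = n &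
    forall m, (0 < m <= N)%N ->
      `|(ncyc l m)%:R - n%:R * moment mu true m| <= K%:R]) ->
  realizable N M (borel_values mu).
Proof.
move=> M0 mu1 mom0 cyc; exists K%:R => n; have [l [l0 ln lm]] := cyc n.
exists l; split => // m mN.
have q h := qf_moment h m mu1 M0.
have qn h : `|n%:R * moment mu h m - n%:R * qf h m M (borel_values mu)| <= n%:R / M%:R.
  by rewrite -mulrBr normrM ger0_norm // ler_wpM2l // distrC.
split.
  have -> : (ncyc l m)%:R - n%:R * qf true m M (borel_values mu) =
    ((ncyc l m)%:R - n%:R * moment mu true m) +
    (n%:R * moment mu true m - n%:R * qf true m M (borel_values mu)).
    by rewrite addrA subrK.
  by apply: le_trans (ler_normD _ _) _; rewrite lerD // lm.
have := qn false; rewrite mom0 mulr0 sub0r normrN => /le_trans; apply.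
by rewrite lerDr.
Qed.

Lemma ncyc_cat l l' m : ncyc (l ++ l') m = (ncyc l m + ncyc l' m)%N.
Proof. by rewrite /ncyc big_cat. Qed.

Lemma ncyc_nseq q i m : ncyc (nseq q i) m = (if i %| m then q * i else 0)%N.
Proof.
elim: q => [|q IH]; first by rewrite /ncyc big_nil mul0n if_same.
rewrite /ncyc big_cons -/(ncyc (nseq q i) m) IH mulSn.
by case: (i %| m)%N.
Qed.

(** As many i-cycles as possible, completed by fewer than i fixed points. *)
Lemma cycles_finite i n : (0 < i)%N -> exists l : seq nat,
  [/\ all (fun c => 0 < c)%N l, sumn l = n & forall m,
    `|(ncyc l m)%:R - n%:R * (i %| m)%N%:R| <= i%:R :> R].
Proof.
move=> i0; exists (nseq (n %/ i) i ++ nseq (n %% i) 1%N); split.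
- by rewrite all_cat !all_nseq i0 !orbT.
- by rewrite sumn_cat !sumn_nseq mul1n mulnC -divn_eq.
move=> m; rewrite ncyc_cat !ncyc_nseq dvd1n muln1.
case: (i %| m)%N; first by rewrite -divn_eq mulr1 subrr normr0.
by rewrite mulr0 subr0 add0n ger0_norm // ler_nat ltnW // ltn_pmod.
Qed.

(** A single n-cycle: its m-th power has no fixed point unless n divides m, and
    then n <= m <= N. *)
Lemma cycle_infinite N n : exists l : seq nat,
  [/\ all (fun c => 0 < c)%N l, sumn l = n & forall m, (0 < m <= N)%N ->
    `|(ncyc l m)%:R| <= N%:R :> R].
Proof.
exists (nseq (0 < n)%N n); split.
- by case: n => //= n; rewrite andbT.
- by case: n => //= n; rewrite addn0.
move=> m /andP[m0 mN]; rewrite ger0_norm // ler_nat ncyc_nseq.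
case: ifP => // nm; apply: leq_trans mN; apply: leq_trans (dvdn_leq m0 nm).
by case: (0 < n)%N; rewrite ?mul1n ?mul0n.
Qed.

Lemma realizable_lambdas N M : (0 < M)%N ->
  @borel_values R @` (@lambdas R) `<=` realizable N M.
Proof.
move=> M0 _ [la la_in <-].
suff [i ->] : exists i, la = @lambda_ R i.
  have [lam lamP] := lambda_measures R.
  have [lamE lam1 lamM] := lamP i.
  have -> : borel_values (@lambda_ R i) = borel_values (lam i).
    by apply/funext => A; rewrite /borel_values lamE.
  case: i lamE lam1 lamM => [|i] lamE lam1 lamM.
    apply: (@realizable_measure _ _ _ N) => // n.
    have [l [l0 ln lm]] := cycle_infinite N n; exists l; split => // m mN.
    rewrite lamM /= dvd0n; case: eqP mN => [->//|_] mN.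
    by rewrite mulr0 subr0 lm.
  apply: (@realizable_measure _ _ _ i.+1) => // n.
  have [l [l0 ln lm]] := @cycles_finite i.+1 n isT; exists l; split => // m mN.
  by rewrite lamM lm.
case: la_in => [[i /= i0 <-]|->]; last by exists 0%N.
by exists i; case: i i0.
Qed.

(** Cut the n points into two blocks of sizes about t n and (1 - t) n, and take on
    each block the cycles that realize f and g. *)
Lemma realizable_convex N M : (0 < M)%N ->
  convex_set (realizable N M : set (convex_lmodType (B -> R^o))).
Proof.
move=> M0 f g p /set_mem[K1 h1] /set_mem[K2 h2]; apply/mem_set.
set t := p%:num; have t0 : 0 <= t by rewrite /t ge0.
have t1 : t <= 1 by rewrite /t le1.
pose D := \sum_(hm : bool * 'I_N.+1) (`|qf hm.1 hm.2 M f| + `|qf hm.1 hm.2 M g|).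
have Dq h m : (m <= N)%N -> `|qf h m M f| + `|qf h m M g| <= D.
  move=> mN; have mN' : (m < N.+1)%N by [].
  rewrite /D (bigD1 (h, Ordinal mN')) //= lerDl.
  by apply: sumr_ge0 => *; rewrite addr_ge0.
exists (K1 + K2 + D) => n.
pose n1 := Num.truncn (t * n%:R).
have tn0 : 0 <= t * n%:R by rewrite mulr_ge0.
have /andP[n1a n1b] := truncn_itv tn0; rewrite -/n1 in n1a n1b.
have n1n : (n1 <= n)%N.
  rewrite -(ler_nat R); apply: le_trans n1a _; by rewrite ler_piMl.
have [l1 [l10 l1n l1m]] := h1 n1; have [l2 [l20 l2n l2m]] := h2 (n - n1)%N.
exists (l1 ++ l2); split.
- by rewrite all_cat l10.
- by rewrite sumn_cat l1n l2n subnKC.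
move=> m mN; have /andP[_ mN'] := mN.
have [a1 b1] := l1m m mN; have [a2 b2] := l2m m mN.
have -> : conv p f g = t *: f + (1 - t) *: g by [].
pose d := t * n%:R - n1%:R.
have d1 : `|d| <= 1.
  by rewrite ger0_norm ?subr_ge0 // lerBlDl natr1 ltW.
have split h : n%:R * qf h m M (t *: f + (1 - t) *: g) =
    n1%:R * qf h m M f + (n - n1)%:R * qf h m M g + d * (qf h m M f - qf h m M g).
  by rewrite qf_comb natrB // /d; ring.
have dle h : `|d * (qf h m M f - qf h m M g)| <= D.
  rewrite normrM; apply: le_trans (Dq h m mN'); apply: le_trans (ler_normB _ _).
  by rewrite ler_piMl.
have nM : n%:R / M%:R = n1%:R / M%:R + (n - n1)%:R / M%:R :> R.
  by rewrite natrB // -mulrDl addrC subrK.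
split; rewrite split ?ncyc_cat ?natrD nM.
  have -> : (ncyc l1 m)%:R + (ncyc l2 m)%:R -
      (n1%:R * qf true m M f + (n - n1)%:R * qf true m M g +
       d * (qf true m M f - qf true m M g)) =
    ((ncyc l1 m)%:R - n1%:R * qf true m M f) +
    ((ncyc l2 m)%:R - (n - n1)%:R * qf true m M g) -
    d * (qf true m M f - qf true m M g) by ring.
  apply: le_trans (ler_normB _ _) _; apply: le_trans (lerD (ler_normD _ _) (dle _)) _.
  by move: (lerD a1 a2) => h; lra.
apply: le_trans (ler_normD _ _) _; apply: le_trans (lerD (ler_normD _ _) (dle _)) _.
by move: (lerD b1 b2) => h; lra.
Qed.

(** Take f in the hull close to mu on the level sets that enter [qf]. Each of the
    three passages, from fixed points to the approximate moments of f, to those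
    of mu, and to the moments of mu, costs about n / M, and M is of order 4 / e. *)
Lemma perms_of_hull (mu : {measure set T -> \bar R}) N (e : R) :
  mu setT = 1%E -> closed_convex_hull (@lambdas R) mu -> 0 < e ->
  exists n0 : nat, forall n, (n0 <= n)%N -> exists s : {perm 'I_n},
    forall m, (0 < m <= N)%N ->
      `|(nfix s m)%:R - n%:R * moment mu true m| <= e * n%:R /\
      `|n%:R * moment mu false m| <= e * n%:R.
Proof.
move=> mu1 hull e0; pose M := (Num.truncn (4 / e)).+1.
have M0 : 0 < M%:R :> R by rewrite ltr0n.
have Me : 4 / M%:R <= e.
  by rewrite ler_pdivrMr // mulrC -ler_pdivrMr // ltW // truncnS_gt.
have M2 : 0 < ((2 * M)%:R : R)^-1 by rewrite invr_gt0 ltr0n.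
have [f fh fA] := closed_hull_approx (fun x : bool * 'I_N.+1 * 'I_(2 * M) =>
  blevel R x.1.1 x.1.2 M (x.2).+1) M2 hull.
have fq h m : (m <= N)%N -> `|qf h m M f - qf h m M (borel_values mu)| <= M%:R^-1.
  move=> mN; rewrite /qf opprB addrA subrK -mulrBr -sumrB normrM.
  rewrite ger0_norm ?invr_ge0 // ler_piMr ?invr_ge0 //.
  apply: le_trans (ler_norm_sum _ _ _) _.
  have -> : 1 = \sum_(j < 2 * M) ((2 * M)%:R : R)^-1.
    by rewrite sumr_const card_ord -[RHS]mulr_natl divff // pnatr_eq0.
  have mN' : (m < N.+1)%N by [].
  by apply: ler_sum => j _; exact: ltW (fA (h, Ordinal mN', j)).
have [K fK] : realizable N M f.
  by apply: fh; split; [exact: realizable_convex|exact: realizable_lambdas].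
exists (Num.truncn (K * M%:R)).+1 => n nn.
have Kn : K <= n%:R / M%:R.
  rewrite ler_pdivlMr // ltW // (lt_le_trans (truncnS_gt _)) //.
  by rewrite ler_nat.
have [l [l0 ln lm]] := fK n; have [s sl] := perm_of_cycles l0 ln.
exists s => m mN; have /andP[_ mN'] := mN; have [a b] := lm m mN.
rewrite sl.
have n4 : n%:R / M%:R * 4 <= e * n%:R.
  by rewrite -mulrA mulrC ler_wpM2r // mulrC.
have close h : `|n%:R * qf h m M f - n%:R * moment mu h m| <= n%:R / M%:R * 2.
  rewrite -mulrBr normrM ger0_norm // -mulrA ler_wpM2l //.
  have -> : qf h m M f - moment mu h m = (qf h m M f - qf h m M (borel_values mu)) +
    (qf h m M (borel_values mu) - moment mu h m) by rewrite addrA subrK.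
  apply: le_trans (ler_normD _ _) _.
  by rewrite mulr_natr mulr2n lerD // ?fq // qf_moment.
move: (close true) (close false) a b n4 Kn.
move: (n%:R / M%:R) (e * n%:R) (n%:R * moment mu true m) (n%:R * moment mu false m)
  (n%:R * qf true m M f) (n%:R * qf false m M f) ((ncyc l m)%:R : R) => r E x y z w c.
rewrite !ler_norml => /andP[? ?] /andP[? ?] /andP[? ?] /andP[? ?] ? ?.
by split; apply/andP; split; lra.
Qed.

End Realization.
(** * The two implications *)

Section Directions.
Variables (R : realType) (omega : free_ultrafilter) (n : nat -> nat).
Hypothesis n_gt0 : forall k, (0 < n k)%N.
Hypothesis n_oo : n @ \oo --> \oo.
Local Notation C := R[i].
Local Notation T := (borel_circle R).
Local Notation B := (borel_set R).
Local Notation W := (ultrafilter_sets omega).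
Local Notation M := (uprod R omega n).
Local Notation cl := (@ucls R omega n).

Lemma ultra_size j : W [set k | (j <= n k)%N].
Proof.
have [k0 _ hk] := n_oo (nbhs_infty_ge j).
by apply: filterS (ultra_tail omega k0) => k /hk.
Qed.

Lemma ntr_perm k (s : {perm 'I_(n k)}) m :
  ntr ((perm_mx s : 'M[C]_(n k)) ^+ m) = ((nfix s m)%:R / (n k)%:R)%:C.
Proof.
rewrite /ntr trace_perm mulrC rmorphM fmorphV /= -!(rmorph_nat (real_complex R)).
by [].
Qed.

Lemma normc_dist_real (x : R) (z : C) :
  Normc.normc (x%:C - z) <= `|x - complex.Re z| + `|complex.Im z|.
Proof.
by apply: le_trans (normc_le_ReIm _) _; rewrite ReB ImB /= sub0r normrN.
Qed.

(** Permutations whose moments tend to those of u give, with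
    [conjugated_of_moments], a conjugate of u. *)
Lemma perm_of_measure (u : M) (mu : probability T R) :
  unitary u -> associated_measure mu u -> closed_convex_hull (@lambdas R) mu ->
  exists2 v, uperm v & conjugated u v.
Proof.
move=> uu muP hull; have mu1 : mu setT = 1%E := probability_setT mu.
have [U UU UE] := unitary_lift uu; rewrite -UE in muP *.
pose P k (s : {perm 'I_(n k)}) j := forall m, (0 < m <= j)%N ->
  `|(nfix s m)%:R - (n k)%:R * moment mu true m| <= j.+1%:R^-1 * (n k)%:R /\
  `|(n k)%:R * moment mu false m| <= j.+1%:R^-1 * (n k)%:R.
have [k s i j ij Pj m|j|s hs] := @diagonal_choice omega (fun k => {perm 'I_(n k)})
    (fun k => 1%g) P.
- move=> /andP[m0 mi]; have [|a b] := Pj m; first by rewrite m0 (leq_trans mi).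
  have h : j.+1%:R^-1 * (n k)%:R <= i.+1%:R^-1 * (n k)%:R :> R.
    by rewrite ler_wpM2r // lef_pV2 ?posrE ?ltr0n // ler_nat ltnS.
  by split; [exact: le_trans a h|exact: le_trans b h].
- have j0 : 0 < (j.+1%:R^-1 : R) by rewrite invr_gt0.
  have [n0 hn0] := perms_of_hull j mu1 hull j0.
  by apply: filterS (ultra_size n0) => k /= /hn0.
pose V := unitary_seq (fun k => perm_unitary R (s k)).
exists (cl V); first by exists V => // k; exact: perm_mx_is_perm.
apply: conjugated_of_moments => // [k|m m0]; first exact: perm_unitary.
rewrite -!uclsX; apply/esym/utr_unique => e e0.
pose j0 := Num.truncn (2 / e).
apply: filterS (hs (maxn j0 m)) => k /= /(_ m).
rewrite m0 leq_maxr => /(_ isT)[a b].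
rewrite linf_exprE [X in ntr (X ^+ _)](_ : _ = perm_mx (s k)) // ntr_perm.
apply: le_trans (normc_dist_real _ _) _.
have nk : 0 < (n k)%:R :> R by rewrite ltr0n.
have je : (maxn j0 m).+1%:R^-1 * 2 <= e.
  rewrite mulrC ler_pdivrMr // mulrC -ler_pdivrMr // ltW //.
  by apply: lt_le_trans (truncnS_gt _) _; rewrite ler_nat ltnS leq_maxl.
have mE h : part h (utr (cl (U ^+ m))) = moment mu h m.
  by rewrite uclsX (assoc_moment h muP).
rewrite -[complex.Re _]/(part true _) -[complex.Im _]/(part false _) !mE.
move: a b; move: (_.+1%:R^-1) je => r je a b.
apply: le_trans je; rewrite mulr_natr mulr2n; apply: lerD.
  have -> : (nfix (s k) m)%:R / (n k)%:R - moment mu true m =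
      ((nfix (s k) m)%:R - (n k)%:R * moment mu true m) / (n k)%:R.
    by field; rewrite gt_eqF.
  by rewrite normrM normfV (gtr0_norm nk) ler_pdivrMr.
by move: b; rewrite normrM (ger0_norm (ltW nk)) mulrC ler_pM2r.
Qed.

Lemma cvg_sum_seq (I : Type) (r : seq I) (Q : pred I) (f : I -> nat -> R) (l : I -> R)
    (F : set_system nat) : Filter F ->
  (forall i, f i @ F --> l i) ->
  (fun k => \sum_(i <- r | Q i) f i k) @ F --> \sum_(i <- r | Q i) l i.
Proof.
move=> FF fl; elim: r => [|i r IH].
  rewrite big_nil; under eq_fun do rewrite big_nil; exact: cvg_cst.
rewrite big_cons; under eq_fun do rewrite big_cons.
by case: (Q i) => //; apply: cvgD.
Qed.

(** A i is the limit of the proportion of points on i-cycles. Mass may escape to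
    longer and longer cycles, so the total is only bounded by 1. *)
Lemma cycle_proportions (s : forall k, {perm 'I_(n k)}) : exists A : nat -> R,
  [/\ forall i, 0 <= A i, A 0%N = 0, forall N, \sum_(0 <= i < N) A i <= 1 &
   forall m, (0 < m)%N -> (fun k => (nfix (s k) m)%:R / (n k)%:R) @ W -->
     \sum_(0 <= i < m.+1 | (i %| m)%N) A i].
Proof.
pose a i k : R := (oncyc (s k) i)%:R / (n k)%:R.
have nk k : 0 < (n k)%:R :> R by rewrite ltr0n.
have a0 i k : 0 <= a i k by rewrite divr_ge0.
have sa N k : \sum_(0 <= i < N) a i k <= 1.
  rewrite -mulr_suml ler_pdivrMr // mul1r -natr_sum ler_nat.
  exact: sum_oncyc_le.
have a1 i k : `|a i k| <= 1.
  rewrite ger0_norm //; apply: le_trans (sa i.+1 k).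
  by rewrite big_nat_recr //= lerDr; apply: sumr_ge0.
have FW : Filter W by apply: ultra_proper.
have ac i : a i @ W --> lim (a i @ W) by exact: ultra_bounded_cvg (a1 i).
exists (fun i => lim (a i @ W)); split => [i||N|m m0].
- by apply: (limr_ge (ac i)); exact: filterE.
- apply: cvg_lim => //; rewrite (_ : a 0%N = fun=> 0); first exact: cvg_cst.
  by apply/funext => k; rewrite /a oncyc0 mul0r.
- have c := @cvg_sum_seq _ (index_iota 0 N) xpredT _ _ W FW ac.
  rewrite -(cvg_lim _ c) //; apply: limr_le; first by apply/cvg_ex; eexists; exact: c.
  by apply: filterE => k; exact: sa.
have c := @cvg_sum_seq _ (index_iota 0 m.+1) (fun i => i %| m)%N _ _ W FW ac.
rewrite (_ : (fun k => _) = (fun k => \sum_(0 <= i < m.+1 | (i %| m)%N) a i k)) //.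
by apply/funext => k; rewrite nfix_oncyc // natr_sum mulr_suml.
Qed.

(** The measure of u is identified through its moments with a mixture of the
    lambda_i, whose truncations are convex combinations. *)
Lemma measure_of_perm (u : M) (mu : probability T R) v :
  associated_measure mu u -> uperm v -> conjugated u v ->
  closed_convex_hull (@lambdas R) mu.
Proof.
move=> muP [p pP pv] [w wU vE]; have mu1 : mu setT = 1%E := probability_setT mu.
have ex k : exists s : {perm 'I_(n k)}, p k = perm_mx s by exact/is_perm_mxP.
pose s k := projT1 (cid (ex k)).
have sE k : p k = perm_mx (s k) by rewrite /s; case: cid.
have [A [A0 A00 A1 Am]] := cycle_proportions s.
have mom h m : (0 < m)%N ->
    moment mu h m = h%:R * \sum_(0 <= i < m.+1 | (i %| m)%N) A i.
  move=> m0; rewrite (assoc_moment h muP m0) -(utr_conj _ _ wU) -vE -pv -uclsX.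
  rewrite (@utr_unique _ _ _ _ ((\sum_(0 <= i < m.+1 | (i %| m)%N) A i)%:C)).
    by case: h; rewrite /= ?mul1r ?mul0r.
  move=> e e0; have /cvgrPdist_lt/(_ e e0) := Am m m0.
  apply: filterS => k /= h1; rewrite linf_exprE sE ntr_perm.
  by rewrite -rmorphB normc_real distrC ltW.
have ser1 : exists L : R, series A @ \oo --> L.
  apply/cvg_ex; apply: nondecreasing_is_cvgn.
    by apply/nondecreasing_series.
  by exists 1 => _ [N _ <-]; exact: A1.
have [L serL] := ser1.
have L1 : L <= 1.
  rewrite -(cvg_lim _ serL) //; apply: limr_le; first by apply/cvg_ex; exists L.
  by apply: nearW => N; exact: A1.
(* The mass that escapes to longer and longer cycles goes to lambda_oo. *)
pose a i : R := if i is 0 then 1 - L else A i.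
have a0 i : 0 <= a i by case: i => //=; rewrite subr_ge0.
have sera N : series a N.+1 = series A N.+1 + (1 - L).
  rewrite /series /= !big_nat_recl //= A00 add0r addrC.
  by congr (_ + _); apply: eq_big_nat.
have cva : series a @ \oo --> (1 : R).
  have -> : (1 : R) = L + (1 - L) by rewrite addrC subrK.
  rewrite -cvg_shiftS; under eq_fun do rewrite /= sera.
  apply: cvgD; last exact: cvg_cst.
  by rewrite cvg_shiftS.
have [lam lamP] := lambda_measures R.
have lamE i X : lam i X = @lambda_ R i X by have [] := lamP i.
have lam1 i : lam i setT = 1%E by have [] := lamP i.
have lamM i h k : moment (lam i) h k = (h && (i %| k)%N)%:R by have [] := lamP i.
have [nu [nu1 nuM nuA]] := mixture lam1 lamM a0 cva.
have mm h m : moment mu h m = moment nu h m.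
  have [->|m0] := posnP m; first by rewrite !moment0.
  rewrite mom // nuM //; congr (_ * _).
  by apply: eq_bigr => -[|i] // d; move: d; rewrite dvd0n gtn_eqF.
have muE X : measurable X -> mu X = nu X.
  by move=> mX; exact: measure_eq_of_moments.
pose g i : B -> R^o := borel_values (@lambda_ R i).
have gS i : convex_hull (@borel_values R @` (@lambdas R) : set (B -> R^o)) (g i).
  apply: convex_hull_sub; exists (@lambda_ R i) => //.
  by case: i => [|i]; [right|left; exists i.+1].
have ser_le N : series a N <= 1.
  rewrite -(cvg_lim _ cva) //; apply: nondecreasing_cvgn_le.
    by apply/nondecreasing_series.
  by apply/cvg_ex; exists 1.
apply: (@closed_hull_seq _ _ _ (fun N =>
  \sum_(0 <= i < N) a i *: g i + (1 - \sum_(0 <= i < N) a i) *: g 0%N)) => [N|X].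
  by apply: convex_sum => //; [exact: convex_hull_convex|exact: ser_le].
have mX : measurable (set_val X) by exact: (set_mem (svalP X)).
have -> : borel_values mu X = fine (nu (set_val X)) by rewrite /borel_values muE.
have E : (fun N => (\sum_(0 <= i < N) a i *: g i +
    (1 - \sum_(0 <= i < N) a i) *: g 0%N) X) =
    (fun N => series (fun i => a i * fine (lam i (set_val X))) N +
      (1 - series a N) * g 0%N X).
  apply/funext => N; rewrite /series /= [LHS]/(_ + _) fct_sumE.
  congr (_ + _); apply: eq_bigr => i _.
  by rewrite lamE.
have c : (fun N => series (fun i => a i * fine (lam i (set_val X))) N +
    (1 - series a N) * g 0%N X) @ \oo --> fine (nu (set_val X)) + (1 - 1) * g 0%N X.
  apply: cvgD; first exact: nuA.
  apply: cvgM; last exact: cvg_cst.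
  by apply: cvgB => //; exact: cvg_cst.
rewrite subrr mul0r addr0 -E in c; exact: c.
Qed.

End Directions.
Theorem theorem4p3 (R : realType) (omega : free_ultrafilter) (n : nat -> nat)
    (n_gt0 : forall k, (0 < n k)%N) (n_oo : n @ \oo --> \oo)
    (u : uprod R omega n) (u_unitary : unitary u)
    (mu_u : probability (borel_circle R) R)
    (mu_uP : associated_measure mu_u u) :
  (exists2 v, uperm v & conjugated u v) <->
  closed_convex_hull (@lambdas R) mu_u.
Proof.
split=> [[v v_perm uv]|hull]; first exact: (measure_of_perm n_gt0 mu_uP v_perm uv).
exact: (perm_of_measure n_gt0 n_oo u_unitary mu_uP hull).
Qed.
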